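(* Let $\mathbb{F}=\mathbb{C}$, let $W=\wedge^2(\mathfrak{g}_{-1})^*\otimes\mathfrak{g}_{-2}$ with $\mathfrak{g}_{-1}=\mathbb{C}^6$, $\mathfrak{g}_{-2}=\mathbb{C}^3$, and let $S=GL(\mathfrak{g}_{-1}^* )\times GL(\mathfrak{g}_{-2})$. Let $U\subset W$ be the set of all $l\in W$ for which there exists $s\in S$ such that $\theta(s\cdot l)=0$ and the $S$-orbit of $s\cdot l$ is maximally transverse to the kernel of $\theta$ at $s\cdot l$. Then $U$ is the union of the families 1, 2 and 5.
   Context: **The bracket $k$ and the map $\theta$.** Write $\mathfrak{g}_{-1}=E\oplus F$ with bases $e_1,e_2,e_3$ of $E$ and $f_1,f_2,f_3$ of $F$, dual bases $e^i$, $f^i$, and let $g_1,g_2,g_3$ be a basis of $\mathfrak{g}_{-2}$ (identified with $E\wedge E=F\wedge F$ via $g_1=e_2\wedge e_3$ and cyclically), with dual basis $g^1,g^2,g^3$. With $\epsilon_{ijq}$ the alternating symbol and summation over repeated indices, $$k=\epsilon_{ijq}(e^i\wedge f^j+f^i\wedge e^j)\otimes g_q\in W,\qquad k^*=\epsilon_{ijq}(e_i\wedge f_j+f_i\wedge e_j)\otimes g^q\in W^*.$$ Let $\mathfrak{s}=\mathfrak{gl}(\mathfrak{g}_{-1}^* )\oplus\mathfrak{gl}(\mathfrak{g}_{-2})$ and define $\partial^*=\alpha+\beta:W\to\mathfrak{s}$ in components (lower-case indices for $\mathfrak{g}_{-1}$, upper-case for $\mathfrak{g}_{-2}$) by $(\alpha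 l)^i_j=\sum_{I,q}l^I_{qi}(k^* )^{qj}_I\in\mathfrak{gl}(\mathfrak{g}_{-1}^* )$ and $(\beta l)^I_J=-\tfrac12\sum_{i,j}l^I_{ij}(k^* )^{ij}_J\in\mathfrak{gl}(\mathfrak{g}_{-2})$. Put $\theta(l)=\partial^*l-\partial^*k$. ''Maximally transverse to the kernel of $\theta$'' at a point $p$ means that locally $S\cdot p/\ker\theta\cong W/\ker\theta$, i.e. the tangent space at $p$ of the orbit $S\cdot p$ together with $\ker\partial^*$ (the direction of the affine subspace $\{\theta=0\}$) spans $W$. **Semisimple and nilpotent parts.** Let $S'=SL(\mathfrak{g}_{-1}^* )\times SL(\mathfrak{g}_{-2})$ with Lie algebra $\mathfrak{s}'$. The complex simple Lie algebra $\mathfrak{e}_7$ has a $\mathbb{Z}/3$-grading $\mathfrak{e}_7=\mathfrak{h}_{-1}\oplus\mathfrak{h}_0\oplus\mathfrak{h}_1$ with $\mathfrak{h}_{-1}=W^*$, $\mathfrak{h}_0=\mathfrak{s}'$, $\mathfrak{h}_1=W$, $\mathfrak{h}_0$ acting naturally on $W,W^*$. An element of $W=\mathfrak{h}_1$ is semisimple (nilpotent) if it is so in $\mathfrak{e}_7$; each $l\in W$ is uniquely $l=\sigma+\nu$ with $\sigma,\nu\in W$, $\sigma$ semisimple, $\nu$ nilpotent, $[\sigma,\nu]=0$. **Families.** Let $a^1,\dots,a^6$ be a basis of $\mathfrak{g}_{-1}^*$, $b_1,b_2,b_3$ a basis of $\mathfrak{g}_{-2}$, and $$u_1=a^1\wedge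 a^2\otimes b_1+a^3\wedge a^4\otimes b_2+a^5\wedge a^6\otimes b_3,$$ $$u_2=a^5\wedge a^4\otimes b_1+a^1\wedge a^6\otimes b_2+a^3\wedge a^2\otimes b_3,$$ $$u_3=a^3\wedge a^6\otimes b_1+a^5\wedge a^2\otimes b_2+a^1\wedge a^4\otimes b_3.$$ An element $l\in W$ belongs to a given family if its semisimple part is $S'$-conjugate to an element of the following form (with complex parameters): Family 1: $\lambda_1u_1+\lambda_2u_2+\lambda_3u_3$ with $\lambda_i\ne0$, $\lambda_i^3\neq\lambda_j^3$ for $i\ne j$, and $(\lambda_1^3+\lambda_2^3+\lambda_3^3)^3-(3\lambda_1\lambda_2\lambda_3)^3\neq0$ (all elements of this family are semisimple). Family 2: $\lambda u_2+\mu u_3$ with $\lambda,\mu,\lambda^3\pm\mu^3\neq0$. Family 3: $\lambda u_1+\mu(u_2+u_3)$ with $\lambda,\mu,\lambda^3-\mu^3,\lambda^3+8\mu^3\ne0$. Family 4: $\lambda(u_2+u_3)$, $\lambda\ne0$. Family 5: $\lambda(u_3-u_2)$, $\lambda\neq0$. Family 6: $\lambda u_1$, $\lambda\ne0$. Family 7: $0$ (i.e. $l$ nilpotent). Every element of $W$ lies in exactly one family. *)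

(* Defs.v *)
From HB Require Import structures.
From mathcomp Require Import all_boot all_order all_algebra.
From mathcomp Require Import complex.
From mathcomp Require Import boolp classical_sets functions reals.
From mathcomp Require Import topology normedtype derive.
From mathcomp Require Import ring.

Set Implicit Arguments.
Unset Strict Implicit.
Unset Printing Implicit Defensive.

Import Order.TTheory GRing.Theory Num.Theory.
Import numFieldNormedType.Exports.

Local Open Scope classical_set_scope.
Local Open Scope ring_scope.

(* With a basis of g_{-1} (dimension 6) and of g_{-2} (dimension 3), a tensor
   l in (g_{-1})^* (x) (g_{-1})^* (x) g_{-2} is the family of 6 x 6 matrices
   l I = (l^I_{ij})_{i,j}.  Elements of the dual space, with components
   m_I^{ij}, have the same type. *)
Notation tensor_type C := {ffun 'I_3 -> 'M[C]_6}.

Section Defs.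
Variable C : numFieldType.
Local Notation tens := (tensor_type C).

(* W = Wedge^2 (g_{-1})^* (x) g_{-2}, and likewise W^*. *)
Definition W : set tens := [set l : tens | forall I, (l I)^T = - l I].

(* Covectors are row vectors of coordinates;
   (x /\ y)_{ij} = x_i y_j - x_j y_i. *)
Definition wedge (x y : 'rV[C]_6) : 'M[C]_6 := x^T *m y - y^T *m x.

Definition tensor (w : 'M[C]_6) (b : 'rV[C]_3) : tens :=
  [ffun I => b 0 I *: w].

(* The alternating symbol: sign of t if t is a permutation, 0 otherwise. *)
Definition eps n (t : n.-tuple 'I_n) : C :=
  \det (\matrix_(i, j) (tnth t i == j)%:R).

(* g_{-1} = E (+) F, where E is spanned by the first three vectors of the
   standard basis of C^6 and F by the last three.  In the dual bases, e_i and
   e^i have the same coordinates, and so have f_i, f^i and g_i, g^i. *)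
Definition ebasis (i : 'I_3) : 'rV[C]_6 := delta_mx 0 (lshift 3 i : 'I_6).
Definition fbasis (i : 'I_3) : 'rV[C]_6 := delta_mx 0 (rshift 3 i : 'I_6).
Definition gbasis (i : 'I_3) : 'rV[C]_3 := delta_mx 0 i.

Definition kbr : tens :=
  \sum_i \sum_j \sum_q eps [tuple i; j; q] *:
    tensor (wedge (ebasis i) (fbasis j) + wedge (fbasis i) (ebasis j))
           (gbasis q).

Definition kstar : tens :=
  \sum_i \sum_j \sum_q eps [tuple i; j; q] *:
    tensor (wedge (ebasis i) (fbasis j) + wedge (fbasis i) (ebasis j))
           (gbasis q).

(* \partial^* = alpha + beta : W -> gl(g_{-1}^* ) (+) gl(g_{-2}). *)
Definition alpha (l : tens) : 'M[C]_6 :=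
  \matrix_(i, j) \sum_I \sum_q l I q i * kstar I q j.
Definition beta (l : tens) : 'M[C]_3 :=
  \matrix_(I, J) (- 2^-1 * \sum_i \sum_j l I i j * kstar J i j).
Definition dstar (l : tens) : 'M[C]_6 * 'M[C]_3 := (alpha l, beta l).
Definition theta (l : tens) : 'M[C]_6 * 'M[C]_3 := dstar l - dstar kbr.

(* Action of (g, h) in GL(g_{-1}^* ) x GL(g_{-2}). *)
Definition act (g : 'M[C]_6) (h : 'M[C]_3) (l : tens) : tens :=
  [ffun I => \sum_J h I J *: (g *m l J *m g^T)].

(* Tangent space at p of the orbit of p: the image of the differential at the
   identity of the orbit map (g, h) |-> (g, h).p (see tangent_orbitE). *)
Definition tangent_orbit (p : tens) : set tens :=
  [set v : tens | exists X Y, forall I i j,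
     is_derive (0 : C) 1
       (fun t : C => act (1%:M + t *: X) (1%:M + t *: Y) p I i j : C)
       (v I i j)].

Definition max_transverse (p : tens) : Prop :=
  forall w, W w -> exists v n,
    [/\ tangent_orbit p v, W n, dstar n = 0 & w = v + n].

Definition U : set tens := [set l : tens | W l /\ exists g h,
  [/\ g \in unitmx, h \in unitmx, theta (act g h l) = 0
    & max_transverse (act g h l)]].

(* The Lie algebra e_7 = W^* (+) (sl_6 (+) sl_3) (+) W. *)

(* Natural action of gl_6 (+) gl_3 on W, and its dual action on W^*. *)
Definition lact (X : 'M[C]_6) (Y : 'M[C]_3) (l : tens) : tens :=
  [ffun I => X *m l I + l I *m X^T + \sum_J Y I J *: l J].
Definition lact_dual (X : 'M[C]_6) (Y : 'M[C]_3) (m : tens) : tens :=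
  lact (- X^T) (- Y^T) m.

Lemma act_taylor (X : 'M[C]_6) (Y : 'M[C]_3) (p : tens) : exists q r : tens,
  forall t : C, act (1%:M + t *: X) (1%:M + t *: Y) p =
    p + t *: lact X Y p + t ^+ 2 *: q + t ^+ 3 *: r.
Proof.
pose D l : 'M[C]_6 := X *m l + l *m X^T; pose Q l : 'M[C]_6 := X *m l *m X^T.
exists [ffun I => Q (p I) + \sum_J Y I J *: D (p J)].
exists [ffun I => \sum_J Y I J *: Q (p J)] => t.
apply/ffunP => I; rewrite !ffunE.
have E J : (1%:M + t *: X) *m p J *m (1%:M + t *: X)^T
    = p J + t *: D (p J) + t ^+ 2 *: Q (p J).
  rewrite linearD linearZ /= trmx1 mulmxDl mul1mx mulmxDr mulmx1.
  rewrite -!scalemxAl -scalemxAr mulmxDl -scalemxAl.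
  by rewrite /D /Q !scalerDr scalerA -expr2 !addrA; congr (_ + _); rewrite addrAC.
pose A J := p J + t *: D (p J) + t ^+ 2 *: Q (p J).
transitivity (\sum_J ((I == J)%:R *: A J + t *: (Y I J *: A J))).
  by apply: eq_bigr => J _; rewrite E !mxE scalerDl scalerA.
rewrite big_split /= (bigD1 I) //= eqxx scale1r big1 ?addr0; last first.
  by move=> J; rewrite eq_sym => /negbTE ->; rewrite scale0r.
have -> : \sum_J t *: (Y I J *: A J) = t *: (\sum_J Y I J *: p J) +
    t ^+ 2 *: (\sum_J Y I J *: D (p J)) + t ^+ 3 *: (\sum_J Y I J *: Q (p J)).
  rewrite !scaler_sumr -!big_split /=; apply: eq_bigr => J _.
  rewrite /A !scalerDr !scalerA.
  by congr (_ *: _ + (_ *: _ + _ *: _) + _ *: _); ring.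
rewrite /A /D !scalerDr.
rewrite -!addrA; congr (_ + (_ + (_ + _))).
by rewrite [RHS]addrCA; congr (_ + _); rewrite [RHS]addrCA.
Qed.

Lemma tangent_orbitE (p v : tens) :
  tangent_orbit p v <-> exists X Y, v = lact X Y p.
Proof.
have der X Y I i j : is_derive (0 : C) 1
    (fun t : C => act (1%:M + t *: X) (1%:M + t *: Y) p I i j : C)
    (lact X Y p I i j).
  have [q [r E]] := act_taylor X Y p.
  pose f : C -> C := cst (p I i j) + id * (cst (lact X Y p I i j)
    + id * (cst (q I i j) + id * cst (r I i j))).
  have -> : (fun t : C => act (1%:M + t *: X) (1%:M + t *: Y) p I i j) = f.
    by apply/funext => t; rewrite E /f !fctE !ffunE !mxE; ring.
  by apply: is_derive_eq; rewrite !fctE /GRing.scale /=; ring.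
split=> [[X [Y dv]]|[X [Y ->]]]; last by exists X, Y => I i j; exact: der.
exists X, Y; apply/ffunP => I; apply/matrixP => i j.
have := @derive_val _ _ _ _ _ _ _ (dv I i j).
by rewrite (@derive_val _ _ _ _ _ _ _ (der X Y I i j)).
Qed.
(* The wedge product of two 2-forms, seen as a bivector through
   Wedge^4 (g_{-1})^* = Wedge^2 g_{-1}; and vice versa. *)
Definition wedge2 (p q : 'M[C]_6) : 'M[C]_6 :=
  \matrix_(a, b) (4^-1 * \sum_c \sum_d \sum_e \sum_f
    eps [tuple a; b; c; d; e; f] * p c d * q e f).

(* The brackets W x W -> W^* and W^* x W^* -> W. *)
Definition cross (l m : tens) : tens :=
  [ffun K => \sum_I \sum_J eps [tuple I; J; K] *: wedge2 (l I) (m J)].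

Definition tracefree n (A : 'M[C]_n) : 'M[C]_n := A - (\tr A / n%:R)%:M.

(* The bracket W x W^* -> sl_6 (+) sl_3. *)
Definition pair6 (l m : tens) : 'M[C]_6 := tracefree (\sum_I l I *m m I).
Definition pair3 (l m : tens) : 'M[C]_3 :=
  tracefree (\matrix_(I, J) (2^-1 * \tr (l I *m m J))).

(* (m, (X, Y), l) : degrees -1, 0 and 1. *)
Local Notation e7_carrier := (tens * ('M[C]_6 * 'M[C]_3) * tens)%type.

Definition e7 : set e7_carrier := [set x : e7_carrier | let: (m, (X, Y), l) := x in
  [/\ W m, \tr X = 0, \tr Y = 0 & W l]].

(* The relative normalizations of the components are forced, up to rescaling
   W and W^*, by the Jacobi identity. *)
Definition e7_bracket (x x' : e7_carrier) : e7_carrier :=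
  let: (m, (X, Y), l) := x in
  let: (m', (X', Y'), l') := x' in
  (lact_dual X Y m' - lact_dual X' Y' m + cross l l',
   (X *m X' - X' *m X + pair6 l m' - pair6 l' m,
    Y *m Y' - Y' *m Y + pair3 l m' - pair3 l' m),
   lact X Y l' - lact X' Y' l + cross m m').

Definition e7_of (l : tens) : e7_carrier := (0, (0, 0), l).

(* ad x is diagonalizable: e_7 is the sum of the eigenspaces of ad x. *)
Definition ad_semisimple (x : e7_carrier) : Prop :=
  forall y, e7 y -> exists s : seq e7_carrier,
    y = \sum_(z <- s) z /\
    {in s, forall z, e7 z /\ exists c : C, e7_bracket x z = c *: z}.

Definition ad_nilpotent (x : e7_carrier) : Prop :=
  exists n, forall y, e7 y -> iter n (e7_bracket x) y = 0.

Definition jordan_parts (l sigma nu : tens) : Prop :=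
  [/\ W sigma, W nu, l = sigma + nu
    & [/\ ad_semisimple (e7_of sigma), ad_nilpotent (e7_of nu)
        & e7_bracket (e7_of sigma) (e7_of nu) = 0]].

(* The elements of W whose semisimple part is S'-conjugate to an element
   of P, where S' = SL(g_{-1}^* ) x SL(g_{-2}). *)
Definition family (P : set tens) : set tens :=
  [set l : tens | W l /\ exists sigma nu, jordan_parts l sigma nu /\
     exists g h, [/\ \det g = 1, \det h = 1 & P (act g h sigma)]].

(* The basis a^1, ..., a^6 of g_{-1}^* is given by the rows of a, and the basis
   b_1, b_2, b_3 of g_{-2} by the rows of b. *)
Section Families.
Variables (a : 'M[C]_6) (b : 'M[C]_3).

Let aa (i j : nat) := wedge (row (inord i.-1) a) (row (inord j.-1) a).
Let bb (i : nat) := row (inord i.-1) b.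

Definition u1 : tens :=
  tensor (aa 1 2) (bb 1) + tensor (aa 3 4) (bb 2) + tensor (aa 5 6) (bb 3).
Definition u2 : tens :=
  tensor (aa 5 4) (bb 1) + tensor (aa 1 6) (bb 2) + tensor (aa 3 2) (bb 3).
Definition u3 : tens :=
  tensor (aa 3 6) (bb 1) + tensor (aa 5 2) (bb 2) + tensor (aa 1 4) (bb 3).

Definition family1 : set tens := family [set l : tens | exists x1 x2 x3 : C,
  [/\ l = x1 *: u1 + x2 *: u2 + x3 *: u3,
      [/\ x1 != 0, x2 != 0 & x3 != 0],
      [/\ x1 ^+ 3 != x2 ^+ 3, x1 ^+ 3 != x3 ^+ 3 & x2 ^+ 3 != x3 ^+ 3]
    & (x1 ^+ 3 + x2 ^+ 3 + x3 ^+ 3) ^+ 3 - (3 * x1 * x2 * x3) ^+ 3 != 0]].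

Definition family2 : set tens := family [set l : tens | exists x y : C,
  [/\ l = x *: u2 + y *: u3, x != 0, y != 0
    & (x ^+ 3 + y ^+ 3 != 0) && (x ^+ 3 - y ^+ 3 != 0)]].

Definition family5 : set tens := family [set l : tens | exists x : C,
  l = x *: (u3 - u2) /\ x != 0].

End Families.

End Defs.

(* Main.v *)
From Stdlib Require Import ZArith.
Require Import Defs.
From mathcomp Require Import all_boot all_order all_algebra.
From mathcomp Require Import fingroup perm complex.
From mathcomp Require Import classical_sets reals.
From mathcomp Require Import ring zify ssrZ.

(* A zero of theta is k plus a tensor symmetric in its three indices, that is,
   plus a ternary cubic c, and GL_3 acts on these compatibly with its action on
   cubics.  By means of flexes and the Weierstrass form, every ternary cubic is
   GL_3-equivalent to one of
     (F) c1 x^3 + c2 y^3 + c3 z^3 + 6 d x y z,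
     (N) a y^2 z + r(x, y) with r a binary cubic.
   In case (F), k + c has the coefficients c1, c2, c3 on the three terms of u1,
   plus l2 u2 + l3 u3 with l3 - l2 = 4.  Transversality is then a linear system
   splitting into small blocks; with m^3 = c1 c2 c3 and w a primitive cube root
   of 1, it holds if and only if l2, l3, l2^3 - l3^3, m^3 - l2^3, m^3 - l3^3 and
   m^3 + (w l2 + w^2 l3)^3, m^3 + (w^2 l2 + w l3)^3 do not vanish.  If m = 0, the
   u1-part is nilpotent and commutes with l2 u2 + l3 u3: this is family 2, or
   family 5 when l2 + l3 = 0.  If m^3 + (l2 + l3)^3 = 0, the cubic is a triangle,
   and taking its lines as coordinates gives m = 0.  Otherwise scaling makes
   c1 = c2 = c3 = m, and the conditions are those of family 1.
   In case (N), the cubic part has positive weights for a torus of SL_3 fixing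
   k, hence is nilpotent and commutes with k, a member of family 5; transversality
   holds at k, and also at k + c because c raises the weights.

   Conversely, the part commuting with the Cartan element s consists, in
   families 1 and 2, of the coefficients on the three terms of u1 and multiples
   of u2 and u3, and in family 5 of a multiple of s plus a ternary cubic.  If p
   is nilpotent, an eigenvalue of (ad p)^3 on a suitable vector vanishes; this
   leaves only the coefficients on u1, with product 0, respectively the cubic,
   and transversality is the case already treated. *)

Set Implicit Arguments.
Unset Strict Implicit.
Unset Printing Implicit Defensive.

Import Order.TTheory GRing.Theory Num.Theory.
Local Open Scope ring_scope.

(** Membership in a family is a statement on adjoint actions in dimension 133. Semisimplicity is
    proved on the span of u_1, u_2, u_3: with denominators cleared, their adjoint actions are
    integer matrices, and a computation shows that they commute and are annihilated by one separable
    polynomial. Nilpotency is proved from a torus of SL_6 x SL_3 for which the element has positive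
    weights, and is exploited through (ad p)^3, which preserves the Z/3-degree and so can have
    eigenvectors inside sl_6. Both notions are moved along orbits of GL_6 x GL_3, where the bracket
    W x W -> W^* is preserved only up to det g det h: a cube root of this number, used to rescale W
    and W^*, restores an automorphism, and a scalar factor changes neither notion. Passing from GL
    to SL likewise only rescales the parameters of a family. Tensors are handled as functions of
    natural numbers, on which every identity between entries unfolds to an identity for [ring] or
    [field]. *)

(** * Indices and explicit sums *)

Definition j3 (n : nat) : 'I_3 :=
  match n with
  | 0 => @Ordinal 3 0 isT | 1 => @Ordinal 3 1 isT | _ => @Ordinal 3 2 isT
  end.
Definition j6 (n : nat) : 'I_6 :=
  match n with
  | 0 => @Ordinal 6 0 isT | 1 => @Ordinal 6 1 isT | 2 => @Ordinal 6 2 isT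
  | 3 => @Ordinal 6 3 isT | 4 => @Ordinal 6 4 isT | _ => @Ordinal 6 5 isT
  end.

Lemma ord3E (i : 'I_3) : i = j3 i.
Proof. by case: i => [[|[|[|i]]] Hi] //=; exact: val_inj. Qed.

Lemma ord6E (i : 'I_6) : i = j6 i.
Proof. by case: i => [[|[|[|[|[|[|i]]]]]] Hi] //=; exact: val_inj. Qed.

(** Unlike a big operator, this sum unfolds under [cbv] to explicit terms, ready for [ring]. *)
Fixpoint sm (V : nmodType) (n : nat) (F : nat -> V) : V :=
  if n is n'.+1 then sm n' F + F n' else 0.

Lemma big_sm (V : nmodType) (n : nat) (F : nat -> V) : \sum_(i < n) F i = sm n F.
Proof. by elim: n => [|n IHn]; rewrite ?big_ord0 // big_ord_recr IHn. Qed.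

Lemma big_sm3 (V : nmodType) (F : 'I_3 -> V) :
  \sum_i F i = sm 3 (fun i => F (j3 i)).
Proof. by rewrite -big_sm; apply: eq_bigr => i _; rewrite -ord3E. Qed.

Lemma big_sm6 (V : nmodType) (F : 'I_6 -> V) :
  \sum_i F i = sm 6 (fun i => F (j6 i)).
Proof. by rewrite -big_sm; apply: eq_bigr => i _; rewrite -ord6E. Qed.

Lemma eq_sm (V : nmodType) (n : nat) (F G : nat -> V) :
  (forall i, (i < n)%N -> F i = G i) -> sm n F = sm n G.
Proof.
elim: n => [|n IHn] //= FG; rewrite IHn => [|i ltin]; first by rewrite FG.
by rewrite FG // ltnW.
Qed.

(** * The alternating symbol as the sign of a Vandermonde product *)

Definition zn (n : nat) : Z := Z.of_nat n.

(* The sign of the Vandermonde product, hence of the tuple if it is a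
   permutation; 0 if an entry is repeated. *)
Fixpoint sgl (s : seq nat) : Z :=
  if s is x :: s' then
    foldr (fun y r => Z.sgn (zn y - zn x) * r) (sgl s') s'
  else 1.

Fixpoint vdm (s : seq nat) : Z :=
  if s is x :: s' then foldr (fun y r => (zn y - zn x) * r) (vdm s') s' else 1.

Section Eps.
Variable C : numFieldType.

Definition zC (z : Z) : C := (int_of_Z z)%:~R.

Lemma zC0 : zC 0 = 0. Proof. by []. Qed.
Lemma zC1 : zC 1 = 1. Proof. by []. Qed.
Lemma zCM (x y : Z) : zC (x * y) = zC x * zC y.
Proof. by rewrite /zC rmorphM /= intrM. Qed.
Lemma zCD (x y : Z) : zC (x + y) = zC x + zC y.
Proof. by rewrite /zC rmorphD /= intrD. Qed.
Lemma zCN (x : Z) : zC (- x) = - zC x.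
Proof. by rewrite /zC rmorphN /= rmorphN. Qed.
Lemma zCB (x y : Z) : zC (x - y) = zC x - zC y.
Proof. by rewrite zCD zCN. Qed.
Lemma zC_nat (n : nat) : zC (zn n) = n%:R.
Proof. by rewrite /zC /zn; case: n => [|n] //=; rewrite SuccNat2Pos.id_succ. Qed.

(** The Vandermonde matrix of 0, ..., n - 1 times the transposed 0-1 matrix of [t] is the
    Vandermonde matrix of the entries of [t]; take determinants. *)
Lemma vandermonde_eps (n : nat) (t : n.-tuple 'I_n) :
  \prod_(i < n) \prod_(j < n | (i < j)%N)
     ((tnth t j : nat)%:R - (tnth t i : nat)%:R)
  = eps C t * \prod_(i < n) \prod_(j < n | (i < j)%N)
     ((j : nat)%:R - (i : nat)%:R).
Proof.
have E (s : 'I_n -> 'I_n) : \prod_(i < n) \prod_(j < n | (i < j)%N)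
     ((s j : nat)%:R - (s i : nat)%:R : C)
    = \det (Vandermonde n (\row_j (s j : nat)%:R : 'rV[C]_n)).
  by rewrite det_Vandermonde; do 2!apply: eq_bigr => ? _; rewrite !mxE.
rewrite (E (tnth t)) (E id) /eps mulrC -[X in _ * X]det_tr -det_mulmx.
congr (\det _); apply/matrixP => i j; rewrite !mxE.
rewrite (bigD1 (tnth t j)) //= !mxE eqxx mulr1 big1 ?addr0 // => k.
by rewrite !mxE eq_sym => /negbTE ->; rewrite mulr0.
Qed.

Lemma eps_zC3 (a b c : 'I_3) :
  eps C [tuple a; b; c] = zC (sgl [:: val a; val b; val c]).
Proof.
set z := sgl _; have := vandermonde_eps [tuple a; b; c].
under [LHS]eq_bigr => i _ do rewrite big_mkcond !big_ord_recl big_ord0.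
under [X in _ = _ * X]eq_bigr => i _ do rewrite big_mkcond !big_ord_recl big_ord0.
rewrite !big_ord_recl !big_ord0 /= !mul1r !mulr1 !(tnth_nth a) /= => E.
(* The Vandermonde product of 0, 1, 2 is 2. *)
have E2 : eps C [tuple a; b; c] * zC (zn 2) = zC (vdm [:: val a; val b; val c]).
  rewrite /= !zCM !zCB !zC_nat zC1 mulr1 mulrA E /bump /=.
  by ring.
have : vdm [:: val a; val b; val c] = z * zn 2.
  by rewrite {}/z; move: a b c {E E2} => [[|[|[|a]]] ?] // [[|[|[|b]]] ?] // [[|[|[|c]]] ?].
move=> E3; apply: (@mulIf _ (zC (zn 2))); first by rewrite zC_nat pnatr_eq0.
by rewrite E2 E3; exact: zCM.
Qed.

Let r6 := iota 0 6.

(** All 6^6 tuples are tested by computation. The constant is the Vandermonde product 1! 2! 3! 4! 5!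
    of 0, ..., 5. *)
Lemma vdm6 :
  all (fun a => all (fun b => all (fun c => all (fun d => all (fun e => all
    (fun f => vdm [:: a; b; c; d; e; f]
      == sgl [:: a; b; c; d; e; f] * (zn 2 * zn 6 * zn 24 * zn 120))
  r6) r6) r6) r6) r6) r6.
Proof. by vm_compute. Qed.

Lemma eps_zC6 (a b c d e f : 'I_6) :
  eps C [tuple a; b; c; d; e; f]
  = zC (sgl [:: val a; val b; val c; val d; val e; val f]).
Proof.
set s := [:: val a; val b; val c; val d; val e; val f]; set z := sgl s.
have := vandermonde_eps [tuple a; b; c; d; e; f].
under [LHS]eq_bigr => i _ do rewrite big_mkcond !big_ord_recl big_ord0.
under [X in _ = _ * X]eq_bigr => i _ do rewrite big_mkcond !big_ord_recl big_ord0.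
rewrite !big_ord_recl !big_ord0 /= !mul1r !mulr1 !(tnth_nth a) /= => E.
have E2 : eps C [tuple a; b; c; d; e; f] * zC ((zn 2 * zn 6 * zn 24 * zn 120)) = zC (vdm s).
  rewrite [vdm s]/= !zCM !zCB !zC_nat zC1 mulr1.
  rewrite -!mulrA in E; rewrite E /bump /=.
  by ring.
have E3 : vdm s = z * (zn 2 * zn 6 * zn 24 * zn 120).
  have In (x : 'I_6) : val x \in r6 by rewrite mem_iota /=.
  have /allP/(_ _ (In a))/allP/(_ _ (In b))/allP/(_ _ (In c)) := vdm6.
  by move=> /allP/(_ _ (In d))/allP/(_ _ (In e))/allP/(_ _ (In f))/eqP.
apply: (@mulIf _ (zC (zn 2 * zn 6 * zn 24 * zn 120))).
  by rewrite !zCM !zC_nat !mulf_neq0 // pnatr_eq0.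
by rewrite E2 E3; exact: zCM.
Qed.
End Eps.

(** * Coordinate formulas for the brackets over a commutative ring *)

Section Formulas.
Variable T : comPzRingType.

Fixpoint lt_ (m n : nat) : bool :=
  if n is n'.+1 then (if m is m'.+1 then lt_ m' n' else true) else false.

Lemma lt_E m n : lt_ m n = (m < n)%N.
Proof. by elim: m n => [|m IHm] [|n] //=; rewrite IHm. Qed.

(** Only the entries above the diagonal are read, so that every function of two indices defines a
    skew matrix. *)
Definition sk (f : nat -> nat -> T) (i j : nat) : T :=
  if lt_ i j then f i j else if lt_ j i then - f j i else 0.

(** The 24 terms of [wedge2] on four fixed indices fall into six groups of four equal ones, which
    cancels the factor 1/4. The sign [s] is that of the permutation (a, b, c, d, e, f). *)
Definition wedge4 (p q : nat -> nat -> T) (s : T) (c d e f : nat) : T :=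
  s * (p c d * q e f - p c e * q d f + p c f * q d e
     + q c d * p e f - q c e * p d f + q c f * p d e).

Definition wedgeF (p q : nat -> nat -> T) (a b : nat) : T :=
  match a, b with
  | 0, 1 => wedge4 p q 1 2 3 4 5 | 0, 2 => wedge4 p q (-1)%R 1 3 4 5 | 0, 3 => wedge4 p q 1 1 2 4 5
  | 0, 4 => wedge4 p q (-1)%R 1 2 3 5 | 0, 5 => wedge4 p q 1 1 2 3 4
  | 1, 2 => wedge4 p q 1 0 3 4 5 | 1, 3 => wedge4 p q (-1)%R 0 2 4 5 | 1, 4 => wedge4 p q 1 0 2 3 5
  | 1, 5 => wedge4 p q (-1)%R 0 2 3 4
  | 2, 3 => wedge4 p q 1 0 1 4 5 | 2, 4 => wedge4 p q (-1)%R 0 1 3 5 | 2, 5 => wedge4 p q 1 0 1 3 4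
  | 3, 4 => wedge4 p q 1 0 1 2 5 | 3, 5 => wedge4 p q (-1)%R 0 1 2 4
  | 4, 5 => wedge4 p q 1 0 1 2 3
  | _, _ => 0
  end.

Definition crossF (f g : nat -> nat -> nat -> T) (K a b : nat) : T :=
  match K with
  | 0 => wedgeF (f 1%N) (g 2%N) a b - wedgeF (f 2%N) (g 1%N) a b
  | 1 => wedgeF (f 2%N) (g 0%N) a b - wedgeF (f 0%N) (g 2%N) a b
  | _ => wedgeF (f 0%N) (g 1%N) a b - wedgeF (f 1%N) (g 0%N) a b
  end.

Definition lactF (X Y : nat -> nat -> T) (f : nat -> nat -> nat -> T)
    (I i j : nat) : T :=
  sm 6 (fun k => X i k * sk (f I) k j + sk (f I) i k * X j k)
  + sm 3 (fun J => Y I J * sk (f J) i j).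

Definition pairF (f g : nat -> nat -> nat -> T) (i j : nat) : T :=
  sm 3 (fun I => sm 6 (fun k => sk (f I) i k * sk (g I) k j)).
Definition pairF3 (f g : nat -> nat -> nat -> T) (I J : nat) : T :=
  sm 6 (fun i => sm 6 (fun k => sk (f I) i k * sk (g J) k i)).
End Formulas.

(** * Tensors and brackets in coordinates *)

Section Coord.
Variable C : numFieldType.
Local Notation tens := (tensor_type C).

Definition mk6 (f : nat -> nat -> C) : 'M[C]_6 := \matrix_(i, j) f i j.
Definition mk3 (f : nat -> nat -> C) : 'M[C]_3 := \matrix_(i, j) f i j.
Definition mkW (f : nat -> nat -> nat -> C) : tens :=
  [ffun I : 'I_3 => mk6 (sk (f I))].

Lemma skN (f : nat -> nat -> C) i j : sk f j i = - sk f i j.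
Proof.
rewrite /sk !lt_E; case: ltngtP => _; by rewrite ?oppr0 ?opprK.
Qed.

Lemma mkW_W f : W (mkW f).
Proof. by move=> I; apply/matrixP => i j; rewrite !ffunE !mxE skN. Qed.

Lemma W_skew (l : tens) : W l -> forall I i j, l I j i = - l I i j.
Proof. by move=> Wl I i j; have /matrixP/(_ i j) := Wl I; rewrite !mxE. Qed.

Lemma W_mkW (l : tens) : W l -> exists f, l = mkW f.
Proof.
move=> Wl; exists (fun I i j => l (j3 I) (j6 i) (j6 j)).
apply/ffunP => I; rewrite ffunE; apply/matrixP => i j.
rewrite !mxE /sk !lt_E -!ord6E -ord3E.
case: ltngtP => [_|_|/val_inj ->] //.
  by rewrite -(W_skew Wl).
by have := W_skew Wl I j j; move/eqP; rewrite -addr_eq0 -mulr2n mulrn_eq0 /= => /eqP.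
Qed.

Lemma mkW_eq (f g : nat -> nat -> nat -> C) :
  (forall I i j, (I < 3)%N -> (i < j)%N -> (j < 6)%N -> f I i j = g I i j) ->
  mkW f = mkW g.
Proof.
move=> fg; apply/ffunP => I; rewrite !ffunE; apply/matrixP => i j.
by rewrite !mxE /sk !lt_E; case: ltngtP => // ij; rewrite fg.
Qed.

Lemma mkWE f I i j : mkW f I i j = sk (f I) i j.
Proof. by rewrite ffunE mxE. Qed.

(** The sign as an option, [None] being zero, so that it reduces to a literal 0, 1 or -1 of the
    field without integer arithmetic. *)
Fixpoint sgo (s : seq nat) : option bool :=
  if s is x :: s' then
    foldr (fun y r =>
      if lt_ x y then r else if lt_ y x then omap negb r else None) (sgo s') s'
  else Some false.

Definition sv (o : option bool) : C :=
  match o with Some false => 1 | Some true => -1 | None => 0 end.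

Lemma zC_sgl s : zC C (sgl s) = sv (sgo s).
Proof.
elim: s => [|x s IHs]; first by [].
have : forall s', zC C (foldr (fun y r => Z.sgn (zn y - zn x) * r) (sgl s) s')
   = sv (foldr (fun y r =>
      if lt_ x y then r else if lt_ y x then omap negb r else None) (sgo s) s').
  elim=> [|y s' IHs'] //; rewrite [foldr _ _ _]/= zCM IHs' /= !lt_E.
  case: ltngtP => [ltxy|ltyx|->].
  - have -> : Z.sgn (zn y - zn x) = 1.
      by apply/Z.sgn_pos_iff; rewrite /zn; lia.
    by rewrite zC1 mul1r.
  - have -> : Z.sgn (zn y - zn x) = -1.
      by apply/Z.sgn_neg_iff; rewrite /zn; lia.
    by rewrite zCN zC1 mulN1r; case: (foldr _ _ _) => [[]|] /=; rewrite ?opprK ?oppr0.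
  - have -> : Z.sgn (zn y - zn y) = 0 by apply/Z.sgn_null_iff; rewrite /zn; lia.
    by rewrite zC0 mul0r.
by apply.
Qed.

Lemma wedge2_sum (p q : nat -> nat -> C) (a b : 'I_6) :
  wedge2 (mk6 p) (mk6 q) a b =
  4^-1 * sm 6 (fun c => sm 6 (fun d => sm 6 (fun e => sm 6 (fun f =>
    sv (sgo [:: val a; val b; c; d; e; f]) * p c d * q e f)))).
Proof.
rewrite mxE; congr (_ * _).
do 4!(rewrite -big_sm; apply: eq_bigr => ? _).
by rewrite eps_zC6 zC_sgl !mxE.
Qed.

Lemma wedge2N (p q : 'M[C]_6) a b : wedge2 p q b a = - wedge2 p q a b.
Proof.
rewrite !mxE -mulrN; congr (_ * _); rewrite -sumrN.
do 3!(apply: eq_bigr => ? _; rewrite -sumrN).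
apply: eq_bigr => ? _; rewrite -!mulNr; congr (_ * _ * _).
rewrite !eps_zC6 -zCN; congr zC => /=.
have -> : Z.sgn (zn a - zn b) = - Z.sgn (zn b - zn a).
  by rewrite -[RHS]Z.sgn_opp; congr Z.sgn; rewrite -[RHS]/(- (zn b - zn a)) opprB.
by ring.
Qed.

Definition quads (r : seq nat) : seq (nat * nat * (nat * nat)) :=
  [seq (x, y) | x <- [seq (c, d) | c <- r, d <- r],
                y <- [seq (e, f) | e <- r, f <- r]].

Lemma big_quads (V : nmodType) r (G : nat * nat * (nat * nat) -> V) :
  \sum_(x <- quads r) G x = \sum_(c <- r) \sum_(d <- r) \sum_(e <- r)
    \sum_(f <- r) G (c, d, (e, f)).
Proof.
rewrite /quads big_allpairs big_allpairs; apply: eq_bigr => c _.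
by apply: eq_bigr => d _; rewrite big_allpairs.
Qed.

Lemma sm6_iota (V : nmodType) (F : nat -> V) : sm 6 F = \sum_(i <- iota 0 6) F i.
Proof. by rewrite -big_sm -(big_mkord xpredT F). Qed.

Definition sgq (a b : nat) (x : nat * nat * (nat * nat)) :=
  sgo [:: a; b; x.1.1; x.1.2; x.2.1; x.2.2].

(** For distinct [a], [b], only the 24 orderings of the complement survive among the 6^4 terms. The
    filtered list is concrete and is computed in [wedge2E]. *)
Lemma sm_quads (p q : nat -> nat -> C) (a b : nat) :
  sm 6 (fun c => sm 6 (fun d => sm 6 (fun e => sm 6 (fun f =>
    sv (sgo [:: a; b; c; d; e; f]) * p c d * q e f)))) =
  \sum_(x <- [seq x <- quads (iota 0 6) | isSome (sgq a b x)])
    sv (sgq a b x) * p x.1.1 x.1.2 * q x.2.1 x.2.2.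
Proof.
rewrite big_filter big_mkcond sm6_iota.
move: (iota 0 6) (@sm6_iota C) => r E; rewrite big_quads.
apply: eq_bigr => c _; rewrite E; apply: eq_bigr => d _; rewrite E.
apply: eq_bigr => e _; rewrite E; apply: eq_bigr => f _.
rewrite /sgq; cbn [fst snd].
by case: (sgo _) => [s|]; cbn [isSome]; rewrite ?mul0r.
Qed.

Lemma wedge2E (p q : nat -> nat -> C) (a b : nat) : (a < b)%N -> (b < 6)%N ->
  wedge2 (mk6 (sk p)) (mk6 (sk q)) (j6 a) (j6 b) = wedgeF p q a b.
Proof.
rewrite wedge2_sum => lab lb.
have -> : val (j6 a) = a by case: a b lab lb => [|[|[|[|[|[|a]]]]]] [|[|[|[|[|[|b]]]]]].
have -> : val (j6 b) = b by case: b lab lb => [|[|[|[|[|[|b]]]]]].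
rewrite sm_quads; set L := filter _ _.
suff : forall s, s = L -> 4^-1 * (\sum_(x <- s)
    sv (sgq a b x) * sk p x.1.1 x.1.2 * sk q x.2.1 x.2.2) = wedgeF p q a b.
  by apply.
rewrite {}/L; move: b lb lab => [|[|[|[|[|[|b]]]]]] // _;
  move: a => [|[|[|[|[|a]]]]] // _ s E; vm_compute in E;
  rewrite E !big_cons big_nil;
  cbn [sgq sk lt_ sgo sv foldr omap obind oapp negb wedgeF wedge4 fst snd];
  by rewrite /wedge4; field.
Qed.

End Coord.

Section Coord2.
Variable C : numFieldType.
Local Notation tens := (tensor_type C).

Lemma cross_W (l m : tens) : W (cross l m).
Proof.
move=> K; apply/matrixP => a b; rewrite !mxE !ffunE !summxE -sumrN.
apply: eq_bigr => I _; rewrite !summxE -sumrN; apply: eq_bigr => J _.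
by rewrite [LHS]mxE [in RHS]mxE wedge2N mulrN.
Qed.

Lemma W_eqP (l m : tens) : W l -> W m ->
  (forall I i j, (I < 3)%N -> (i < j)%N -> (j < 6)%N ->
     l (j3 I) (j6 i) (j6 j) = m (j3 I) (j6 i) (j6 j)) -> l = m.
Proof.
move=> Wl Wm lm; have [f Ef] := W_mkW Wl; have [g Eg] := W_mkW Wm.
rewrite Ef Eg in lm *; apply: mkW_eq => I i j I3 ij j6'.
have := lm I i j I3 ij j6'; rewrite !mkWE.
have v6 k : (k < 6)%N -> nat_of_ord (j6 k) = k by case: k => [|[|[|[|[|[|k]]]]]].
have -> : nat_of_ord (j3 I) = I by case: I I3 {lm} => [|[|[|I]]].
by rewrite !v6 // /sk ?lt_E ?ij // (ltn_trans ij).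
Qed.

Lemma crossE (f g : nat -> nat -> nat -> C) :
  cross (mkW f) (mkW g) = mkW (crossF f g).
Proof.
apply: W_eqP => [||K a b K3 ab b6]; [exact: cross_W|exact: mkW_W|].
rewrite mkWE ffunE.
have v6 k : (k < 6)%N -> nat_of_ord (j6 k) = k by case: k => [|[|[|[|[|[|k]]]]]].
have v3 k : (k < 3)%N -> nat_of_ord (j3 k) = k by case: k => [|[|[|k]]].
rewrite v3 // !v6 ?(ltn_trans ab) // {1}/sk lt_E ab.
pose w i j := wedgeF (f i) (g j) a b.
transitivity (sm 3 (fun I => sm 3 (fun J => sv C (sgo [:: I; J; K]) * w I J))).
  rewrite summxE big_sm3; apply: eq_sm => I I3; rewrite summxE big_sm3.
  apply: eq_sm => J J3; rewrite mxE eps_zC3 zC_sgl !ffunE !v3 //.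
  by rewrite wedge2E //; congr (sv _ (sgo [:: _; _; _]) * _); exact: v3.
rewrite /crossF -!/(w _ _); move: w => w {v6 v3 ab}.
case: K K3 => [|[|[|K]]] // _; cbn; ring.
Qed.

Lemma lactE (X : 'M[C]_6) (Y : 'M[C]_3) (l : tens) I i j :
  lact X Y l I i j = \sum_k (X i k * l I k j + l I i k * X j k)
    + \sum_J Y I J * l J i j.
Proof.
rewrite ffunE !mxE summxE -big_split; congr (_ + _).
  by apply: eq_bigr => k _; rewrite !mxE.
by apply: eq_bigr => J _; rewrite mxE.
Qed.

Lemma lact_W (X : 'M[C]_6) (Y : 'M[C]_3) (l : tens) : W l -> W (lact X Y l).
Proof.
move=> Wl I; apply/matrixP => i j; rewrite mxE [in RHS]mxE !lactE.
rewrite !opprD; congr (_ + _); last first.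
  by rewrite -sumrN; apply: eq_bigr => k _; rewrite (W_skew Wl) mulrN.
rewrite -!sumrN; apply: eq_bigr => k _.
by rewrite !(W_skew Wl _ j) !(W_skew Wl _ k) /=; ring.
Qed.

Lemma lactFE (X Y : nat -> nat -> C) (f : nat -> nat -> nat -> C) :
  lact (mk6 X) (mk3 Y) (mkW f) = mkW (lactF X Y f).
Proof.
apply: W_eqP => [||I i j I3 ij j6']; [exact/lact_W/mkW_W|exact: mkW_W|].
have v6 k : (k < 6)%N -> nat_of_ord (j6 k) = k by case: k => [|[|[|[|[|[|k]]]]]].
have v3 k : (k < 3)%N -> nat_of_ord (j3 k) = k by case: k => [|[|[|k]]].
rewrite mkWE {1}/sk v3 // !v6 ?(ltn_trans ij) // lt_E ij lactE !big_sm6 big_sm3.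
by congr (_ + _); apply: eq_sm => k k6;
  rewrite ?mkWE !mxE ?v3 // !v6 // (ltn_trans ij).
Qed.

Lemma pair6E (f g : nat -> nat -> nat -> C) : pair6 (mkW f) (mkW g) = tracefree (mk6 (pairF f g)).
Proof.
rewrite /pair6; congr tracefree; apply/matrixP => i j.
rewrite summxE big_sm3 mxE; apply: eq_sm => I I3.
rewrite mxE big_sm6; apply: eq_sm => k k6; rewrite !mkWE.
by case: I I3 => [|[|[|I]]] // _; case: k k6 => [|[|[|[|[|[|k]]]]]].
Qed.

Lemma pair3E (f g : nat -> nat -> nat -> C) : pair3 (mkW f) (mkW g)
  = tracefree (mk3 (fun I J => 2^-1 * pairF3 f g I J)).
Proof.
rewrite /pair3; congr tracefree; apply/matrixP => I J.
rewrite !mxE; congr (_ * _); rewrite /mxtrace big_sm6; apply: eq_sm => i i6.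
rewrite mxE big_sm6; apply: eq_sm => k k6; rewrite !mkWE.
by case: i i6 => [|[|[|[|[|[|i]]]]]] // _; case: k k6 => [|[|[|[|[|[|k]]]]]].
Qed.

Lemma wedge2_linear_l (c : C) (p p' q : 'M[C]_6) :
  wedge2 (c *: p + p') q = c *: wedge2 p q + wedge2 p' q.
Proof.
apply/matrixP => a b; rewrite !mxE mulrCA -mulrDr; congr (_ * _).
rewrite mulr_sumr -big_split; apply: eq_bigr => i _.
rewrite mulr_sumr -big_split; apply: eq_bigr => j _.
rewrite mulr_sumr -big_split; apply: eq_bigr => k _.
rewrite mulr_sumr -big_split; apply: eq_bigr => n _.
by rewrite !mxE /=; ring.
Qed.

Lemma wedge2_linear_r (c : C) (p q q' : 'M[C]_6) :
  wedge2 p (c *: q + q') = c *: wedge2 p q + wedge2 p q'.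
Proof.
apply/matrixP => a b; rewrite !mxE mulrCA -mulrDr; congr (_ * _).
rewrite mulr_sumr -big_split; apply: eq_bigr => i _.
rewrite mulr_sumr -big_split; apply: eq_bigr => j _.
rewrite mulr_sumr -big_split; apply: eq_bigr => k _.
rewrite mulr_sumr -big_split; apply: eq_bigr => n _.
by rewrite !mxE /=; ring.
Qed.

Lemma cross_linear_l (c : C) (l l' m : tens) :
  cross (c *: l + l') m = c *: cross l m + cross l' m.
Proof.
apply/ffunP => K; rewrite !ffunE scaler_sumr -big_split; apply: eq_bigr => I _.
rewrite scaler_sumr -big_split; apply: eq_bigr => J _ /=.
by rewrite !ffunE wedge2_linear_l scalerDr !scalerA mulrC.
Qed.

Lemma cross_linear_r (c : C) (l m m' : tens) :
  cross l (c *: m + m') = c *: cross l m + cross l m'.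
Proof.
apply/ffunP => K; rewrite !ffunE scaler_sumr -big_split; apply: eq_bigr => I _.
rewrite scaler_sumr -big_split; apply: eq_bigr => J _ /=.
by rewrite !ffunE wedge2_linear_r scalerDr !scalerA mulrC.
Qed.

Lemma tens_linE (c : C) (l l' : tens) I i j :
  (c *: l + l') I i j = c * l I i j + l' I i j.
Proof. by rewrite !ffunE !mxE. Qed.

Lemma lact_linear_r (X : 'M[C]_6) (Y : 'M[C]_3) (c : C) (l l' : tens) :
  lact X Y (c *: l + l') = c *: lact X Y l + lact X Y l'.
Proof.
apply/ffunP => I; apply/matrixP => i j; rewrite lactE.
rewrite [in RHS]tens_linE !lactE.
rewrite !mulrDr !mulr_sumr [RHS]addrACA -!big_split.
by congr (_ + _); apply: eq_bigr => k _; rewrite !tens_linE /=; ring.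
Qed.

Lemma lact_linear_l (X X' : 'M[C]_6) (Y Y' : 'M[C]_3) (c : C) (l : tens) :
  lact (c *: X + X') (c *: Y + Y') l = c *: lact X Y l + lact X' Y' l.
Proof.
apply/ffunP => I; apply/matrixP => i j; rewrite lactE.
rewrite [in RHS]tens_linE !lactE.
rewrite !mulrDr !mulr_sumr [RHS]addrACA -!big_split.
by congr (_ + _); apply: eq_bigr => k _; rewrite !mxE /=; ring.
Qed.

Lemma tracefree_linear n (c : C) (A B : 'M[C]_n) :
  tracefree (c *: A + B) = c *: tracefree A + tracefree B.
Proof.
apply/matrixP => i j; rewrite !mxE linearP /=; move: (n%:R^-1) => u.
by case: (i == j); rewrite ?mulr1n ?mulr0n; ring.
Qed.

Lemma pair6_linear_l (c : C) (l l' m : tens) :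
  pair6 (c *: l + l') m = c *: pair6 l m + pair6 l' m.
Proof.
rewrite -tracefree_linear; congr tracefree.
rewrite scaler_sumr -big_split; apply: eq_bigr => I _.
by rewrite !ffunE mulmxDl scalemxAl.
Qed.

Lemma pair6_linear_r (c : C) (l m m' : tens) :
  pair6 l (c *: m + m') = c *: pair6 l m + pair6 l m'.
Proof.
rewrite -tracefree_linear; congr tracefree.
rewrite scaler_sumr -big_split; apply: eq_bigr => I _.
by rewrite !ffunE mulmxDr scalemxAr.
Qed.

Lemma pair3_linear_l (c : C) (l l' m : tens) :
  pair3 (c *: l + l') m = c *: pair3 l m + pair3 l' m.
Proof.
rewrite -tracefree_linear; congr tracefree; apply/matrixP => I J.
by rewrite !mxE !ffunE mulmxDl -scalemxAl linearP /= mulrDr mulrCA.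
Qed.

Lemma pair3_linear_r (c : C) (l m m' : tens) :
  pair3 l (c *: m + m') = c *: pair3 l m + pair3 l m'.
Proof.
rewrite -tracefree_linear; congr tracefree; apply/matrixP => I J.
by rewrite !mxE !ffunE mulmxDr -scalemxAr linearP /= mulrDr mulrCA.
Qed.

Lemma linear_fun0 (U V : lmodType C) (f : U -> V) :
  (forall c x y, f (c *: x + y) = c *: f x + f y) -> f 0 = 0.
Proof.
by move=> fP; have := fP (-1) 0 0; rewrite scaler0 addr0 scaleN1r addNr.
Qed.

Lemma e7_bracket_of (l m l' : tens) (X : 'M[C]_6) (Y : 'M[C]_3) :
  e7_bracket (e7_of l) (m, (X, Y), l')
  = (cross l l', (pair6 l m, pair3 l m), - lact X Y l).
Proof.
rewrite /e7_bracket /e7_of /lact_dual.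
have lact0 X' Y' : lact X' Y' (0 : tens) = 0.
  by apply: linear_fun0 => c x y; exact: lact_linear_r.
have lact00 (n : tens) : lact 0 0 n = 0.
  have := lact_linear_l 0 0 0 0 (-1) n.
  by rewrite !scaler0 !addr0 scaleN1r addNr.
rewrite !lact0 trmx0 oppr0 trmx0 oppr0 !lact00 subr0 add0r.
rewrite !mul0mx !mulmx0 !subr0 !add0r.
have -> : pair6 l' 0 = 0 by apply: linear_fun0 => c x y; exact: pair6_linear_r.
have -> : pair3 l' 0 = 0 by apply: linear_fun0 => c x y; exact: pair3_linear_r.
have -> : cross 0 m = 0.
  by apply: (linear_fun0 (f := (@cross C)^~ m)) => c x y; exact: cross_linear_l.
by rewrite !subr0 addr0.
Qed.
End Coord2.

(** * Equivariance of the brackets under GL_6 x GL_3 *)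

Section Equivariance.
Variable C : numFieldType.
Local Notation tens := (tensor_type C).

Lemma sum_delta (n : nat) (F : 'I_n -> C) (x : 'I_n) :
  \sum_k F k * (k == x)%:R = F x.
Proof.
rewrite (bigD1 x) //= eqxx mulr1 big1 ?addr0 // => k /negbTE ->.
by rewrite mulr0.
Qed.

Lemma det_rows (n : nat) (h : 'M[C]_n) (t : n.-tuple 'I_n) :
  \det (\matrix_(i, j) h j (tnth t i)) = \det h * eps C t.
Proof.
rewrite [RHS]mulrC -[in RHS](det_tr h) -det_mulmx; congr (\det _).
apply/matrixP => i j; rewrite !mxE.
under [RHS]eq_bigr => k _ do rewrite !mxE mulrC eq_sym.
by rewrite (sum_delta (fun k => h j k)).
Qed.

Lemma prod3 (F : 'I_3 -> C) :
  \prod_i F i = F ord0 * (F (lift ord0 ord0) * F (lift ord0 (lift ord0 ord0))).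
Proof. by rewrite !big_ord_recl big_ord0 mulr1. Qed.

(** By [det_rows] the right side is the determinant of the columns a, b, c of [h]; Leibniz's formula
    on both sides gives the same sum. *)
Lemma eps_conj3 (h : 'M[C]_3) (a b c : 'I_3) :
  \sum_i \sum_j \sum_k h i a * h j b * h k c * eps C [tuple i; j; k]
  = \det h * eps C [tuple a; b; c].
Proof.
rewrite -det_rows.
transitivity (\sum_(s : {perm 'I_3}) (-1) ^+ s * \sum_i \sum_j \sum_k
   ((h i a * (i == s ord0)%:R) * ((h j b * (j == s (lift ord0 ord0))%:R) *
   (h k c * (k == s (lift ord0 (lift ord0 ord0)))%:R)))).
  under [RHS]eq_bigr => s _ do rewrite mulr_sumr.
  rewrite [RHS]exchange_big; apply: eq_bigr => i _ /=.
  under [RHS]eq_bigr => s _ do rewrite mulr_sumr.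
  rewrite [RHS]exchange_big; apply: eq_bigr => j _ /=.
  under [RHS]eq_bigr => s _ do rewrite mulr_sumr.
  rewrite [RHS]exchange_big; apply: eq_bigr => k _ /=.
  rewrite mulr_sumr; apply: eq_bigr => s _.
  rewrite prod3 !mxE !(tnth_nth i) /=.
  move: (_ ^+ _) (_ == _) (_ == _) (_ == _) => u v1 v2 v3; ring.
apply: eq_bigr => s _; congr (_ * _); rewrite prod3.
rewrite !mxE !(tnth_nth a) /=.
rewrite -[h _ a](sum_delta (fun i => h i a)) mulr_suml; apply: eq_bigr => i _.
rewrite -[h _ b](sum_delta (fun i => h i b)) mulr_suml mulr_sumr.
apply: eq_bigr => j _.
rewrite -[h _ c](sum_delta (fun i => h i c)) !mulr_sumr.
by apply: eq_bigr.
Qed.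

Lemma prod6 (F : 'I_6 -> C) :
  \prod_i F i = F ord0 * (F (lift ord0 ord0) *
    (F (lift ord0 (lift ord0 ord0)) *
    (F (lift ord0 (lift ord0 (lift ord0 ord0))) *
    (F (lift ord0 (lift ord0 (lift ord0 (lift ord0 ord0)))) *
    F (lift ord0 (lift ord0 (lift ord0 (lift ord0 (lift ord0 ord0))))))))).
Proof. by rewrite !big_ord_recl big_ord0 mulr1. Qed.

Lemma eps_conj6 (g : 'M[C]_6) (a b c d e f : 'I_6) :
  \sum_i \sum_j \sum_k \sum_m \sum_n \sum_o
    g i a * g j b * (g k c * g m d * (g n e * g o f)) * eps C [tuple i; j; k; m; n; o]
  = \det g * eps C [tuple a; b; c; d; e; f].
Proof.
rewrite -det_rows; pose s1 : 'I_6 := lift ord0 ord0.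
pose s2 : 'I_6 := lift ord0 (lift ord0 ord0).
pose s3 : 'I_6 := lift ord0 (lift ord0 (lift ord0 ord0)).
pose s4 : 'I_6 := lift ord0 (lift ord0 (lift ord0 (lift ord0 ord0))).
pose s5 : 'I_6 := lift ord0 (lift ord0 (lift ord0 (lift ord0 (lift ord0 ord0)))).
transitivity (\sum_(s : {perm 'I_6}) (-1) ^+ s *
  \sum_i \sum_j \sum_k \sum_m \sum_n \sum_o
   ((g i a * (i == s ord0)%:R) * ((g j b * (j == s s1)%:R) *
    ((g k c * (k == s s2)%:R) * ((g m d * (m == s s3)%:R) *
    ((g n e * (n == s s4)%:R) * (g o f * (o == s s5)%:R))))))).
  do 6!(under [RHS]eq_bigr => s _ do rewrite mulr_sumr;
  rewrite [RHS]exchange_big; apply: eq_bigr => ? _ /=).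
  rewrite mulr_sumr; apply: eq_bigr => s _.
  rewrite prod6 !mxE !(tnth_nth a) /=.
  move: (_ ^+ _) (_ == _) (_ == _) (_ == _) (_ == _) (_ == _) (_ == _).
  by move=> u v1 v2 v3 v4 v5 v6; ring.
apply: eq_bigr => s _; congr (_ * _); rewrite prod6.
rewrite !mxE !(tnth_nth a) /= -/s1 -/s2 -/s3 -/s4 -/s5.
rewrite -[g _ a](sum_delta (fun i => g i a)) mulr_suml; apply: eq_bigr => i _.
rewrite -[g _ b](sum_delta (fun i => g i b)) mulr_suml mulr_sumr.
apply: eq_bigr => j _.
rewrite -[g _ c](sum_delta (fun i => g i c)) mulr_suml !mulr_sumr.
apply: eq_bigr => k _.
rewrite -[g _ d](sum_delta (fun i => g i d)) mulr_suml !mulr_sumr.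
apply: eq_bigr => m _.
rewrite -[g _ e](sum_delta (fun i => g i e)) mulr_suml !mulr_sumr.
apply: eq_bigr => n _.
rewrite -[g _ f](sum_delta (fun i => g i f)) !mulr_sumr.
by apply: eq_bigr.
Qed.

Lemma conj_mxE (n : nat) (g p : 'M[C]_n) c d :
  (g *m p *m g^T) c d = \sum_(y : 'I_n * 'I_n) g c y.1 * g d y.2 * p y.1 y.2.
Proof.
rewrite mxE -(pair_bigA _ (fun i j => g c i * g d j * p i j)) exchange_big /=.
apply: eq_bigr => j _; rewrite !mxE mulr_suml; apply: eq_bigr => i _; ring.
Qed.

Lemma wedge2_pair (p q : 'M[C]_6) (a b : 'I_6) :
  wedge2 p q a b = 4^-1 * \sum_(x : ('I_6 * 'I_6) * ('I_6 * 'I_6))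
    eps C [tuple a; b; x.1.1; x.1.2; x.2.1; x.2.2]
      * p x.1.1 x.1.2 * q x.2.1 x.2.2.
Proof.
rewrite mxE; congr (_ * _).
rewrite -(pair_bigA _ (fun y z => eps C [tuple a; b; y.1; y.2; z.1; z.2]
      * p y.1 y.2 * q z.1 z.2)) /=.
rewrite -(pair_bigA _ (fun c d => \sum_z eps C [tuple a; b; c; d; z.1; z.2]
      * p c d * q z.1 z.2)) /=.
apply: eq_bigr => c _; apply: eq_bigr => d _.
by rewrite -(pair_bigA _ (fun e f => eps C [tuple a; b; c; d; e; f]
      * p c d * q e f)).
Qed.

Lemma eps_conj6_pair (g : 'M[C]_6) (a b : 'I_6) (y : ('I_6 * 'I_6) * ('I_6 * 'I_6)) :
  \sum_(z : 'I_6 * 'I_6) \sum_(x : ('I_6 * 'I_6) * ('I_6 * 'I_6))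
    g z.1 a * g z.2 b *
    (g x.1.1 y.1.1 * g x.1.2 y.1.2 * (g x.2.1 y.2.1 * g x.2.2 y.2.2)) *
    eps C [tuple z.1; z.2; x.1.1; x.1.2; x.2.1; x.2.2]
  = \det g * eps C [tuple a; b; y.1.1; y.1.2; y.2.1; y.2.2].
Proof.
rewrite -eps_conj6 -(pair_bigA _ (fun i j => \sum_(x : ('I_6 * 'I_6) * ('I_6 * 'I_6))
    g i a * g j b *
    (g x.1.1 y.1.1 * g x.1.2 y.1.2 * (g x.2.1 y.2.1 * g x.2.2 y.2.2)) *
    eps C [tuple i; j; x.1.1; x.1.2; x.2.1; x.2.2])) /=.
apply: eq_bigr => i _; apply: eq_bigr => j _.
rewrite -(pair_bigA _ (fun x1 x2 : 'I_6 * 'I_6 => g i a * g j b *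
    (g x1.1 y.1.1 * g x1.2 y.1.2 * (g x2.1 y.2.1 * g x2.2 y.2.2)) *
    eps C [tuple i; j; x1.1; x1.2; x2.1; x2.2])) /=.
rewrite -(pair_bigA _ (fun k m => \sum_x2 g i a * g j b *
    (g k y.1.1 * g m y.1.2 * (g x2.1 y.2.1 * g x2.2 y.2.2)) *
    eps C [tuple i; j; k; m; x2.1; x2.2])) /=.
apply: eq_bigr => k _; apply: eq_bigr => m _.
by rewrite -(pair_bigA _ (fun n o => g i a * g j b *
    (g k y.1.1 * g m y.1.2 * (g n y.2.1 * g o y.2.2)) *
    eps C [tuple i; j; k; m; n; o])).
Qed.

(** Wedge^4 V^* is Wedge^2 V only up to the determinant character, whence the factor; the identity
    is [eps_conj6_pair] contracted with [p] and [q]. *)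
Lemma wedge2_conj (g p q : 'M[C]_6) :
  g^T *m wedge2 (g *m p *m g^T) (g *m q *m g^T) *m g = \det g *: wedge2 p q.
Proof.
apply/matrixP => a b; have := conj_mxE g^T (wedge2 (g *m p *m g^T) (g *m q *m g^T)) a b.
rewrite trmxK => ->; rewrite [RHS]mxE wedge2_pair.
pose E (x y : ('I_6 * 'I_6) * ('I_6 * 'I_6)) (z : 'I_6 * 'I_6) :=
  g z.1 a * g z.2 b *
  (g x.1.1 y.1.1 * g x.1.2 y.1.2 * (g x.2.1 y.2.1 * g x.2.2 y.2.2)) *
  eps C [tuple z.1; z.2; x.1.1; x.1.2; x.2.1; x.2.2] *
  (p y.1.1 y.1.2 * q y.2.1 y.2.2).
transitivity (4^-1 * \sum_y \sum_z \sum_x E x y z).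
  rewrite [in RHS]exchange_big /= mulr_sumr; apply: eq_bigr => z _.
  rewrite wedge2_pair [g^T a _]mxE [g^T b _]mxE mulrCA; congr (_ * _).
  rewrite [in RHS]exchange_big mulr_sumr; apply: eq_bigr => x _ /=.
  rewrite !conj_mxE -[eps _ _ * _ * _]mulrA big_distrlr pair_bigA !mulr_sumr.
  apply: eq_bigr => y _; rewrite /E /=.
  by move: (eps _ _) => u; ring.
rewrite [RHS]mulrCA; congr (_ * _); rewrite mulr_sumr; apply: eq_bigr => y _.
rewrite -[eps _ _ * _ * _]mulrA [RHS]mulrA -eps_conj6_pair mulr_suml; apply: eq_bigr => z _.
by rewrite mulr_suml.
Qed.

Lemma actE (g : 'M[C]_6) (h : 'M[C]_3) (l : tens) I :
  act g h l I = \sum_J h I J *: (g *m l J *m g^T).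
Proof. by rewrite ffunE. Qed.

Lemma act_comp g g' h h' (l : tens) : act g h (act g' h' l) = act (g *m g') (h *m h') l.
Proof.
apply/ffunP => I; rewrite !actE.
under eq_bigr => J _ do rewrite actE mulmx_sumr mulmx_suml scaler_sumr.
rewrite exchange_big; apply: eq_bigr => K _ /=.
rewrite mxE scaler_suml; apply: eq_bigr => J _.
by rewrite -scalemxAr -scalemxAl scalerA trmx_mul !mulmxA.
Qed.

Lemma act1 (l : tens) : act 1%:M 1%:M l = l.
Proof.
apply/ffunP => I; rewrite actE (bigD1 I) //= big1 => [|J].
  by rewrite mxE eqxx scale1r mul1mx trmx1 mulmx1 addr0.
by rewrite eq_sym mxE => /negbTE ->; rewrite scale0r.
Qed.

Lemma act_linear g h (c : C) (l m : tens) :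
  act g h (c *: l + m) = c *: act g h l + act g h m.
Proof.
apply/ffunP => I; rewrite !ffunE scaler_sumr -big_split; apply: eq_bigr => J _.
rewrite !ffunE mulmxDr mulmxDl -scalemxAr -scalemxAl scalerDr !scalerA /=.
by rewrite mulrC.
Qed.

Lemma act_scale g h (c : C) (l : tens) : act g h (c *: l) = c *: act g h l.
Proof. by rewrite -[c *: l]addr0 act_linear linear_fun0 ?addr0 //; exact: act_linear. Qed.

Lemma act_scalemx g h (c d : C) (l : tens) :
  act (c *: g) (d *: h) l = (c ^+ 2 * d) *: act g h l.
Proof.
apply/ffunP => I; rewrite !ffunE scaler_sumr; apply: eq_bigr => J _.
rewrite linearZ /= -!scalemxAl -scalemxAr !scalerA mxE; congr (_ *: _); ring.
Qed.

Lemma act_W g h (l : tens) : W l -> W (act g h l).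
Proof.
move=> Wl I; rewrite actE linear_sum /= -sumrN; apply: eq_bigr => J _.
by rewrite linearZ /= !trmx_mul trmxK Wl mulNmx mulmxN scalerN mulmxA.
Qed.

Lemma wedge2_suml n (c : 'I_n -> C) (p : 'I_n -> 'M[C]_6) q :
  wedge2 (\sum_i c i *: p i) q = \sum_i c i *: wedge2 (p i) q.
Proof.
have W0 : wedge2 0 q = 0.
  by apply: (linear_fun0 (f := (@wedge2 C)^~ q)) => ? ? ?; exact: wedge2_linear_l.
elim: n c p => [|n IHn] c p; first by rewrite !big_ord0.
by rewrite !big_ord_recl wedge2_linear_l IHn.
Qed.

Lemma wedge2_sumr n (c : 'I_n -> C) p (q : 'I_n -> 'M[C]_6) :
  wedge2 p (\sum_i c i *: q i) = \sum_i c i *: wedge2 p (q i).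
Proof.
have W0 : wedge2 p 0 = 0.
  by apply: linear_fun0 => ? ? ?; exact: wedge2_linear_r.
elim: n c q => [|n IHn] c q; first by rewrite !big_ord0.
by rewrite !big_ord_recl wedge2_linear_r IHn.
Qed.

(** Transposes in place of inverses keep the identity polynomial in [g] and [h]; [cross_act] is the
    usual form. *)
Lemma cross_act_tr g h (l m : tens) :
  act g^T h^T (cross (act g h l) (act g h m)) = (\det g * \det h) *: cross l m.
Proof.
pose w I J := wedge2 (l I) (m J).
pose w' I J := g^T *m wedge2 (g *m l I *m g^T) (g *m m J *m g^T) *m g.
have ww' I J : w' I J = \det g *: w I J by exact: wedge2_conj.
apply/ffunP => K.
transitivity (\sum_I' \sum_J' (\sum_I \sum_J \sum_K' h I I' * h J J' * h K' K *
  eps C [tuple I; J; K']) *: w' I' J'); last first.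
  rewrite !ffunE scaler_sumr; apply: eq_bigr => I _.
  rewrite scaler_sumr; apply: eq_bigr => J _.
  by rewrite eps_conj3 ww' !scalerA; congr (_ *: _); ring.
rewrite actE trmxK.
transitivity (\sum_K' \sum_I \sum_J \sum_I' \sum_J'
  (h I I' * h J J' * h K' K * eps C [tuple I; J; K']) *: w' I' J').
  apply: eq_bigr => K' _.
  rewrite ffunE mulmx_sumr mulmx_suml scaler_sumr; apply: eq_bigr => I _.
  rewrite mulmx_sumr mulmx_suml scaler_sumr; apply: eq_bigr => J _.
  rewrite !actE wedge2_suml.
  under eq_bigr => I' _ do rewrite wedge2_sumr.
  rewrite scaler_sumr mulmx_sumr mulmx_suml scaler_sumr; apply: eq_bigr => I' _.
  rewrite 2!scaler_sumr mulmx_sumr mulmx_suml scaler_sumr; apply: eq_bigr => J' _.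
  rewrite !scalerA -!scalemxAr -!scalemxAl scalerA mxE /w'; congr (_ *: _); ring.
rewrite exchange_big /=.
under eq_bigr => I _ do rewrite exchange_big /=.
under eq_bigr => I _ do under eq_bigr => J _ do rewrite exchange_big /=.
under eq_bigr => I _ do rewrite exchange_big /=.
rewrite exchange_big /=; apply: eq_bigr => I' _.
under eq_bigr => I _ do under eq_bigr => J _ do rewrite exchange_big /=.
under eq_bigr => I _ do rewrite exchange_big /=.
rewrite exchange_big /=; apply: eq_bigr => J' _.
rewrite scaler_suml; apply: eq_bigr => I _.
rewrite scaler_suml; apply: eq_bigr => J _.
by rewrite scaler_suml.
Qed.

(** The contragredient action, on W^*. *)
Definition star g h (m : tens) : tens := act (invmx g)^T (invmx h)^T m.

Lemma cross_act g h (l m : tens) : g \in unitmx -> h \in unitmx ->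
  cross (act g h l) (act g h m) = (\det g * \det h) *: star g h (cross l m).
Proof.
move=> gu hu; rewrite -act_scale -cross_act_tr /star act_comp -!trmx_mul.
by rewrite !mulmxV // !trmx1 act1.
Qed.

Lemma lact_act g h X Y (l : tens) : g \in unitmx -> h \in unitmx ->
  lact (g *m X *m invmx g) (h *m Y *m invmx h) (act g h l) = act g h (lact X Y l).
Proof.
move=> gu hu; apply/ffunP => I; rewrite ffunE [RHS]actE.
under [RHS]eq_bigr => J _ do
  rewrite ffunE mulmxDr mulmxDl scalerDr mulmx_sumr mulmx_suml scaler_sumr.
rewrite big_split /=; congr (_ + _).
  rewrite actE mulmx_sumr mulmx_suml -big_split /=; apply: eq_bigr => J _.
  rewrite -scalemxAr -scalemxAl -scalerDr; congr (_ *: _).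
  rewrite mulmxDr mulmxDl !trmx_mul !mulmxA mulmxKV //; congr (_ + _).
  by rewrite -[g *m l J *m g^T *m _]mulmxA -trmx_mul mulVmx // trmx1 mulmx1.
under [LHS]eq_bigr => J _ do rewrite actE scaler_sumr.
under [RHS]eq_bigr => J _ do under eq_bigr => K _ do
  rewrite -scalemxAr -scalemxAl scalerA.
rewrite exchange_big [RHS]exchange_big; apply: eq_bigr => K _ /=.
rewrite -scaler_suml; under eq_bigr => J _ do rewrite scalerA.
rewrite -scaler_suml; congr (_ *: _).
transitivity ((h *m Y *m invmx h *m h) I K); first by rewrite [RHS]mxE.
by rewrite mulmxKV // mxE.
Qed.

Lemma tracefree_conj n (g X : 'M[C]_n) : g \in unitmx ->
  tracefree (g *m X *m invmx g) = g *m tracefree X *m invmx g.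
Proof.
move=> gu; rewrite /tracefree mxtrace_mulC mulmxA mulVmx // mul1mx.
rewrite mulmxBr mulmxBl; congr (_ - _).
by rewrite scalar_mxC mulmxK.
Qed.

Lemma pair_conj g (l m : 'M[C]_6) : g \in unitmx ->
  (g *m l *m g^T) *m ((invmx g)^T *m m *m invmx g) = g *m (l *m m) *m invmx g.
Proof.
move=> gu; rewrite !mulmxA -[g *m l *m g^T *m _]mulmxA -trmx_mul mulVmx //.
by rewrite trmx1 mulmx1.
Qed.

Lemma pair6_act g h (l m : tens) : g \in unitmx -> h \in unitmx ->
  pair6 (act g h l) (star g h m) = g *m pair6 l m *m invmx g.
Proof.
move=> gu hu; rewrite -tracefree_conj //; congr tracefree.
transitivity (\sum_I \sum_J \sum_K (h I J * (invmx h) K I) *: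
   (g *m (l J *m m K) *m invmx g)).
  apply: eq_bigr => I _; rewrite !actE trmxK mulmx_suml; apply: eq_bigr => J _.
  rewrite mulmx_sumr; apply: eq_bigr => K _.
  by rewrite -scalemxAl -scalemxAr scalerA pair_conj // mxE.
rewrite exchange_big /= mulmx_sumr mulmx_suml; apply: eq_bigr => J _.
rewrite exchange_big (bigD1 J) //= [X in _ + X = _]big1 => [|K neKJ]; rewrite -?scaler_suml.
  rewrite addr0; under eq_bigr => I _ do rewrite mulrC.
  have -> : \sum_I invmx h J I * h I J = (invmx h *m h) J J by rewrite [RHS]mxE.
  by rewrite mulVmx // mxE eqxx scale1r.
under eq_bigr => I _ do rewrite mulrC.
have -> : \sum_I invmx h K I * h I J = (invmx h *m h) K J by rewrite [RHS]mxE.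
by rewrite mulVmx // mxE (negbTE neKJ) scale0r.
Qed.

Lemma pair3_act g h (l m : tens) : g \in unitmx -> h \in unitmx ->
  pair3 (act g h l) (star g h m) = h *m pair3 l m *m invmx h.
Proof.
move=> gu hu; rewrite -tracefree_conj //; congr tracefree.
apply/matrixP => I J; rewrite mxE [RHS]mxE.
under [RHS]eq_bigr => K _ do rewrite mxE mulr_suml.
rewrite !actE trmxK mulmx_suml linear_sum mulr_sumr exchange_big /=.
apply: eq_bigr => K _; rewrite mulmx_sumr linear_sum mulr_sumr.
apply: eq_bigr => L _.
rewrite -scalemxAl -scalemxAr scalerA pair_conj // linearZ /= mxtrace_mulC.
rewrite mulmxA mulVmx // mul1mx !mxE; ring.
Qed.
End Equivariance.

(** * Semisimple and nilpotent elements along GL_6 x GL_3-orbits *)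

Section Transport.
Variable C : numClosedFieldType.
Local Notation tens := (tensor_type C).
Local Notation carrier := (tens * ('M[C]_6 * 'M[C]_3) * tens)%type.

Lemma bracket_scale (c : C) (l : tens) (x : carrier) :
  e7_bracket (e7_of (c *: l)) x = c *: e7_bracket (e7_of l) x.
Proof.
case: x => -[m [X Y]] l'; rewrite !e7_bracket_of.
have E (V : lmodType C) (f : tens -> V) :
    (forall c x y, f (c *: x + y) = c *: f x + f y) -> f (c *: l) = c *: f l.
  by move=> fP; rewrite -[c *: l]addr0 fP linear_fun0 ?addr0.
rewrite (E _ ((@cross C)^~ l')) => [|*]; last exact: cross_linear_l.
rewrite (E _ ((@pair6 C)^~ m)) => [|*]; last exact: pair6_linear_l.
rewrite (E _ ((@pair3 C)^~ m)) => [|*]; last exact: pair3_linear_l.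
rewrite (E _ (lact X Y)) => [|*]; last exact: lact_linear_r.
by rewrite -scalerN.
Qed.

Lemma bracket_linear (l : tens) (c : C) (x y : carrier) :
  e7_bracket (e7_of l) (c *: x + y)
  = c *: e7_bracket (e7_of l) x + e7_bracket (e7_of l) y.
Proof.
case: x y => -[m [X Y]] n [[m' [X' Y']] n'].
rewrite -[c *: _ + _]/(c *: m + m', (c *: X + X', c *: Y + Y'), c *: n + n').
rewrite !e7_bracket_of cross_linear_r pair6_linear_r pair3_linear_r.
by rewrite lact_linear_l opprD -scalerN.
Qed.

Lemma bracket0 (l : tens) : e7_bracket (e7_of l) 0 = 0.
Proof. by apply: linear_fun0 => c x y; exact: bracket_linear. Qed.

Lemma ad_semisimple_scale (c : C) (l : tens) :
  ad_semisimple (e7_of l) -> ad_semisimple (e7_of (c *: l)).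
Proof.
move=> ss y /ss[s [-> sP]]; exists s; split=> // z /sP[ez [d zd]].
by split=> //; exists (c * d); rewrite bracket_scale zd scalerA.
Qed.

Lemma ad_nilpotent_scale (c : C) (l : tens) :
  ad_nilpotent (e7_of l) -> ad_nilpotent (e7_of (c *: l)).
Proof.
move=> [n nP]; exists n => y /nP yn.
suff -> k : iter k (e7_bracket (e7_of (c *: l))) y
     = c ^+ k *: iter k (e7_bracket (e7_of l)) y by rewrite yn scaler0.
elim: k => [|k IHk]; first by rewrite scale1r.
rewrite !iterS IHk bracket_scale -[_ *: iter _ _ _]addr0 bracket_linear bracket0.
by rewrite addr0 scalerA exprS.
Qed.

(** The bracket W x W -> W^* acquires the factor det g det h under (g, h). Scaling W by [c] and W^*
    by its inverse compensates it when c^3 det g det h = 1, the hypothesis [cP] below. *)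
Definition phi (g : 'M[C]_6) (h : 'M[C]_3) (c : C) (x : carrier) : carrier :=
  let: (m, (X, Y), l) := x in
  (c^-1 *: star g h m, (g *m X *m invmx g, h *m Y *m invmx h), c *: act g h l).

Section Phi.
Variables (g : 'M[C]_6) (h : 'M[C]_3) (c : C).
Hypotheses (gu : g \in unitmx) (hu : h \in unitmx).
Hypothesis cP : c ^+ 3 * (\det g * \det h) = 1.

Let c0 : c != 0.
Proof. by apply: contraPneq cP => ->; rewrite expr0n mul0r => /esym/eqP; rewrite oner_eq0. Qed.

Lemma phi_linear (d : C) (x y : carrier) :
  phi g h c (d *: x + y) = d *: phi g h c x + phi g h c y.
Proof.
case: x y => -[m [X Y]] n [[m' [X' Y']] n'].
rewrite -[d *: _ + _]/(d *: m + m', (d *: X + X', d *: Y + Y'), d *: n + n').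
rewrite /phi /star !act_linear !mulmxDr !mulmxDl -!scalemxAr -!scalemxAl.
by rewrite !scalerDr !scalerA (mulrC c) (mulrC c^-1) -!scalerA.
Qed.

Lemma phi_bracket (l : tens) (x : carrier) :
  e7_bracket (e7_of (c *: act g h l)) (phi g h c x)
  = phi g h c (e7_bracket (e7_of l) x).
Proof.
case: x => -[m [X Y]] n; rewrite bracket_scale /phi !e7_bracket_of.
have E (V : lmodType C) (f : tens -> V) d x :
    (forall c x y, f (c *: x + y) = c *: f x + f y) -> f (d *: x) = d *: f x.
  by move=> fP; rewrite -[d *: x]addr0 fP linear_fun0 ?addr0.
rewrite (E _ (cross _)) => [|*]; last exact: cross_linear_r.
rewrite (E _ (pair6 _)) => [|*]; last exact: pair6_linear_r.
rewrite (E _ (pair3 _)) => [|*]; last exact: pair3_linear_r.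
rewrite cross_act // pair6_act // pair3_act // lact_act //.
have -> : act g h (- lact X Y l) = - act g h (lact X Y l).
  by rewrite -scaleN1r act_scale scaleN1r.
rewrite -[LHS]/(_, (_, _), _) !scalerA; congr (_, (_, _), _).
- congr (_ *: _); apply: (mulfI c0); rewrite divff // -cP; ring.
- by rewrite divff // scale1r.
- by rewrite divff // scale1r.
Qed.

Lemma phi_e7 (x : carrier) : e7 x -> e7 (phi g h c x).
Proof.
have WZ d (l : tens) : W l -> W (d *: l).
  by move=> Wl I; rewrite !ffunE linearZ /= Wl scalerN.
case: x => -[m [X Y]] n [Wm X0 Y0 Wn]; split.
- exact/WZ/act_W.
- by rewrite mxtrace_mulC mulmxA mulVmx // mul1mx.
- by rewrite mxtrace_mulC mulmxA mulVmx // mul1mx.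
- exact/WZ/act_W.
Qed.

Lemma phiK (x : carrier) : phi (invmx g) (invmx h) c^-1 (phi g h c x) = x.
Proof.
case: x => -[m [X Y]] n; rewrite /phi /star !act_scale !scalerA !act_comp.
rewrite !invmxK invrK divff // mulVf // !scale1r -!trmx_mul !mulVmx //.
by rewrite !trmx1 !act1 !mulmxA !mulmxKV // !mulVmx // !mul1mx.
Qed.
End Phi.

Lemma cube_root (d : C) : d != 0 -> exists c : C, c ^+ 3 * d = 1.
Proof. by move=> d0; exists (3.-root d^-1); rewrite rootCK // mulVf. Qed.

Section ActTransport.
Variables (g : 'M[C]_6) (h : 'M[C]_3).
Hypotheses (gu : g \in unitmx) (hu : h \in unitmx).

Let phiP : exists c : C, [/\ c != 0, c ^+ 3 * (\det g * \det h) = 1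
  & forall y, e7 y -> exists2 x, e7 x & y = phi g h c x].
Proof.
have gi : \det g != 0 by rewrite -unitfE -unitmxE.
have hi : \det h != 0 by rewrite -unitfE -unitmxE.
have [c cP] := cube_root (mulf_neq0 gi hi).
have c0 : c != 0.
  by apply: contraPneq cP => ->; rewrite expr0n mul0r => /esym/eqP; rewrite oner_eq0.
exists c; split=> // y ey; exists (phi (invmx g) (invmx h) c^-1 y).
  by apply: phi_e7; rewrite ?unitmx_inv.
rewrite -{1}(invmxK g) -{1}(invmxK h) -{1}(invrK c) phiK ?unitmx_inv //.
by rewrite !det_inv exprVn -!invfM cP invr1.
Qed.

(** Eigenvectors are carried along by [phi], which sends [l] to c times (g, h).l; the factor [c] is
    removed by [ad_semisimple_scale]. *)
Lemma ad_semisimple_act (l : tens) :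
  ad_semisimple (e7_of l) -> ad_semisimple (e7_of (act g h l)).
Proof.
have [c [c0 cP surj]] := phiP => ss.
rewrite -[act g h l]scale1r -(mulVf c0) -scalerA; apply: ad_semisimple_scale.
move=> y /surj[x /ss[s [-> sP]] ->].
exists (map (phi g h c) s); split.
  elim: s {sP} => [|z s IHs].
    by rewrite !big_nil; apply: linear_fun0 => ? ? ?; exact: phi_linear.
  by rewrite /= !big_cons -IHs -[z]scale1r phi_linear !scale1r.
move=> _ /mapP[z /sP[ez [d zd]] ->]; split; first exact: phi_e7.
exists d; rewrite phi_bracket // zd -[d *: z]addr0 phi_linear.
by rewrite [phi g h c 0]linear_fun0 ?addr0 // => ? ? ?; exact: phi_linear.
Qed.

Lemma ad_nilpotent_act (l : tens) :
  ad_nilpotent (e7_of l) -> ad_nilpotent (e7_of (act g h l)).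
Proof.
have [c [c0 cP surj]] := phiP => -[n nP].
rewrite -[act g h l]scale1r -(mulVf c0) -scalerA; apply: ad_nilpotent_scale.
exists n => y /surj[x /nP xn ->].
suff -> k : iter k (e7_bracket (e7_of (c *: act g h l))) (phi g h c x)
   = phi g h c (iter k (e7_bracket (e7_of l)) x).
  by rewrite xn; apply: linear_fun0 => ? ? ?; exact: phi_linear.
by elim: k => [|k IHk] //; rewrite !iterS IHk phi_bracket.
Qed.
End ActTransport.
End Transport.

(** * Integer matrices of the adjoint actions of u_1, u_2, u_3 *)

Section Fermat.
Variable T : comPzRingType.

(* c1 x1 y1 b1 + c2 x2 y2 b2 + c3 x3 y3 b3 + l2 u2 + l3 u3, where
   x = (e^1, e^2, e^3) and y = (f^1, f^2, f^3). *)
Definition ferm (c1 c2 c3 l2 l3 : T) (I i j : nat) : T :=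
  match I, i, j with
  | 0, 0, 3 => c1 | 1, 1, 4 => c2 | 2, 2, 5 => c3
  | 0, 2, 4 => l2 | 1, 0, 5 => l2 | 2, 1, 3 => l2
  | 0, 1, 5 => l3 | 1, 2, 3 => l3 | 2, 0, 4 => l3
  | _, _, _ => 0
  end.

Definition pairs6 : seq (nat * nat) :=
  [:: (0, 1); (0, 2); (0, 3); (0, 4); (0, 5); (1, 2); (1, 3); (1, 4); (1, 5);
      (2, 3); (2, 4); (2, 5); (3, 4); (3, 5); (4, 5)]%N.
(** The rank of (I, i, j) in the list behind [deW]: there are 15 pairs i < j for each I, and 0, 5,
    9, 12, 14 of them precede those that start with i = 0, ..., 4. *)
Definition pix (I i j : nat) : nat :=
  (15 * I + (nth 0 [:: 0; 5; 9; 12; 14] i + (j - i.+1)))%N.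
Definition deW (o : nat) : nat * (nat * nat) :=
  nth (0, (0, 0))%N [seq (K, p) | K <- iota 0 3, p <- pairs6] o.
Definition de6 (o : nat) : nat * nat :=
  nth (0, 0)%N [seq (i, j) | i <- iota 0 6, j <- iota 0 6] o.
Definition de3 (o : nat) : nat * nat :=
  nth (0, 0)%N [seq (i, j) | i <- iota 0 3, j <- iota 0 3] o.

(** The layout is 45 + 36 + 9 + 45 = 135. Taking gl_6 and gl_3 in place of sl_6 and sl_3 gives a
    basis of matrix units, at the price of two more dimensions and of the projections in [adF]. *)
Definition flat (m : nat -> nat -> nat -> T) (X Y : nat -> nat -> T)
    (l : nat -> nat -> nat -> T) (o : nat) : T :=
  if lt_ o 45 then m (deW o).1 (deW o).2.1 (deW o).2.2
  else if lt_ o 81 then X (de6 (o - 45)).1 (de6 (o - 45)).2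
  else if lt_ o 90 then Y (de3 (o - 81)).1 (de3 (o - 81)).2
  else l (deW (o - 90)).1 (deW (o - 90)).2.1 (deW (o - 90)).2.2.

Definition mof (v : nat -> T) I i j := v (pix I i j).
Definition Xof (v : nat -> T) i j := v (45 + (6 * i + j))%N.
Definition Yof (v : nat -> T) i j := v (81 + (3 * i + j))%N.
Definition lof (v : nat -> T) I i j := v (90 + pix I i j)%N.

(* Six times the adjoint action of u in W on coordinate vectors of gl-triples,
   projected to trace-free ones: the factor clears the denominators. *)
Definition adF (u : nat -> nat -> nat -> T) (v : nat -> T) : nat -> T :=
  flat (fun K a b => 6%:R * crossF u (lof v) K a b)
    (fun i j => 6%:R * pairF u (mof v) i j
       - (if eqn i j then sm 6 (fun k => pairF u (mof v) k k) else 0))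
    (fun I J => 3%:R * pairF3 u (mof v) I J
       - (if eqn I J then sm 3 (fun K => pairF3 u (mof v) K K) else 0))
    (fun I i j => 2%:R * (sm 6 (fun k => Xof v k k) + sm 3 (fun k => Yof v k k))
         * u I i j - 6%:R * lactF (Xof v) (Yof v) u I i j).
End Fermat.

Section Naturality.
Variables (T T' : comPzRingType) (f : {rmorphism T -> T'}).

Lemma sm_morph (n : nat) (F : nat -> T) : f (sm n F) = sm n (fun i => f (F i)).
Proof. by elim: n => [|n IHn] /=; rewrite ?rmorph0 // rmorphD IHn. Qed.

Lemma sk_morph (p : nat -> nat -> T) i j :
  f (sk p i j) = sk (fun i j => f (p i j)) i j.
Proof. by rewrite /sk; do 2?case: lt_; rewrite ?rmorphN ?rmorph0. Qed.

Lemma wedgeF_morph (p q : nat -> nat -> T) i j :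
  f (wedgeF p q i j) = wedgeF (fun i j => f (p i j)) (fun i j => f (q i j)) i j.
Proof.
have E s c d e g : f (wedge4 p q s c d e g) =
    wedge4 (fun i j => f (p i j)) (fun i j => f (q i j)) (f s) c d e g.
  by rewrite /wedge4 !(rmorphM, rmorphD, rmorphN).
by case: i => [|[|[|[|[|i]]]]]; case: j => [|[|[|[|[|[|j]]]]]];
  rewrite /wedgeF ?rmorph0 // E ?rmorphN rmorph1.
Qed.

Lemma crossF_morph (p q : nat -> nat -> nat -> T) K i j :
  f (crossF p q K i j)
  = crossF (fun I i j => f (p I i j)) (fun I i j => f (q I i j)) K i j.
Proof. by case: K => [|[|K]]; rewrite /crossF rmorphB !wedgeF_morph. Qed.

Lemma pairF_morph (p q : nat -> nat -> nat -> T) i j :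
  f (pairF p q i j)
  = pairF (fun I i j => f (p I i j)) (fun I i j => f (q I i j)) i j.
Proof.
rewrite /pairF sm_morph; apply: eq_sm => I _; rewrite sm_morph.
by apply: eq_sm => k _; rewrite rmorphM !sk_morph.
Qed.

Lemma pairF3_morph (p q : nat -> nat -> nat -> T) i j :
  f (pairF3 p q i j)
  = pairF3 (fun I i j => f (p I i j)) (fun I i j => f (q I i j)) i j.
Proof.
rewrite /pairF3 sm_morph; apply: eq_sm => I _; rewrite sm_morph.
by apply: eq_sm => k _; rewrite rmorphM !sk_morph.
Qed.

Lemma lactF_morph (X Y : nat -> nat -> T) (p : nat -> nat -> nat -> T) I i j :
  f (lactF X Y p I i j) = lactF (fun i j => f (X i j)) (fun i j => f (Y i j))
    (fun I i j => f (p I i j)) I i j.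
Proof.
rewrite /lactF rmorphD !sm_morph; congr (_ + _); apply: eq_sm => k _.
  by rewrite rmorphD !rmorphM !sk_morph.
by rewrite rmorphM sk_morph.
Qed.

(** This carries the matrices computed over Z to those over the field. *)
Lemma adF_morph (u : nat -> nat -> nat -> T) (v : nat -> T) o :
  f (adF u v o) = adF (fun I i j => f (u I i j)) (fun k => f (v k)) o.
Proof.
rewrite /adF /flat; case: lt_; first by rewrite rmorphM rmorph_nat crossF_morph.
case: lt_.
  rewrite rmorphB rmorphM rmorph_nat pairF_morph; congr (_ - _).
  case: eqn; rewrite ?rmorph0 // sm_morph; apply: eq_sm => k _.
  exact: pairF_morph.
case: lt_.
  rewrite rmorphB rmorphM rmorph_nat pairF3_morph; congr (_ - _).
  case: eqn; rewrite ?rmorph0 // sm_morph; apply: eq_sm => k _.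
  exact: pairF3_morph.
rewrite rmorphB !rmorphM !rmorph_nat rmorphD !sm_morph.
by rewrite lactF_morph.
Qed.
End Naturality.

Definition dlZ (b k : nat) : Z := if eqn b k then 1 else 0.
Definition adZ (u : nat -> nat -> nat -> Z) : seq (seq Z) :=
  [seq [seq adF u (dlZ b) o | o <- iota 0 135] | b <- iota 0 135].
Definition axpyZ (x : Z) (r s : seq Z) : seq Z :=
  [seq x * p.1 + p.2 | p <- zip r s].
Definition rowmulZ (n : nat) (r : seq Z) (B : seq (seq Z)) : seq Z :=
  foldr (fun p acc => if p.1 == 0 then acc else axpyZ p.1 p.2 acc)
    (nseq n 0) (zip r B).
Definition mulZ (A B : seq (seq Z)) : seq (seq Z) :=
  [seq rowmulZ 135 r B | r <- A].
Definition addZ (A B : seq (seq Z)) : seq (seq Z) :=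
  [seq axpyZ 1 p.1 p.2 | p <- zip A B].
Definition sclZ (x : Z) (A : seq (seq Z)) : seq (seq Z) :=
  [seq [seq x * y | y <- r] | r <- A].
Definition UZ (i : nat) : nat -> nat -> nat -> Z :=
  match i with
  | 0 => ferm 1 1 1 0 0 | 1 => ferm 0 0 0 1 0 | _ => ferm 0 0 0 0 1
  end%N.

(** With a = 6^6 the polynomial is X (X^6 - a) (X^6 + 27 a), which is X (X^6 - 1) (X^6 + 27) before
    the scaling by 6 in [adF]. *)
Definition polyZ (A : seq (seq Z)) :=
  let A2 := mulZ A A in let A3 := mulZ A A2 in let A6 := mulZ A3 A3 in
  let A7 := mulZ A A6 in let A13 := mulZ A6 A7 in
  addZ A13 (addZ (sclZ 1213056 A7) (sclZ (-58773123072) A)).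

Definition allz (A : seq (seq Z)) := all (all (fun x : Z => x == 0)) A.

(** The products of 135 x 135 matrices are evaluated by the virtual machine, when [Qed] checks the
    cast. *)
Lemma adZ_check :
  let A0 := adZ (UZ 0) in let A1 := adZ (UZ 1) in let A2 := adZ (UZ 2) in
  [&& allz (polyZ A0), allz (polyZ A1), allz (polyZ A2),
   mulZ A0 A1 == mulZ A1 A0, mulZ A0 A2 == mulZ A2 A0 & mulZ A1 A2 == mulZ A2 A1].
Proof. vm_cast_no_check (erefl true). Qed.

Section IntMatrices.
Variable C : numFieldType.

Definition mxZ (n : nat) (A : seq (seq Z)) : 'M[C]_n :=
  \matrix_(i, j) zC C (nth 0 (nth [::] A i) j).
Definition sqZ (n : nat) (A : seq (seq Z)) :=
  (size A == n) && all (fun r => size r == n) A.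

Lemma sqZ_nth n A i : sqZ n A -> (i < n)%N -> size (nth [::] A i) = n.
Proof.
case/andP => /eqP sA /allP rA ltin; apply/eqP/rA/mem_nth; by rewrite sA.
Qed.

Lemma nth_axpyZ x r s j : size r = size s ->
  nth 0 (axpyZ x r s) j = x * nth 0 r j + nth 0 s j.
Proof.
move=> rs; case: (ltnP j (size r)) => ltj.
  rewrite (nth_map (0, 0)) ?size_zip ?rs ?minnn -?rs //.
  by rewrite nth_zip.
rewrite !nth_default ?mulr0 ?addr0 -?rs //.
by rewrite size_map size_zip -rs minnn.
Qed.

Lemma size_rowmulZ n r B : all (fun s => size s == n) B -> size (rowmulZ n r B) = n.
Proof.
rewrite /rowmulZ; elim: r B => [|x r IHr] [|s B] //=; rewrite ?size_nseq //.
move=> /andP[/eqP sn Bn]; case: eqP => _; first exact: IHr.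
by rewrite size_map size_zip sn IHr // minnn.
Qed.

Lemma nth_rowmulZ n r B j : all (fun s => size s == n) B -> size r = size B ->
  nth 0 (rowmulZ n r B) j = \sum_(k < size B) nth 0 r k * nth 0 (nth [::] B k) j.
Proof.
elim: r B => [|x r IHr] [|s B] //=; first by rewrite big_ord0 /rowmulZ /= nth_nseq if_same.
move=> /andP[/eqP sn Bn] [rB]; rewrite big_ord_recl /= -IHr // /rowmulZ /=.
case: eqP => [->|_]; first by rewrite mul0r add0r.
by rewrite nth_axpyZ // sn size_rowmulZ.
Qed.

Lemma mxZ_mul A B : sqZ 135 A -> sqZ 135 B ->
  mxZ 135 (mulZ A B) = mxZ 135 A *m mxZ 135 B.
Proof.
move=> sA sB; apply/matrixP => i j; rewrite !mxE.
case/andP: (sA) => /eqP zA _; case/andP: (sB) => /eqP zB aB.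
rewrite (nth_map [::]) ?zA // nth_rowmulZ ?(sqZ_nth sA) ?zB //.
rewrite /zC rmorph_sum rmorph_sum /=; apply: eq_bigr => k _.
by rewrite !mxE rmorphM intrM.
Qed.

Lemma sqZ_mul A B : sqZ 135 A -> sqZ 135 B -> sqZ 135 (mulZ A B).
Proof.
move=> /andP[sA _] /andP[_ aB]; rewrite /sqZ size_map sA.
by apply/allP => _ /mapP[r _ ->]; rewrite size_rowmulZ.
Qed.

Lemma mxZ_add A B : sqZ 135 A -> sqZ 135 B ->
  mxZ 135 (addZ A B) = mxZ 135 A + mxZ 135 B.
Proof.
move=> sA sB; apply/matrixP => i j; rewrite !mxE.
case/andP: (sA) => /eqP zA _; case/andP: (sB) => /eqP zB _.
rewrite (nth_map ([::], [::])) ?size_zip ?zA ?zB ?minnn //.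
rewrite nth_zip ?zA // nth_axpyZ ?(sqZ_nth sA) ?(sqZ_nth sB) //.
by rewrite mul1r zCD.
Qed.

Lemma sqZ_add A B : sqZ 135 A -> sqZ 135 B -> sqZ 135 (addZ A B).
Proof.
move=> sA sB; case/andP: (sA) => /eqP zA _; case/andP: (sB) => /eqP zB _.
rewrite /sqZ size_map size_zip zA zB eqxx /=.
apply/(all_nthP [::]) => k; rewrite size_map size_zip zA zB => ltk.
rewrite (nth_map ([::], [::])) ?size_zip ?zA ?zB //.
by rewrite nth_zip ?zA // size_map size_zip (sqZ_nth sA) ?(sqZ_nth sB).
Qed.

Lemma mxZ_scl x A : mxZ 135 (sclZ x A) = zC C x *: mxZ 135 A.
Proof.
apply/matrixP => i j; rewrite !mxE -zCM; congr zC.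
case: (ltnP i (size A)) => ltiA; last first.
  rewrite ![nth [::] _ i]nth_default ?size_map // nth_nil.
  exact/esym/(mulr0 x).
rewrite (nth_map [::]) //; case: (ltnP j (size (nth [::] A i))) => ltj.
  by rewrite (nth_map 0).
rewrite ![nth 0 _ j]nth_default ?size_map //; exact/esym/(mulr0 x).
Qed.

Lemma sqZ_scl x A : sqZ 135 A -> sqZ 135 (sclZ x A).
Proof.
move=> /andP[sA aA]; rewrite /sqZ size_map sA /=.
by apply/allP => _ /mapP[r /(allP aA) sr ->]; rewrite size_map.
Qed.

Lemma sqZ_adZ u : sqZ 135 (adZ u).
Proof.
apply/andP; split; first by rewrite size_map size_iota.
by apply/allP => _ /mapP[b _ ->]; rewrite size_map size_iota.
Qed.

Lemma mxZ_eq0 A : allz A -> mxZ 135 A = 0.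
Proof.
move=> zA; apply/matrixP => i j; rewrite !mxE.
case: (ltnP i (size A)) => ltiA; last by rewrite [nth [::] _ i]nth_default ?nth_nil.
have /allP r0 : all (fun x : Z => x == 0) (nth [::] A i).
  by apply: (allP zA); exact: mem_nth.
case: (ltnP j (size (nth [::] A i))) => ltj; last by rewrite nth_default.
by rewrite (eqP (r0 _ (mem_nth _ ltj))).
Qed.

Lemma polyZ_mx A : sqZ 135 A -> allz (polyZ A) ->
  let B := mxZ 135 A in
  B ^+ 13 + (zC C 1213056 *: B ^+ 7 + zC C (-58773123072) *: B) = 0.
Proof.
move=> sA /mxZ_eq0; rewrite /polyZ /=; set B := mxZ 135 A => <-.
have s2 := sqZ_mul sA sA; have s3 := sqZ_mul sA s2.
have s6 := sqZ_mul s3 s3; have s7 := sqZ_mul sA s6; have s13 := sqZ_mul s6 s7.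
rewrite mxZ_add ?sqZ_add ?sqZ_scl // mxZ_add ?sqZ_scl // !mxZ_scl.
rewrite (mxZ_mul s6 s7) (mxZ_mul sA s6) (mxZ_mul s3 s3) (mxZ_mul sA s2) (mxZ_mul sA sA) -/B.
by rewrite !mulmxE !(exprS B) expr0 mulr1 !mulrA.
Qed.
End IntMatrices.

(** * Semisimplicity of the Cartan elements *)

Section Semisimple.
Variable C : numClosedFieldType.
Local Notation tens := (tensor_type C).
Local Notation carrier := (tens * ('M[C]_6 * 'M[C]_3) * tens)%type.

Lemma j6K k : (k < 6)%N -> nat_of_ord (j6 k) = k.
Proof. by case: k => [|[|[|[|[|[|k]]]]]]. Qed.
Lemma j3K k : (k < 3)%N -> nat_of_ord (j3 k) = k.
Proof. by case: k => [|[|[|k]]]. Qed.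

Lemma sm_scale (c : C) n F : c * sm n F = sm n (fun k => c * F k).
Proof. by elim: n => [|n IHn] /=; rewrite ?mulr0 // mulrDr IHn. Qed.

Definition iot (v : nat -> C) : carrier :=
  (mkW (mof v), (mk6 (Xof v), mk3 (Yof v)), mkW (lof v)).

Lemma iot_flat m X Y l : iot (flat m X Y l) = (mkW m, (mk6 X, mk3 Y), mkW l).
Proof.
congr (_, (_, _), _).
- apply: mkW_eq => I i j; case: I => [|[|[|I]]] //;
  by case: i => [|[|[|[|[|i]]]]]; case: j => [|[|[|[|[|[|j]]]]]].
- apply/matrixP => i j; rewrite !mxE; case: i => [[|[|[|[|[|[|i]]]]]] ?] //;
  by case: j => [[|[|[|[|[|[|j]]]]]] ?].
- apply/matrixP => i j; rewrite !mxE; case: i => [[|[|[|i]]] ?] //;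
  by case: j => [[|[|[|j]]] ?].
- apply: mkW_eq => I i j; case: I => [|[|[|I]]] //;
  by case: i => [|[|[|[|[|i]]]]]; case: j => [|[|[|[|[|[|j]]]]]].
Qed.

Lemma mkW_linear (c : C) (f g : nat -> nat -> nat -> C) :
  mkW (fun I i j => c * f I i j + g I i j) = c *: mkW f + mkW g.
Proof.
apply/ffunP => I; apply/matrixP => i j; rewrite tens_linE !mkWE /sk.
by case: lt_ => //; case: lt_; rewrite ?mulr0 ?addr0 // opprD mulrN.
Qed.

Lemma iot_linear (c : C) v w : iot (fun k => c * v k + w k) = c *: iot v + iot w.
Proof.
rewrite -[RHS]/(_, (_, _), _) -!mkW_linear /iot; congr (_, (_, _), _).
  by apply/matrixP => i j; rewrite !mxE.
by apply/matrixP => i j; rewrite !mxE.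
Qed.

(** A vector of length 135 encodes matrices with arbitrary traces; this brings it into e_7. *)
Definition pi0 (x : carrier) : carrier :=
  let: (m, (X, Y), l) := x in (m, (tracefree X, tracefree Y), l).

Lemma pi0_linear (c : C) x y : pi0 (c *: x + y) = c *: pi0 x + pi0 y.
Proof.
case: x y => -[m [X Y]] n [[m' [X' Y']] n'].
rewrite -[c *: _ + _ in LHS]/(c *: m + m', (c *: X + X', c *: Y + Y'), c *: n + n').
by rewrite /pi0 !tracefree_linear.
Qed.

Lemma tr_tracefree n (A : 'M[C]_n.+1) : \tr (tracefree A) = 0.
Proof.
rewrite /tracefree linearB /= mxtrace_scalar -[X in _ - X]mulr_natr divfK ?subrr //.
by rewrite pnatr_eq0.
Qed.

Lemma tracefree_id n (A : 'M[C]_n) : \tr A = 0 -> tracefree A = A.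
Proof. by move=> A0; rewrite /tracefree A0 mul0r raddf0 subr0. Qed.

Lemma pi0_id (x : carrier) : e7 x -> pi0 x = x.
Proof. by case: x => -[m [X Y]] n [_ X0 Y0 _]; rewrite /pi0 !tracefree_id. Qed.

Lemma W_opp (l : tens) : W l -> W (- l).
Proof. by move=> Wl I; rewrite !ffunE linearN /= Wl. Qed.

Lemma bracket_e7 (l : tens) x : W l -> e7 (e7_bracket (e7_of l) x).
Proof.
case: x => -[m [X Y]] n Wl; rewrite e7_bracket_of; split.
- exact: cross_W.
- exact: tr_tracefree.
- exact: tr_tracefree.
- exact/W_opp/lact_W.
Qed.

Lemma pi0_iot_e7 v : e7 (pi0 (iot v)).
Proof. by split; [exact: mkW_W|exact: tr_tracefree|exact: tr_tracefree|exact: mkW_W]. Qed.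

Lemma e7_iot (x : carrier) : e7 x -> exists v, x = iot v.
Proof.
case: x => -[m [X Y]] n [/W_mkW[f ->] _ _ /W_mkW[g ->]].
exists (flat f (fun i j => X (j6 i) (j6 j)) (fun i j => Y (j3 i) (j3 j)) g).
rewrite iot_flat; congr (_, (_, _), _).
  by apply/matrixP => i j; rewrite mxE -!ord6E.
by apply/matrixP => i j; rewrite mxE -!ord3E.
Qed.

Lemma scalar_lact (a b : C) (l : tens) :
  lact a%:M b%:M l = (2%:R * a + b) *: l.
Proof.
apply/ffunP => I; rewrite !ffunE.
rewrite (bigD1 I) //= big1 => [|J]; last first.
  by rewrite eq_sym mxE => /negbTE ->; rewrite mulr0n scale0r.
rewrite addr0 mxE eqxx mulr1n tr_scalar_mx mul_scalar_mx mul_mx_scalar.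
by rewrite -!scalerDl; congr (_ *: _); ring.
Qed.

Lemma mkW_scale (c : C) (f : nat -> nat -> nat -> C) :
  mkW (fun I i j => c * f I i j) = c *: mkW f.
Proof.
apply/ffunP => I; apply/matrixP => i j; rewrite mkWE [in RHS]ffunE [in RHS]mxE mkWE /sk.
by case: lt_ => //; case: lt_; rewrite ?mulr0 // mulrN.
Qed.

Lemma adFE (u : nat -> nat -> nat -> C) (v : nat -> C) :
  iot (adF u v) = 6%:R *: e7_bracket (e7_of (mkW u)) (pi0 (iot v)).
Proof.
rewrite /adF iot_flat /pi0 /iot e7_bracket_of crossE pair6E pair3E.
have six0 : (6%:R : C) != 0 by rewrite pnatr_eq0.
rewrite -[RHS]/(_, (_, _), _); congr (_, (_, _), _).
- exact: mkW_scale.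
- apply/matrixP => i j; rewrite !mxE /mxtrace big_sm6.
  rewrite [in RHS](_ : sm 6 _ = sm 6 (fun k => pairF u (mof v) k k)); last first.
    by apply: eq_sm => k k6; rewrite mxE j6K.
  move: (pairF _ _ _ _) (sm _ _) => p q.
  rewrite mulrBr -val_eqE /= -[eqn _ _]/(val i == val j).
  by case: eqP => _; rewrite ?mulr0n ?mulr1n; field.
- apply/matrixP => i j; rewrite !mxE /mxtrace big_sm3.
  rewrite [in RHS](_ : sm 3 _ = 2^-1 * sm 3 (fun k => pairF3 u (mof v) k k)); last first.
    by rewrite sm_scale; apply: eq_sm => k k6; rewrite mxE j3K.
  move: (pairF3 _ _ _ _) (sm _ _) => p q.
  rewrite mulrBr -val_eqE /= -[eqn _ _]/(val i == val j).
  by case: eqP => _; rewrite ?mulr0n ?mulr1n; field.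
rewrite [X in _ = _ *: X]/= /tracefree.
have -> : mk6 (Xof v) - (\tr (mk6 (Xof v)) / 6)%:M =
    (-1) *: (\tr (mk6 (Xof v)) / 6)%:M + mk6 (Xof v) by rewrite scaleN1r addrC.
have -> : mk3 (Yof v) - (\tr (mk3 (Yof v)) / 3)%:M =
    (-1) *: (\tr (mk3 (Yof v)) / 3)%:M + mk3 (Yof v) by rewrite scaleN1r addrC.
rewrite lact_linear_l scalar_lact lactFE.
have -> : \tr (mk6 (Xof v)) = sm 6 (fun k => Xof v k k).
  rewrite /mxtrace big_sm6; apply: eq_sm => k k6.
  by rewrite mxE j6K.
have -> : \tr (mk3 (Yof v)) = sm 3 (fun k => Yof v k k).
  rewrite /mxtrace big_sm3; apply: eq_sm => k k6.
  by rewrite mxE j3K.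
move: (sm 6 _) (sm 3 _) (lactF _ _ _) => p q w.
rewrite scaleN1r opprD opprK scalerDr scalerN scalerA -scaleNr -mkW_scale.
rewrite [RHS]addrC -mkW_linear.
by apply: mkW_eq => I i j _ _ _; field.
Qed.

Lemma bracket_linear_l (c : C) (l l' : tens) (x : carrier) :
  e7_bracket (e7_of (c *: l + l')) x
  = c *: e7_bracket (e7_of l) x + e7_bracket (e7_of l') x.
Proof.
case: x => -[m [X Y]] n; rewrite !e7_bracket_of.
rewrite cross_linear_l pair6_linear_l pair3_linear_l lact_linear_r.
by rewrite opprD -scalerN.
Qed.

Definition adM (i : nat) : 'M[C]_135 := mxZ C 135 (adZ (UZ i)).

Definition UC (i : nat) : nat -> nat -> nat -> C :=
  match i with
  | 0 => ferm 1 1 1 0 0 | 1 => ferm 0 0 0 1 0 | _ => ferm 0 0 0 0 1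
  end%N.

Definition rfun (v : 'rV[C]_135) (k : nat) : C :=
  if insub k is Some i then v 0 i else 0.

Lemma rfunE (v : 'rV[C]_135) (i : 'I_135) : rfun v i = v 0 i.
Proof. by rewrite /rfun valK. Qed.

Lemma iot_ext v w : (forall k, (k < 135)%N -> v k = w k) -> iot v = iot w.
Proof.
move=> vw; congr (_, (_, _), _).
- apply: mkW_eq => I i j I3 ij j6'; apply: vw; move: I i j I3 ij j6'.
  by case=> [|[|[|I]]] //; case=> [|[|[|[|[|i]]]]] //; case=> [|[|[|[|[|[|j]]]]]].
- apply/matrixP => i j; rewrite !mxE; apply: vw.
  by case: i => [[|[|[|[|[|[|i]]]]]] ?] //; case: j => [[|[|[|[|[|[|j]]]]]] ?].
- apply/matrixP => i j; rewrite !mxE; apply: vw.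
  by case: i => [[|[|[|i]]] ?] //; case: j => [[|[|[|j]]] ?].
- apply: mkW_eq => I i j I3 ij j6'; apply: vw; move: I i j I3 ij j6'.
  by case=> [|[|[|I]]] //; case=> [|[|[|[|[|i]]]]] //; case=> [|[|[|[|[|[|j]]]]]].
Qed.

Definition riot (v : 'rV[C]_135) := iot (rfun v).

Lemma riot_linear (c : C) v w : riot (c *: v + w) = c *: riot v + riot w.
Proof.
rewrite /riot -iot_linear; apply: iot_ext => k k135.
by rewrite -[k]/(nat_of_ord (Ordinal k135)) !rfunE !mxE.
Qed.

(** Vectors are rows, so row b of [adM i] is the image of the b-th basis vector. There the claim is
    [adFE], transported from Z; it extends by linearity. *)
Lemma riot_adM i (v : 'rV[C]_135) :
  riot (v *m adM i) = 6%:R *: e7_bracket (e7_of (mkW (UC i))) (pi0 (riot v)).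
Proof.
have base (b : 'I_135) : riot (row b (adM i)) =
    6%:R *: e7_bracket (e7_of (mkW (UC i))) (pi0 (riot (delta_mx 0 b))).
  rewrite -adFE; apply: iot_ext => k k135.
  rewrite -[k]/(nat_of_ord (Ordinal k135)) rfunE !mxE /=.
  rewrite (nth_map 0%N) ?size_iota // (nth_map 0%N) ?size_iota // !nth_iota //.
  pose f : {rmorphism Z -> C} := [the {rmorphism Z -> C} of intr \o int_of_Z].
  transitivity (f (adF (UZ i) (dlZ b) k)); first by [].
  move: (adF_morph f (UZ i) (dlZ b) k) => ->.
  apply: (f_equal2 (fun u v => adF u v k)).
    apply: boolp.funext => I; apply: boolp.funext => p; apply: boolp.funext => q.
    rewrite /UZ /UC; move: (f) => f'; case: i => [|[|i]]; rewrite /ferm;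
    by case: I => [|[|[|I]]]; case: p => [|[|[|p]]]; rewrite ?rmorph0 //;
      case: q => [|[|[|[|[|[|q]]]]]]; rewrite ?rmorph0 ?rmorph1.
  apply: boolp.funext => m; rewrite /dlZ /rfun -[eqn b m]/(nat_of_ord b == m).
  move: (f) => f'; case: insubP => [o _ <-|].
    rewrite mxE eqxx /= eq_sym -val_eqE /=; case: eqP => _;
    by rewrite ?rmorph1 ?rmorph0.
  by case: eqP => [<-|_]; rewrite ?ltn_ord ?rmorph0.
have sumE (V : lmodType C) (F : 'rV[C]_135 -> V) (x : 'I_135 -> 'rV[C]_135) :
    (forall c x y, F (c *: x + y) = c *: F x + F y) ->
    F (\sum_j v 0 j *: x j) = \sum_j v 0 j *: F (x j).
  move=> Flin; have F0 : F 0 = 0 by exact: linear_fun0.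
  by apply: (big_ind2 (fun a b => F a = b)) => // [a c b d <- <-|j _];
    [rewrite -[a]scale1r Flin !scale1r|rewrite -[_ *: x j]addr0 Flin F0 addr0].
rewrite mulmx_sum_row {2}(row_sum_delta v) (sumE _ riot); last exact: riot_linear.
rewrite (sumE _ (fun w => 6%:R *: e7_bracket (e7_of (mkW (UC i))) (pi0 (riot w)))).
  by apply: eq_bigr => b _; rewrite base.
move=> c x y; rewrite riot_linear pi0_linear bracket_linear scalerDr !scalerA.
by rewrite mulrC.
Qed.

End Semisimple.

Section Semisimple2.
Variable C : numClosedFieldType.
Local Notation tens := (tensor_type C).
Local Notation carrier := (tens * ('M[C]_6 * 'M[C]_3) * tens)%type.
Local Notation adM := (adM C).

Local Opaque adZ mulZ polyZ allz.

Lemma adM_poly i : (i < 3)%N ->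
  adM i ^+ 13 + (zC C 1213056 *: adM i ^+ 7 + zC C (-58773123072) *: adM i) = 0.
Proof.
have gen (F : nat -> bool) : F 0%N -> F 1%N -> F 2%N -> forall i, (i < 3)%N -> F i.
  by move=> ? ? ? [|[|[|k]]].
have /and5P[p0 p1 p2 _ _] := adZ_check.
move=> i3; apply: (polyZ_mx C (sqZ_adZ _)).
refine (gen (fun i => allz (polyZ (adZ (UZ i)))) p0 p1 p2 i i3).
Qed.

Lemma adM_comm i j : (i < 3)%N -> (j < 3)%N -> adM i *m adM j = adM j *m adM i.
Proof.
have gen (F : nat -> nat -> seq (seq Z)) : F 0%N 1%N = F 1%N 0%N -> F 0%N 2%N = F 2%N 0%N ->
    F 1%N 2%N = F 2%N 1%N -> forall i j, (i < 3)%N -> (j < 3)%N -> F i j = F j i.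
  by move=> ? ? ? [|[|[|k]]] // [|[|[|m]]].
have /and5P[_ _ _ /eqP c01 /andP[/eqP c02 /eqP c12]] := adZ_check.
move=> i3 j3'; rewrite /adM -(mxZ_mul C (sqZ_adZ _) (sqZ_adZ _)).
rewrite -(mxZ_mul C (sqZ_adZ _) (sqZ_adZ _)); congr (mxZ C 135 _).
refine (gen (fun i j => mulZ (adZ (UZ i)) (adZ (UZ j))) c01 c02 c12 i j i3 j3').
Qed.

Lemma adM_diagonalizable i : (i < 3)%N -> diagonalizable (adM i).
Proof.
move=> i3; have [a [a0 E7 E1]] : exists a : C, [/\ a != 0,
    26%:R * a = zC C 1213056 & - 27%:R * a ^+ 2 = zC C (-58773123072)].
  exists (zC C 46656); split; first by rewrite /zC intr_eq0.
    by rewrite -zC_nat -zCM; congr zC.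
  by rewrite -zC_nat -zCN expr2 -!zCM; congr zC.
pose q : {poly C} := (26%:R * a) *: 'X^7 + (- 27%:R * a ^+ 2) *: 'X.
pose p : {poly C} := 'X^13 + q.
have pA : horner_mx (adM i) p = 0.
  rewrite !rmorphD /= !linearZ /= !rmorphXn /= horner_mx_X.
  rewrite E7 E1.
  exact: adM_poly.
have qs : (size q < size ('X^13 : {poly C}))%N.
  rewrite size_polyXn (leq_ltn_trans (size_polyD _ _)) //.
  rewrite gtn_max (leq_ltn_trans (size_scale_leq _ _)) ?size_polyXn //.
  by rewrite (leq_ltn_trans (size_scale_leq _ _)) ?size_polyX.
have pm : p \is monic by rewrite monicE lead_coefDl // lead_coefXn.
have [rs pE] := closed_field_poly_normal p.
rewrite (monicP pm) scale1r in pE.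
apply/diagonalizableP; exists rs; last by rewrite -pE mxminpoly_min.
rewrite -separable.separable_prod_XsubC -pE separable.separable_poly.unlock.
apply: Pdiv.ClosedField.root_coprimep => x /eqP px; apply/eqP => dpx.
have {}px : x * (x ^+ 6 - a) * (x ^+ 6 + 27%:R * a) = 0.
  by rewrite -px /p /q hornerD hornerXn hornerD !hornerZ hornerXn hornerX; ring.
have {}dpx : 13%:R * (x ^+ 6) ^+ 2 + 182%:R * a * x ^+ 6 - 27%:R * a ^+ 2 = 0.
  rewrite -dpx /p /q derivD derivXn derivD !derivZ derivXn derivX.
  rewrite hornerD hornerMn hornerXn hornerD !hornerZ hornerMn hornerXn hornerC.
  by rewrite /=; ring.
(* At the roots with x = 0, x^6 = a and x^6 = - 27 a, the derivative is - 27 a^2, 168 a^2 and 4536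
   a^2; note that [n0 n] speaks of n + 1. *)
have n0 (n : nat) : (n.+1%:R * a ^+ 2 == 0) = false.
  by rewrite mulf_eq0 pnatr_eq0 expf_eq0 (negbTE a0) andbF.
move/eqP: px; rewrite !mulf_eq0 -orbA => /or3P[/eqP x0|/eqP xa|/eqP xa].
- move: dpx; rewrite x0 !expr0n !mulr0 !addr0 add0r => /eqP.
  by rewrite oppr_eq0 n0.
- move/eqP: xa; rewrite subr_eq0 => /eqP xa.
  have /eqP := n0 167; case.
  by rewrite -dpx xa; ring.
- have {}xa : x ^+ 6 = - (27%:R * a) by apply/eqP; rewrite -addr_eq0 xa.
  have /eqP := n0 4535; case.
  by rewrite -dpx xa; ring.
Qed.

(** The rows of a matrix diagonalizing the three commuting actions at once are eigenvectors of every
    linear combination; their trace-free projections span e_7. *)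
Lemma ad_semisimple_cartan (x1 x2 x3 : C) :
  ad_semisimple (e7_of (mkW (ferm x1 x1 x1 x2 x3))).
Proof.
have [P Pu] : codiagonalizable [:: adM 0; adM 1; adM 2].
  apply/codiagonalizableP; split.
    by move=> A B; rewrite !inE => /or3P[]/eqP-> /or3P[]/eqP->; exact: adM_comm.
  by move=> A; rewrite !inE => /or3P[]/eqP->; exact: adM_diagonalizable.
move=> /and4P[d0 d1 d2 _].
have diagP i : (i < 3)%N -> exists d : 'rV[C]_135, P *m adM i = diag_mx d *m P.
  have D j : is_diag_mx (conjmx P (adM j)) ->
      exists d : 'rV[C]_135, P *m adM j = diag_mx d *m P.
    case/diag_mxP => d Ed; exists d; rewrite -Ed conjumx //.
    by rewrite mulmxKV.
  case: i => [|[|[|i]]] i3; [exact (D _ d0)|exact (D _ d1)|exact (D _ d2)|].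
  by exfalso; clear -i3.
clear d0 d1 d2.
have lamE : mkW (ferm x1 x1 x1 x2 x3)
    = x1 *: mkW (UC C 0) + (x2 *: mkW (UC C 1) + x3 *: mkW (UC C 2)).
  rewrite -[x3 *: _]mkW_scale -!mkW_linear; apply: mkW_eq => I i j _ _ _ /=.
  case: I => [|[|[|I]]] /=; case: i => [|[|[|i]]] /=;
    case: j => [|[|[|[|[|[|j]]]]]] /=; ring.
have scaleE (V : lmodType C) (F : 'rV[C]_135 -> V) c x :
    (forall c x y, F (c *: x + y) = c *: F x + F y) -> F (c *: x) = c *: F x.
  by move=> Flin; rewrite -[c *: x]addr0 Flin linear_fun0 ?addr0.
have eig i k (c : C) : (i < 3)%N -> exists d : C,
    e7_bracket (e7_of (mkW (UC C i))) (pi0 (riot (c *: row k P)))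
    = d *: pi0 (riot (c *: row k P)).
  move=> i3; have [d dP] := diagP i i3; exists (6%:R^-1 * d 0 k).
  have rA : (c *: row k P) *m adM i = d 0 k *: (c *: row k P).
    rewrite -scalemxAl -row_mul dP row_mul row_diag_mx -scalemxAl -rowE.
    by rewrite !scalerA mulrC.
  have := riot_adM i (c *: row k P); rewrite rA scaleE; last exact: riot_linear.
  move=> E; have : pi0 (d 0 k *: riot (c *: row k P))
    = pi0 (6%:R *: e7_bracket (e7_of (mkW (UC C i))) (pi0 (riot (c *: row k P)))).
    by rewrite E.
  rewrite -[6%:R *: _]addr0 pi0_linear.
  rewrite [pi0 0]linear_fun0 ?addr0; last exact: pi0_linear.
  rewrite [pi0 (e7_bracket _ _)]pi0_id; last exact/bracket_e7/mkW_W.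
  rewrite -[d 0 k *: _]addr0 pi0_linear.
  rewrite [pi0 0]linear_fun0 ?addr0; last exact: pi0_linear.
  by rewrite -scalerA => ->; rewrite scalerA mulVf ?scale1r // pnatr_eq0.
move=> y ey; have [v Ev] := e7_iot ey.
pose w : 'rV[C]_135 := \row_k v k; pose c := w *m invmx P.
have wE : riot w = y.
  rewrite Ev; apply: iot_ext => k k135.
  by rewrite -[k]/(nat_of_ord (Ordinal k135)) rfunE mxE.
exists [seq pi0 (riot (c 0 k *: row k P)) | k <- enum 'I_135]; split.
  rewrite big_map big_enum /= -[y]pi0_id // -wE -[w](mulmxKV Pu) -/c.
  rewrite mulmx_sum_row.
  apply: (big_ind2 (fun a b => pi0 (riot a) = b)) => //.
    by rewrite linear_fun0 ?linear_fun0 //; [exact: pi0_linear|exact: riot_linear].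
  move=> a1 b1 a2 b2 <- <-.
  by rewrite -[a1]scale1r riot_linear pi0_linear !scale1r.
move=> _ /mapP[k _ ->]; split; first exact: pi0_iot_e7.
have [d0' E0] := eig 0%N k (c 0 k) isT; have [d1' E1] := eig 1%N k (c 0 k) isT.
have [d2' E2] := eig 2%N k (c 0 k) isT.
exists (x1 * d0' + (x2 * d1' + x3 * d2')).
rewrite lamE !bracket_linear_l bracket_scale E0 E1 E2 !scalerA.
by rewrite [RHS]scalerDl [in RHS]scalerDl.
Qed.
End Semisimple2.

(** * The slice theta = 0 and ternary cubic forms *)

Local Ltac case_coords := case=> [|[|[|?]]] //; case=> [|[|[|[|[|?]]]]] //;
  case=> [|[|[|[|[|[|?]]]]]] // _ _ _.

Section Slice.
Variable C : numFieldType.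
Local Notation tens := (tensor_type C).

(** The two summands of k agree after exchanging i and j, so that k = 2 eps_{ijq} e^i /\ f^j (x)
    g_q. *)
Definition kF : nat -> nat -> nat -> C := ferm 0 0 0 (-2) 2.

Lemma tens_sclE (c : C) (l : tens) I i j : (c *: l) I i j = c * l I i j.
Proof. by rewrite ffunE mxE. Qed.

Lemma tensorE (w : 'M[C]_6) v I i j : tensor w v I i j = v 0 I * w i j.
Proof. by rewrite ffunE mxE. Qed.

Lemma wedgexE (x y : 'rV[C]_6) a b : wedge x y a b = x 0 a * y 0 b - y 0 a * x 0 b.
Proof. by rewrite !mxE !big_ord_recl !big_ord0 !mxE !addr0. Qed.

Definition eE (i a : nat) : C := (eqn a i)%:R.
Definition fE (i a : nat) : C := (eqn a (3 + i))%:R.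

Lemma ebasisE i a : (i < 3)%N -> (a < 6)%N -> ebasis C (j3 i) 0 (j6 a) = eE i a.
Proof.
by rewrite mxE eqxx /=; case: i => [|[|[|i]]] //; case: a => [|[|[|[|[|[|a]]]]]].
Qed.

Lemma fbasisE i a : (i < 3)%N -> (a < 6)%N -> fbasis C (j3 i) 0 (j6 a) = fE i a.
Proof.
by rewrite mxE eqxx /=; case: i => [|[|[|i]]] //; case: a => [|[|[|[|[|[|a]]]]]].
Qed.

Lemma kbr_entry (I : nat) a b : (I < 3)%N -> (a < 6)%N -> (b < 6)%N ->
  kbr C (j3 I) (j6 a) (j6 b) = sm 3 (fun i => sm 3 (fun j =>
    sv C (sgo [:: i; j; I]) * (eE i a * fE j b - fE j a * eE i b
      + (fE i a * eE j b - eE j a * fE i b)))).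
Proof.
move=> I3 a6 b6; rewrite sum_ffunE summxE big_sm3; apply: eq_sm => i i3.
rewrite sum_ffunE summxE big_sm3; apply: eq_sm => j j3'.
rewrite sum_ffunE summxE.
rewrite (bigD1 (j3 I)) // big1 => [|q neq]; rewrite tens_sclE tensorE mxE; last first.
  have -> : (j3 I == q) = false by rewrite eq_sym; exact: negbTE.
  by rewrite andbF mul0r mulr0.
rewrite (eqxx (j3 I)) mul1r [LHS]addr0 mxE !wedgexE !ebasisE // !fbasisE //.
by rewrite eps_zC3 zC_sgl; congr (sv _ (sgo [:: _; _; _]) * _); exact: j3K.
Qed.

Lemma kbr_W : W (kbr C).
Proof.
have ws x y : (wedge x y)^T = - wedge x y :> 'M[C]_6.
  by apply/matrixP => i j; rewrite mxE [in RHS]mxE !wedgexE; ring.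
move=> I; apply/matrixP => a b; rewrite mxE [in RHS]mxE !sum_ffunE !summxE -sumrN.
apply: eq_bigr => i _; rewrite !sum_ffunE !summxE -sumrN.
apply: eq_bigr => j _; rewrite !sum_ffunE !summxE -sumrN.
apply: eq_bigr => q _; rewrite !tens_sclE !tensorE -!mulrN.
congr (_ * (_ * _)); rewrite mxE [in RHS]mxE !wedgexE; ring.
Qed.

Lemma kbrE : kbr C = mkW kF.
Proof.
apply: W_eqP => [||I a b I3 ab b6]; [exact: kbr_W|exact: mkW_W|].
rewrite kbr_entry // ?(ltn_trans ab) // mkWE j3K // !j6K // ?(ltn_trans ab) //.
move: I a b I3 ab b6.
case_coords;
  cbv [sm sk lt_ sgo sv foldr omap obind oapp negb eE fE eqn addn kF ferm];
  rewrite /=; ring.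
Qed.

Lemma kstarE : kstar C = mkW kF.
Proof. exact: kbrE. Qed.

(* The tensors e^i /\ f^j (x) g_q with coefficients symmetric in i, j, q. *)
Definition symT (f : nat -> nat -> nat -> C) : Prop :=
  [/\ forall I i j, (I < 3)%N -> (i < j)%N -> (j < 3)%N -> f I i j = 0,
      forall I i j, (I < 3)%N -> (i < j)%N -> (j < 3)%N ->
        f I (3 + i)%N (3 + j)%N = 0,
      forall I i j, (I < 3)%N -> (i < j)%N -> (j < 3)%N ->
        f I i (3 + j)%N - f I j (3 + i)%N = 0
    & forall I i j, (I < j)%N -> (i < 3)%N -> (j < 3)%N ->
        f I i (3 + j)%N - f j i (3 + I)%N = 0].

Definition alphaF (f : nat -> nat -> nat -> C) (i j : nat) : C :=
  sm 3 (fun I => sm 6 (fun q => sk (f I) q i * sk (kF I) q j)).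
Definition betaF (f : nat -> nat -> nat -> C) (I J : nat) : C :=
  sm 6 (fun i => sm 6 (fun j => sk (f I) i j * sk (kF J) i j)).

Lemma alphaE f (i j : 'I_6) : alpha (mkW f) i j = alphaF f i j.
Proof.
rewrite mxE big_sm3; apply: eq_sm => I I3; rewrite big_sm6.
by apply: eq_sm => q q6; rewrite kstarE !mkWE j3K // j6K.
Qed.

Lemma betaE f (I J : 'I_3) : beta (mkW f) I J = - 2^-1 * betaF f I J.
Proof.
rewrite mxE; congr (_ * _); rewrite big_sm6; apply: eq_sm => i i6; rewrite big_sm6.
by apply: eq_sm => j j6'; rewrite kstarE !mkWE !j6K.
Qed.

(* The symmetric tensor whose entry at a triple of indices with m ones and n
   twos is c m n: these are the ternary cubic forms. *)
Definition cub (c : nat -> nat -> C) (i j q : nat) : C :=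
  c (eqn i 1 + eqn j 1 + eqn q 1)%N (eqn i 2 + eqn j 2 + eqn q 2)%N.

(* t i j q is the coefficient of e^i /\ f^j (x) g_q. *)
Definition efF (t : nat -> nat -> nat -> C) (I i j : nat) : C :=
  if lt_ i 3 then if j is j'.+3 then t i j' I else 0 else 0.

(** The symmetries identify the 27 mixed entries in ten classes, one for each coefficient of a
    ternary cubic. *)
Lemma symT_cub f : symT f -> exists c, mkW f = mkW (efF (cub c)).
Proof.
case=> s1 s2 s3 s4.
have E1 I i j : (I < 3)%N -> (i < j)%N -> (j < 3)%N -> f I i (3 + j)%N = f I j (3 + i)%N.
  by move=> a b c; apply/eqP; rewrite -subr_eq0 s3.
have E2 I i j : (I < j)%N -> (i < 3)%N -> (j < 3)%N -> f I i (3 + j)%N = f j i (3 + I)%N.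
  by move=> a b c; apply/eqP; rewrite -subr_eq0 s4.
have r001 : f 0 0 4 = f 1 0 3 := (E2 0 0 1 isT isT isT).
have r002 : f 0 0 5 = f 2 0 3 := (E2 0 0 2 isT isT isT).
have r010 : f 0 1 3 = f 1 0 3 := (etrans (esym (E1 0 0 1 isT isT isT)) (E2 0 0 1 isT isT isT)).
have r011 : f 0 1 4 = f 1 1 3 := (E2 0 1 1 isT isT isT).
have r012 : f 0 1 5 = f 2 1 3 := (E2 0 1 2 isT isT isT).
have r020 : f 0 2 3 = f 2 0 3 := (etrans (esym (E1 0 0 2 isT isT isT)) (E2 0 0 2 isT isT isT)).
have r021 : f 0 2 4 = f 2 1 3 := (etrans (esym (E1 0 1 2 isT isT isT)) (E2 0 1 2 isT isT isT)).
have r022 : f 0 2 5 = f 2 2 3 := (E2 0 2 2 isT isT isT).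
have r101 : f 1 0 4 = f 1 1 3 := (E1 1 0 1 isT isT isT).
have r102 : f 1 0 5 = f 2 1 3 := (etrans (E2 1 0 2 isT isT isT) (E1 2 0 1 isT isT isT)).
have r112 : f 1 1 5 = f 2 1 4 := (E2 1 1 2 isT isT isT).
have r120 : f 1 2 3 = f 2 1 3 := (etrans (esym (E2 0 2 1 isT isT isT)) (etrans (esym (E1 0 1 2 isT isT isT)) (E2 0 1 2 isT isT isT))).
have r121 : f 1 2 4 = f 2 1 4 := (etrans (esym (E1 1 1 2 isT isT isT)) (E2 1 1 2 isT isT isT)).
have r122 : f 1 2 5 = f 2 2 4 := (E2 1 2 2 isT isT isT).
have r201 : f 2 0 4 = f 2 1 3 := (E1 2 0 1 isT isT isT).
have r202 : f 2 0 5 = f 2 2 3 := (E1 2 0 2 isT isT isT).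
have r212 : f 2 1 5 = f 2 2 4 := (E1 2 1 2 isT isT isT).
have y001 : f 0 0 1 = 0 := s1 0 0 1 isT isT isT.
have y034 : f 0 3 4 = 0 := s2 0 0 1 isT isT isT.
have y002 : f 0 0 2 = 0 := s1 0 0 2 isT isT isT.
have y035 : f 0 3 5 = 0 := s2 0 0 2 isT isT isT.
have y012 : f 0 1 2 = 0 := s1 0 1 2 isT isT isT.
have y045 : f 0 4 5 = 0 := s2 0 1 2 isT isT isT.
have y101 : f 1 0 1 = 0 := s1 1 0 1 isT isT isT.
have y134 : f 1 3 4 = 0 := s2 1 0 1 isT isT isT.
have y102 : f 1 0 2 = 0 := s1 1 0 2 isT isT isT.
have y135 : f 1 3 5 = 0 := s2 1 0 2 isT isT isT.
have y112 : f 1 1 2 = 0 := s1 1 1 2 isT isT isT.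
have y145 : f 1 4 5 = 0 := s2 1 1 2 isT isT isT.
have y201 : f 2 0 1 = 0 := s1 2 0 1 isT isT isT.
have y234 : f 2 3 4 = 0 := s2 2 0 1 isT isT isT.
have y202 : f 2 0 2 = 0 := s1 2 0 2 isT isT isT.
have y235 : f 2 3 5 = 0 := s2 2 0 2 isT isT isT.
have y212 : f 2 1 2 = 0 := s1 2 1 2 isT isT isT.
have y245 : f 2 4 5 = 0 := s2 2 1 2 isT isT isT.

exists (fun a b => match a, b with
  | 0, 0 => f 0 0 3 | 1, 0 => f 1 0 3 | 2, 0 => f 1 1 3 | 3, 0 => f 1 1 4
  | 0, 1 => f 2 0 3 | 1, 1 => f 2 1 3 | 2, 1 => f 2 1 4
  | 0, 2 => f 2 2 3 | 1, 2 => f 2 2 4 | _, _ => f 2 2 5 end)%N.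
apply: mkW_eq; case=> [|[|[|I]]] //; case=> [|[|[|[|[|i]]]]] //;
  by case=> [|[|[|[|[|[|j]]]]]].
Qed.

Lemma dstar_cub c : dstar (mkW (efF (cub c))) = 0.
Proof.
congr (_, _); apply/matrixP => i j; rewrite [RHS]mxE.
  rewrite alphaE; move: (val i) (val j) (ltn_ord i) (ltn_ord j) => {}i {}j.
  by case: i => [|[|[|[|[|[|i]]]]]] //; case: j => [|[|[|[|[|[|j]]]]]] // _ _;
    cbv [alphaF sm sk lt_ kF ferm efF cub eqn nat_of_bool addn]; rewrite /=; ring.
rewrite betaE (_ : betaF _ i j = 0) ?mulr0 //.
move: (val i) (val j) (ltn_ord i) (ltn_ord j) => {}i {}j.
by case: i => [|[|[|i]]] //; case: j => [|[|[|j]]] // _ _;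
  cbv [betaF sm sk lt_ kF ferm efF cub eqn nat_of_bool addn]; rewrite /=; ring.
Qed.

Local Ltac from_alpha A t := transitivity t;
  [cbv [alphaF sm sk lt_ kF ferm]; field|rewrite !A // !mulr0 ?addr0].

(** Each linear equation of [symT] is an explicit combination of entries of [alpha]: the system is
    inverted entry by entry. *)
Lemma dstar0P f : dstar (mkW f) = 0 <-> symT f.
Proof.
have two0 : (2 : C) != 0 by rewrite pnatr_eq0.
split=> [[E _]|/symT_cub[c ->]]; last exact: dstar_cub.
  have A i j : (i < 6)%N -> (j < 6)%N -> alphaF f i j = 0.
    by move=> i6 j6'; have /matrixP/(_ (j6 i) (j6 j)) := E; rewrite alphaE !j6K // mxE.
  have z001 : f 0 0 1 = 0 by from_alpha A ((-1 / 2) * alphaF f 0 5).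
  have z002 : f 0 0 2 = 0 by from_alpha A ((1 / 2) * alphaF f 0 4).
  have z012 : f 0 1 2 = 0 by from_alpha A ((-1 / 4) * alphaF f 0 3 + (1 / 4) * alphaF f 1 4 + (1 / 4) * alphaF f 2 5).
  have z101 : f 1 0 1 = 0 by from_alpha A ((-1 / 2) * alphaF f 1 5).
  have z102 : f 1 0 2 = 0 by from_alpha A ((-1 / 4) * alphaF f 0 3 + (1 / 4) * alphaF f 1 4 + (-1 / 4) * alphaF f 2 5).
  have z112 : f 1 1 2 = 0 by from_alpha A ((-1 / 2) * alphaF f 1 3).
  have z201 : f 2 0 1 = 0 by from_alpha A ((1 / 4) * alphaF f 0 3 + (1 / 4) * alphaF f 1 4 + (-1 / 4) * alphaF f 2 5).
  have z202 : f 2 0 2 = 0 by from_alpha A ((1 / 2) * alphaF f 2 4).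
  have z212 : f 2 1 2 = 0 by from_alpha A ((-1 / 2) * alphaF f 2 3).
  have z034 : f 0 3 4 = 0 by from_alpha A ((-1 / 2) * alphaF f 3 2).
  have z035 : f 0 3 5 = 0 by from_alpha A ((1 / 2) * alphaF f 3 1).
  have z045 : f 0 4 5 = 0 by from_alpha A ((-1 / 4) * alphaF f 3 0 + (1 / 4) * alphaF f 4 1 + (1 / 4) * alphaF f 5 2).
  have z134 : f 1 3 4 = 0 by from_alpha A ((-1 / 2) * alphaF f 4 2).
  have z135 : f 1 3 5 = 0 by from_alpha A ((-1 / 4) * alphaF f 3 0 + (1 / 4) * alphaF f 4 1 + (-1 / 4) * alphaF f 5 2).
  have z145 : f 1 4 5 = 0 by from_alpha A ((-1 / 2) * alphaF f 4 0).
  have z234 : f 2 3 4 = 0 by from_alpha A ((1 / 4) * alphaF f 3 0 + (1 / 4) * alphaF f 4 1 + (-1 / 4) * alphaF f 5 2).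
  have z235 : f 2 3 5 = 0 by from_alpha A ((1 / 2) * alphaF f 5 1).
  have z245 : f 2 4 5 = 0 by from_alpha A ((-1 / 2) * alphaF f 5 0).
  have p001 : f 0 0 4 - f 0 1 3 = 0 by from_alpha A ((-1 / 2) * alphaF f 0 2 + (-1 / 2) * alphaF f 3 5).
  have p002 : f 0 0 5 - f 0 2 3 = 0 by from_alpha A ((1 / 2) * alphaF f 0 1 + (1 / 2) * alphaF f 3 4).
  have p012 : f 0 1 5 - f 0 2 4 = 0 by from_alpha A ((1 / 2) * alphaF f 1 1 + (1 / 2) * alphaF f 2 2 + (-1 / 2) * alphaF f 3 3).
  have p101 : f 1 0 4 - f 1 1 3 = 0 by from_alpha A ((-1 / 2) * alphaF f 1 2 + (-1 / 2) * alphaF f 4 5).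
  have p102 : f 1 0 5 - f 1 2 3 = 0 by from_alpha A ((-1 / 2) * alphaF f 0 0 + (-1 / 2) * alphaF f 2 2 + (1 / 2) * alphaF f 4 4).
  have p112 : f 1 1 5 - f 1 2 4 = 0 by from_alpha A ((-1 / 2) * alphaF f 1 0 + (-1 / 2) * alphaF f 4 3).
  have p201 : f 2 0 4 - f 2 1 3 = 0 by from_alpha A ((-1 / 2) * alphaF f 2 2 + (1 / 2) * alphaF f 3 3 + (1 / 2) * alphaF f 4 4).
  have p202 : f 2 0 5 - f 2 2 3 = 0 by from_alpha A ((1 / 2) * alphaF f 2 1 + (1 / 2) * alphaF f 5 4).
  have p212 : f 2 1 5 - f 2 2 4 = 0 by from_alpha A ((-1 / 2) * alphaF f 2 0 + (-1 / 2) * alphaF f 5 3).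
  have q001 : f 0 0 4 - f 1 0 3 = 0 by from_alpha A ((-1 / 2) * alphaF f 0 2).
  have q002 : f 0 0 5 - f 2 0 3 = 0 by from_alpha A ((1 / 2) * alphaF f 0 1).
  have q011 : f 0 1 4 - f 1 1 3 = 0 by from_alpha A ((-1 / 2) * alphaF f 1 2).
  have q012 : f 0 1 5 - f 2 1 3 = 0 by from_alpha A ((1 / 2) * alphaF f 1 1).
  have q021 : f 0 2 4 - f 1 2 3 = 0 by from_alpha A ((-1 / 2) * alphaF f 2 2).
  have q022 : f 0 2 5 - f 2 2 3 = 0 by from_alpha A ((1 / 2) * alphaF f 2 1).
  have q102 : f 1 0 5 - f 2 0 4 = 0 by from_alpha A ((-1 / 2) * alphaF f 0 0).
  have q112 : f 1 1 5 - f 2 1 4 = 0 by from_alpha A ((-1 / 2) * alphaF f 1 0).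
  have q122 : f 1 2 5 - f 2 2 4 = 0 by from_alpha A ((-1 / 2) * alphaF f 2 0).
  clear E A.
  split.
  - by case=> [|[|[|I]]] //; case=> [|[|[|i]]]; case=> [|[|[|j]]].
  - by case=> [|[|[|I]]] //; case=> [|[|[|i]]]; case=> [|[|[|j]]].
  - by case=> [|[|[|I]]] //; case=> [|[|[|i]]]; case=> [|[|[|j]]].
  - by case=> [|[|[|I]]] //; case=> [|[|[|i]]]; case=> [|[|[|j]]].
Qed.
End Slice.

(** * Transversality at the tensors [ferm] *)

Section Transverse.
Variable C : numClosedFieldType.
Local Notation tens := (tensor_type C).

Lemma mkW_sub (f g : nat -> nat -> nat -> C) :
  mkW f - mkW g = mkW (fun I i j => f I i j - g I i j).
Proof.
rewrite addrC -scaleN1r -mkW_linear; apply: mkW_eq => I i j _ _ _; ring.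
Qed.

(** By [dstar0P] the kernel of [dstar] consists of the symmetric tensors, so every tensor must
    become symmetric after subtracting an infinitesimal action on [P]. *)
Lemma transP (P : nat -> nat -> nat -> C) :
  max_transverse (mkW P) <-> forall w, exists X Y,
    symT (fun I i j => w I i j - lactF X Y P I i j).
Proof.
split=> [tr w|tr _ /W_mkW[w ->]].
  have [v [n [/tangent_orbitE[X [Y vE]] Wn n0 E]]] := tr _ (mkW_W w).
  exists (fun i j => X (j6 i) (j6 j)), (fun i j => Y (j3 i) (j3 j)).
  apply/dstar0P; rewrite -mkW_sub -lactFE E.
  have -> : mk6 (fun i j => X (j6 i) (j6 j)) = X.
    by apply/matrixP => i j; rewrite mxE -!ord6E.
  have -> : mk3 (fun i j => Y (j3 i) (j3 j)) = Y.
    by apply/matrixP => i j; rewrite mxE -!ord3E.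
  by rewrite -vE addrAC subrr add0r.
have [X [Y /dstar0P n0]] := tr w.
exists (lact (mk6 X) (mk3 Y) (mkW P)); eexists; split; last 1 first.
- by rewrite -[LHS](subrK (lact (mk6 X) (mk3 Y) (mkW P))) addrC; reflexivity.
- by apply/tangent_orbitE; exists (mk6 X), (mk3 Y).
- by rewrite lactFE mkW_sub; exact: mkW_W.
- by rewrite lactFE mkW_sub.
Qed.

(** Cramer's rule: a1 a2 a3 + e^3 is the determinant of this cyclic system. *)
Lemma cyc_solve (a1 a2 a3 e t1 t2 t3 : C) : a1 * a2 * a3 + e ^+ 3 != 0 ->
  exists x1 x2 x3, [/\ a1 * x1 = t1 - e * x3, a2 * x2 = t2 - e * x1
    & a3 * x3 = t3 - e * x2].
Proof.
move=> D0; set D := (_ + _) in D0.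
exists ((a2 * a3 * t1 - e * a2 * t3 + e ^+ 2 * t2) / D).
exists ((a3 * a1 * t2 - e * a3 * t1 + e ^+ 2 * t3) / D).
exists ((a1 * a2 * t3 - e * a1 * t2 + e ^+ 2 * t1) / D).
by rewrite /D in D0 *; split; field.
Qed.

Lemma cyc_det (a1 a2 a3 e : C) :
  (forall t1 t2 t3, exists x1 x2 x3, [/\ a1 * x1 + e * x3 = t1,
     a2 * x2 + e * x1 = t2 & a3 * x3 + e * x2 = t3]) ->
  a1 * a2 * a3 + e ^+ 3 != 0.
Proof.
move=> sol; apply/eqP => D0.
have [e0|e0] := eqVneq e 0.
  move: D0; rewrite e0 expr0n addr0 => /eqP; rewrite !mulf_eq0 -orbA.
  case/or3P=> /eqP a0.
  - have [x1 [x2 [x3 [E _ _]]]] := sol 1 0 0.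
    by move/eqP: E; rewrite a0 e0 !mul0r addr0 eq_sym oner_eq0.
  - have [x1 [x2 [x3 [_ E _]]]] := sol 0 1 0.
    by move/eqP: E; rewrite a0 e0 !mul0r addr0 eq_sym oner_eq0.
  - have [x1 [x2 [x3 [_ _ E]]]] := sol 0 0 1.
    by move/eqP: E; rewrite a0 e0 !mul0r addr0 eq_sym oner_eq0.
(* Cramer's combination for [x2] gives e^2 = D x2, where the determinant D is 0. *)
have [x1 [x2 [x3 [E1 E2 E3]]]] := sol 0 0 1.
have : e ^+ 2 = 0.
  transitivity (- e * a3 * 0 + a1 * a3 * 0 + e ^+ 2 * 1); first by ring.
  rewrite -{1}E1 -E2 -E3.
  by transitivity ((a1 * a2 * a3 + e ^+ 3) * x2); [ring|rewrite D0 mul0r].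
by move/eqP; rewrite expf_eq0 (negbTE e0).
Qed.

Definition m33 (a b c d e f g h k : C) (i j : nat) : C :=
  match i, j with
  | 0, 0 => a | 0, 1 => b | 0, _ => c
  | 1, 0 => d | 1, 1 => e | 1, _ => f
  | _, 0 => g | _, 1 => h | _, _ => k
  end.

Definition blk (A U V B : nat -> nat -> C) (i j : nat) : C :=
  match i, j with
  | i'.+3, j'.+3 => B i' j' | i'.+3, _ => V i' j
  | _, j'.+3 => U i j' | _, _ => A i j
  end.

Local Ltac lin1 H :=
  match type of H with ?x = ?y =>
    first [transitivity (y - x); [ring|by rewrite H subrr]
          |transitivity (x - y); [ring|by rewrite H subrr]] end.
Local Ltac lin2 w2 a H b K :=
  match type of H with ?x = ?y => match type of K with ?u = ?v =>
    transitivity (a * (y - x) + b * (v - u));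
      [by field: w2|by rewrite H K !subrr !mulr0 addr0] end end.
(** The equations on the e /\ e and f /\ f entries form six cyclic systems in the off-diagonal
    blocks of [X]. The mixed entries with exactly two equal indices give four more after a Fourier
    transform over Z/3, whose trivial component is left free by the symmetric tensors. The six
    entries with distinct indices involve the diagonal of [X]. *)
Lemma trans_ferm (w c1 c2 c3 l2 l3 : C) : w ^+ 2 = - 1 - w ->
  l2 != 0 -> l3 != 0 -> l2 ^+ 3 != l3 ^+ 3 ->
  c1 * c2 * c3 != l2 ^+ 3 -> c1 * c2 * c3 != l3 ^+ 3 ->
  c1 * c2 * c3 + (l3 * w + l2 * w ^+ 2) ^+ 3 != 0 ->
  c1 * c2 * c3 + (l3 * w ^+ 2 + l2 * w) ^+ 3 != 0 ->
  max_transverse (mkW (ferm c1 c2 c3 l2 l3)).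
Proof.
move=> w2 l20 l30 n23 nc2 nc3 ne1 ne2; apply/transP => z.
have d2 : c1 * c2 * c3 + (- l2) ^+ 3 != 0 by rewrite exprNn -signr_odd mulN1r subr_eq0.
have d3 : c1 * c2 * c3 + (- l3) ^+ 3 != 0 by rewrite exprNn -signr_odd mulN1r subr_eq0.
have d2' : c1 * c3 * c2 + (- l2) ^+ 3 != 0 by rewrite -(mulrA c1) (mulrC c3) mulrA.
have d3' : c1 * c3 * c2 + (- l3) ^+ 3 != 0 by rewrite -(mulrA c1) (mulrC c3) mulrA.
have dd : l3 * l3 * l3 + (- l2) ^+ 3 != 0.
  by rewrite exprNn -signr_odd mulN1r subr_eq0 eq_sym; apply: contraNneq n23 => ->; apply/eqP; ring.
have [U10 [U21 [U02 [A1 A2 A3]]]] := cyc_solve (z 0 0 1)%N (z 1 1 2)%N (- z 2 0 2)%N d3.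
have [U20 [U12 [U01 [B1 B2 B3]]]] := cyc_solve (z 0 0 2)%N (- z 2 1 2)%N (- z 1 0 1)%N d2'.
have [U22 [U00 [U11 [D1 D2 D3]]]] := cyc_solve (z 0 1 2)%N (- z 1 0 2)%N (z 2 0 1)%N dd.
have [V10 [V21 [V02 [A4 A5 A6]]]] := cyc_solve (- z 0 3 4)%N (- z 1 4 5)%N (z 2 3 5)%N d2.
have [V20 [V12 [V01 [B4 B5 B6]]]] := cyc_solve (- z 0 3 5)%N (z 2 4 5)%N (z 1 3 4)%N d3'.
have [V11 [V00 [V22 [D4 D5 D6]]]] := cyc_solve (z 0 4 5)%N (z 2 3 4)%N (- z 1 3 5)%N dd.
have ne1' : c1 * c3 * c2 + (l3 * w + l2 * w ^+ 2) ^+ 3 != 0.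
  by rewrite -(mulrA c1) (mulrC c3) mulrA.
have ne2' : c1 * c3 * c2 + (l3 * w ^+ 2 + l2 * w) ^+ 3 != 0.
  by rewrite -(mulrA c1) (mulrC c3) mulrA.
(* For each multiset of indices, such as 0, 0, 1 here, [s] and [r] are the two nontrivial Fourier
   components of its three entries. *)
pose s0 := (z 0 1 3 + w ^+ 2 * z 0 0 4 + w * z 1 0 3) / 3%:R.
pose r0 := (z 0 1 3 + w * z 0 0 4 + w ^+ 2 * z 1 0 3) / 3%:R.
pose s0' := (z 0 2 3 + w ^+ 2 * z 0 0 5 + w * z 2 0 3) / 3%:R.
pose r0' := (z 0 2 3 + w * z 0 0 5 + w ^+ 2 * z 2 0 3) / 3%:R.
pose s1 := (z 1 2 4 + w ^+ 2 * z 1 1 5 + w * z 2 1 4) / 3%:R.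
pose r1 := (z 1 2 4 + w * z 1 1 5 + w ^+ 2 * z 2 1 4) / 3%:R.
pose s1' := (z 1 0 4 + w ^+ 2 * z 1 1 3 + w * z 0 1 4) / 3%:R.
pose r1' := (z 1 0 4 + w * z 1 1 3 + w ^+ 2 * z 0 1 4) / 3%:R.
pose s2 := (z 2 0 5 + w ^+ 2 * z 2 2 3 + w * z 0 2 5) / 3%:R.
pose r2 := (z 2 0 5 + w * z 2 2 3 + w ^+ 2 * z 0 2 5) / 3%:R.
pose s2' := (z 2 1 5 + w ^+ 2 * z 2 2 4 + w * z 1 2 5) / 3%:R.
pose r2' := (z 2 1 5 + w * z 2 2 4 + w ^+ 2 * z 1 2 5) / 3%:R.
have [v0 [v1 [v2 [G1 G2 G3]]]] := cyc_solve s0 s1 s2 ne1.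
have [u0 [u1 [u2 [G4 G5 G6]]]] := cyc_solve r0 r1 r2 ne2.
have [v0' [v2' [v1' [H1 H2 H3]]]] := cyc_solve s0' s2' s1' ne2'.
have [u0' [u2' [u1' [H4 H5 H6]]]] := cyc_solve r0' r2' r1' ne1'.
subst s0 s1 s2 r0 r1 r2 s0' s1' s2' r0' r1' r2'.
have n23' : l2 - l3 != 0 by rewrite subr_eq0; apply: contraNneq n23 => ->.
(* [s] is the common final value of the six entries with distinct indices. It is chosen so that p0 +
   p1 + p2 = q0 + q1 + q2, since both sums must be the trace of [X] plus that of [Y]. *)
pose s := (l2 * (z 2 0 4 + z 0 1 5 + z 1 2 3) - l3 * (z 1 0 5 + z 2 1 3 + z 0 2 4))
  / (3%:R * (l2 - l3)).
pose p0 := (z 2 0 4 - s) / l3. pose p1 := (z 0 1 5 - s) / l3.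
pose p2 := (z 1 2 3 - s) / l3. pose q0 := (z 1 0 5 - s) / l2.
pose q1 := (z 2 1 3 - s) / l2. pose q2 := (z 0 2 4 - s) / l2.
pose X := blk
  (m33 0 (v1' + u1') (v2 + u2) (v0 + u0) (p1 - q0) (v2' + u2') (v0' + u0') (v1 + u1) (q2 - p0))
  (m33 U00 U01 U02 U10 U11 U12 U20 U21 U22)
  (m33 V00 V01 V02 V10 V11 V12 V20 V21 V22)
  (m33 (p2 - q2 + p0) (w * v1' + w ^+ 2 * u1') (w * v2 + w ^+ 2 * u2)
       (w * v0 + w ^+ 2 * u0) p0 (w * v2' + w ^+ 2 * u2')
       (w * v0' + w ^+ 2 * u0') (w * v1 + w ^+ 2 * u1) q0).
pose Y := m33 0 (w ^+ 2 * v1' + w * u1') (w ^+ 2 * v2 + w * u2)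
  (w ^+ 2 * v0 + w * u0) 0 (w ^+ 2 * v2' + w * u2')
  (w ^+ 2 * v0' + w * u0') (w ^+ 2 * v1 + w * u1) 0.
exists X, Y; split.
- case=> [|[|[|I]]] //; case=> [|[|[|i]]]; case=> [|[|[|j]]] // _ _ _;
    cbv [lactF sm sk lt_ X Y blk m33 ferm addn addn_rec Nat.add].
  + lin1 A1.
  + lin1 B1.
  + lin1 D1.
  + lin1 B3.
  + lin1 D2.
  + lin1 A2.
  + lin1 D3.
  + lin1 A3.
  + lin1 B2.
- case=> [|[|[|I]]] //; case=> [|[|[|i]]]; case=> [|[|[|j]]] // _ _ _;
    cbv [lactF sm sk lt_ X Y blk m33 ferm addn addn_rec Nat.add].
  + lin1 A4.
  + lin1 B4.
  + lin1 D4.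
  + lin1 B6.
  + lin1 D6.
  + lin1 A5.
  + lin1 D5.
  + lin1 A6.
  + lin1 B5.
- case=> [|[|[|I]]] //; case=> [|[|[|i]]]; case=> [|[|[|j]]] // _ _ _;
    cbv [lactF sm sk lt_ X Y blk m33 ferm addn addn_rec Nat.add].
  + lin2 w2 (w - 1) G1 (w ^+ 2 - 1) G4.
  + lin2 w2 (w - 1) H1 (w ^+ 2 - 1) H4.
  + rewrite /p0 /p1 /p2 /q0 /q1 /q2 /s; field; rewrite ?l20 ?l30 ?n23' //.
  + lin2 w2 (1 - w) H3 (1 - w ^+ 2) H6.
  + rewrite /p0 /p1 /p2 /q0 /q1 /q2 /s; field; rewrite ?l20 ?l30 ?n23' //.
  + lin2 w2 (w - 1) G2 (w ^+ 2 - 1) G5.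
  + rewrite /p0 /p1 /p2 /q0 /q1 /q2 /s; field; rewrite ?l20 ?l30 ?n23' //.
  + lin2 w2 (1 - w) G3 (1 - w ^+ 2) G6.
  + lin2 w2 (1 - w) H2 (1 - w ^+ 2) H5.
- case=> [|[|[|I]]]; case=> [|[|[|i]]]; case=> [|[|[|j]]] // _ _ _;
    cbv [lactF sm sk lt_ X Y blk m33 ferm addn addn_rec Nat.add].
  + lin2 w2 (w - w ^+ 2) G1 (w ^+ 2 - w) G4.
  + lin2 w2 (w - w ^+ 2) H1 (w ^+ 2 - w) H4.
  + lin2 w2 (w ^+ 2 - w) H3 (w - w ^+ 2) H6.
  + rewrite /p0 /p1 /p2 /q0 /q1 /q2 /s; field; rewrite ?l20 ?l30 ?n23' //.
  + rewrite /p0 /p1 /p2 /q0 /q1 /q2 /s; field; rewrite ?l20 ?l30 ?n23' //.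
  + lin2 w2 (w ^+ 2 - w) G3 (w - w ^+ 2) G6.
  + rewrite /p0 /p1 /p2 /q0 /q1 /q2 /s; field; rewrite ?l20 ?l30 ?n23' //.
  + lin2 w2 (w - w ^+ 2) G2 (w ^+ 2 - w) G5.
  + lin2 w2 (w ^+ 2 - w) H2 (w - w ^+ 2) H5.
Qed.

End Transverse.

Section TransverseNec.
Variable C : numClosedFieldType.

Local Ltac lin2 w2 a H b K :=
  match type of H with ?x = ?y => match type of K with ?u = ?v =>
    transitivity (a * (y - x) + b * (v - u));
      [by field: w2|by rewrite H K !subrr !mulr0 addr0] end end.

(** Tensors supported on a single block are tested: that all of them can be reached makes the
    determinant of the cyclic system of this block nonzero, by [cyc_det]. *)
Lemma trans_ferm_nec (w c1 c2 c3 l2 l3 : C) : w ^+ 2 = - 1 - w ->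
  max_transverse (mkW (ferm c1 c2 c3 l2 l3)) ->
  [/\ l2 != 0, l3 != 0, l2 ^+ 3 != l3 ^+ 3,
      c1 * c2 * c3 != l2 ^+ 3 /\ c1 * c2 * c3 != l3 ^+ 3
    & c1 * c2 * c3 + (l3 * w + l2 * w ^+ 2) ^+ 3 != 0 /\
      c1 * c2 * c3 + (l3 * w ^+ 2 + l2 * w) ^+ 3 != 0].
Proof.
move=> w2 /transP tr.
have e2 : c1 * c2 * c3 + (- l2) ^+ 3 != 0.
  rewrite -(mulrA c1) (mulrC c2) mulrA.
  apply: cyc_det => t1 t2 t3.
  have [X [Y [s _ _ _]]] := tr (fun I i j => match I, i, j with
    | 0, 0, 2 => t1 | 2, 1, 2 => - t2 | 1, 0, 1 => - t3 | _, _, _ => 0%R end).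
  have := (s 0 0 2 isT isT isT, s 2 1 2 isT isT isT, s 1 0 1 isT isT isT)%N.
  cbv [lactF sm sk lt_ ferm] => -[[E1 E2] E3].
  exists (X 2 3)%N, (X 1 5)%N, (X 0 4)%N; split; apply/eqP; rewrite -subr_eq0.
  - by rewrite -oppr_eq0 -E1; apply/eqP; ring.
  - by rewrite -E2; apply/eqP; ring.
  - by rewrite -E3; apply/eqP; ring.
have e3 : c1 * c2 * c3 + (- l3) ^+ 3 != 0.
  apply: cyc_det => t1 t2 t3.
  have [X [Y [s _ _ _]]] := tr (fun I i j => match I, i, j with
    | 0, 0, 1 => t1 | 1, 1, 2 => t2 | 2, 0, 2 => - t3 | _, _, _ => 0%R end).
  have := (s 0 0 1 isT isT isT, s 1 1 2 isT isT isT, s 2 0 2 isT isT isT)%N.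
  cbv [lactF sm sk lt_ ferm] => -[[E1 E2] E3].
  exists (X 1 3)%N, (X 2 4)%N, (X 0 5)%N; split; apply/eqP; rewrite -subr_eq0.
  - by rewrite -oppr_eq0 -E1; apply/eqP; ring.
  - by rewrite -oppr_eq0 -E2; apply/eqP; ring.
  - by rewrite -E3; apply/eqP; ring.
have e23 : l3 * l3 * l3 + (- l2) ^+ 3 != 0.
  apply: cyc_det => t1 t2 t3.
  have [X [Y [s _ _ _]]] := tr (fun I i j => match I, i, j with
    | 0, 1, 2 => t1 | 1, 0, 2 => - t2 | 2, 0, 1 => t3 | _, _, _ => 0%R end).
  have := (s 0 1 2 isT isT isT, s 1 0 2 isT isT isT, s 2 0 1 isT isT isT)%N.
  cbv [lactF sm sk lt_ ferm] => -[[E1 E2] E3].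
  exists (X 2 5)%N, (X 0 3)%N, (X 1 4)%N; split; apply/eqP; rewrite -subr_eq0.
  - by rewrite -oppr_eq0 -E1; apply/eqP; ring.
  - by rewrite -E2; apply/eqP; ring.
  - by rewrite -oppr_eq0 -E3; apply/eqP; ring.
have ph (v : C) : v ^+ 2 = - 1 - v -> c1 * c2 * c3 + (l3 * v + l2 * v ^+ 2) ^+ 3 != 0.
  move=> v2; apply: cyc_det => t1 t2 t3.
  have [X [Y [_ _ s s']]] := tr (fun I i j => match I, i, j with
    | 0, 1, 3 => t1 | 1, 2, 4 => t2 | 2, 0, 5 => t3 | _, _, _ => 0%R end).
  have := (s 0 0 1 isT isT isT, s 1 1 2 isT isT isT, s 2 0 2 isT isT isT,
    s' 0 0 1 isT isT isT, s' 1 1 2 isT isT isT, s' 0 2 2 isT isT isT)%N.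
  cbv [lactF sm sk lt_ ferm addn addn_rec Nat.add] => -[[[[[E1 E2] E3] E4] E5] E6].
  (* The Fourier component of the unknowns for the cube root [v]; both v = w and v = w^2 are used
     below. *)
  pose f i j := X i j + v ^+ 2 * X (i + 3)%N (j + 3)%N + v * Y i j.
  exists (f 1 0)%N, (f 2 1)%N, (f 0 2)%N; rewrite /f /addn /=.
  split; apply/eqP; rewrite -subr_eq0; apply/eqP.
  - by lin2 v2 (-1 : C) E1 (- v) E4.
  - by lin2 v2 (-1 : C) E2 (- v) E5.
  - by lin2 v2 (1 : C) E3 v E6.
have odd3 (x : C) : (- x) ^+ 3 = - x ^+ 3 by ring.
rewrite odd3 subr_eq0 in e2; rewrite odd3 subr_eq0 in e3.
rewrite odd3 subr_eq0 in e23.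
split=> //; last first.
- split; first exact: ph.
  have w4 : (w ^+ 2) ^+ 2 = - 1 - w ^+ 2 by ring: w2.
  have ww : (w ^+ 2) ^+ 2 = w by ring: w2.
  by have := ph _ w4; rewrite ww.
- by apply: contraNneq e23 => ->; apply/eqP; ring.
(* If l3 = 0, the action does not change the entries 0 1 5 and 1 2 3. Symmetry makes them equal, but
   they are 1 and 0 in the tensor tested here. *)
- apply/eqP => l30; have [X [Y [_ _ s s']]] := tr (fun I i j => match I, i, j with
    | 0, 1, 5 => 1 | _, _, _ => 0%R end).
  have := (s 0 1 2 isT isT isT, s' 0 2 1 isT isT isT)%N; rewrite l30.
  cbv [lactF sm sk lt_ ferm addn addn_rec Nat.add] => -[E1 E2].
  by have /eqP := oner_neq0 C; apply; lin2 w2 (-1 : C) E1 (-1 : C) E2.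
- apply/eqP => l20; have [X [Y [_ _ s s']]] := tr (fun I i j => match I, i, j with
    | 0, 2, 4 => 1 | _, _, _ => 0%R end).
  have := (s 0 1 2 isT isT isT, s' 0 1 2 isT isT isT)%N; rewrite l20.
  cbv [lactF sm sk lt_ ferm addn addn_rec Nat.add] => -[E1 E2].
  by have /eqP := oner_neq0 C; apply; lin2 w2 (1 : C) E1 (-1 : C) E2.
Qed.
End TransverseNec.

(** * Nilpotency from positive torus weights *)

Section Weights.
Variable C : numClosedFieldType.
Local Notation tens := (tensor_type C).

Lemma sum_neq0 (n : nat) (F : 'I_n -> C) : \sum_i F i != 0 -> exists i, F i != 0.
Proof.
move=> h; apply/existsP; apply: contraNT h; rewrite negb_exists => /forallP h.
by rewrite big1 // => i _; apply/eqP; move: (h i); rewrite negbK.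
Qed.

Lemma mulf_neq0P (x y : C) : x * y != 0 -> x != 0 /\ y != 0.
Proof. by rewrite mulf_eq0 negb_or => /andP[]. Qed.

Lemma addf_neq0P (x y : C) : x + y != 0 -> x != 0 \/ y != 0.
Proof.
by case: (eqVneq x 0) => [->|]; [rewrite add0r; right|left].
Qed.

Lemma eps_neq0_sum n (t : n.-tuple 'I_n) (w : 'I_n -> int) :
  eps C t != 0 -> \sum_(i <- t) w i = \sum_i w i.
Proof.
move=> t0; have inj : injective (tnth t).
  move=> i j ij; apply/eqP; apply: contraNT t0 => nij.
  by rewrite /eps (determinant_alternate nij) // => k; rewrite !mxE ij.
by rewrite big_tuple [RHS](reindex_inj inj).
Qed.

Variables (w : 'I_6 -> int) (v : 'I_3 -> int).
Hypotheses (w0 : \sum_i w i = 0) (v0 : \sum_i v i = 0).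

Definition wt_ge (n : int) (l : tens) :=
  forall I i j, l I i j != 0 -> n <= w i + w j + v I.

(** The weight filtration of e_7 under the one-parameter subgroup with exponents [w] and [v]; W^*
    carries the opposite weights. *)
Definition wt_ge7 (n : int) (y : tens * ('M[C]_6 * 'M[C]_3) * tens) :=
  [/\ forall I i j, y.1.1 I i j != 0 -> n <= - (w i + w j + v I),
      forall i j, y.1.2.1 i j != 0 -> n <= w i - w j,
      forall I J, y.1.2.2 I J != 0 -> n <= v I - v J
    & wt_ge n y.2].

Lemma tracefree_neq0 k (A : 'M[C]_k) i j :
  tracefree A i j != 0 -> A i j != 0 \/ i = j /\ exists p, A p p != 0.
Proof.
rewrite !mxE => /addf_neq0P[|]; first by left.
rewrite oppr_eq0; case: (i =P j) => [->|_]; last by rewrite mulr0n eqxx.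
by move/mulf_neq0P => [/sum_neq0 h _]; right.
Qed.

(** A nonzero alternating symbol uses every index once, so the weights of its indices add up to
    0. *)
Lemma wt_cross n l m : wt_ge 1 l -> wt_ge n m ->
  forall K i j, cross l m K i j != 0 -> n + 1 <= - (w i + w j + v K).
Proof.
move=> wl wm K i j; rewrite ffunE summxE => /sum_neq0[I]; rewrite summxE => /sum_neq0[J].
rewrite !mxE => /mulf_neq0P[e3] /mulf_neq0P[_] /sum_neq0[c] /sum_neq0[d] /sum_neq0[e] /sum_neq0[f].
move=> /mulf_neq0P[/mulf_neq0P[e6 /wl a1] /wm a2].
have := eps_neq0_sum v e3; have := eps_neq0_sum w e6.
rewrite w0 v0 /= !big_cons !big_nil; lia.
Qed.

Lemma wt_ge7_ad n nu y : wt_ge 1 nu -> wt_ge7 n y ->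
  wt_ge7 (n + 1) (e7_bracket (e7_of nu) y).
Proof.
case: y => [[m [X Y]] l] wn [wm wX wY wl]; rewrite e7_bracket_of; split=> /=.
- exact: wt_cross.
- have h i j : (\sum_I nu I *m m I) i j != 0 -> n + 1 <= w i - w j.
    rewrite summxE => /sum_neq0[I]; rewrite mxE => /sum_neq0[a] /mulf_neq0P[/wn h1 /wm /= h2].
    lia.
  by move=> i j /tracefree_neq0[/h //|[<- [p /h]]]; rewrite !subrr.
- have h I J : (\matrix_(I, J) (2^-1 * \tr (nu I *m m J))) I J != 0 -> n + 1 <= v I - v J.
    rewrite mxE => /mulf_neq0P[_ h]; case: (@sum_neq0 6 (fun i => (nu I *m m J) i i) h) => i; rewrite mxE => /sum_neq0[a].
    by move=> /mulf_neq0P[/wn h1 /wm /= h2]; lia.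
  by move=> i j /tracefree_neq0[/h //|[<- [p /h]]]; rewrite !subrr.
move=> I i j; rewrite ffunE mxE oppr_eq0 ffunE !mxE => /addf_neq0P[/addf_neq0P[]|].
- by move=> /sum_neq0[a] /mulf_neq0P[/wX /= h1 /wn h2]; lia.
- by move=> /sum_neq0[a]; rewrite mxE => /mulf_neq0P[/wn h1 /wX /= h2]; lia.
rewrite summxE => /sum_neq0[J]; rewrite mxE => /mulf_neq0P[/wY /= h1 /wn h2]; lia.
Qed.

(** The adjoint action raises the filtration by 1, and all weights lie between -B and B, so 2 B + 1
    steps suffice. *)
Lemma ad_nilpotent_weights nu : wt_ge 1 nu -> ad_nilpotent (e7_of nu).
Proof.
move=> wn; pose B : nat := (2 * \sum_i `|w i| + 2 * \sum_i `|v i|)%N.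
have bw i : (`|w i| <= \sum_i `|w i|)%N by rewrite (bigD1 i) //= leq_addr.
have bv i : (`|v i| <= \sum_i `|v i|)%N by rewrite (bigD1 i) //= leq_addr.
exists (2 * B + 1)%N => y _.
have h k : wt_ge7 (k%:Z - B%:Z) (iter k (e7_bracket (e7_of nu)) y).
  elim: k => [|k IH]; last first.
    rewrite iterS; have -> : k.+1%:Z - B%:Z = k%:Z - B%:Z + 1 by lia.
    exact: wt_ge7_ad.
  split=> [I i j _|i j _|I J _|I i j _].
  - by have := bw i; have := bw j; have := bv I; rewrite /B; lia.
  - by have := bw i; have := bw j; rewrite /B; lia.
  - by have := bv I; have := bv J; rewrite /B; lia.
  - by have := bw i; have := bw j; have := bv I; rewrite /B; lia.
move: (h (2 * B + 1)%N); case: (iter _ _ _) => [[m [X Y]] l] [/= h1 h2 h3 h4].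
congr (_, (_, _), _).
- apply/ffunP => I; apply/matrixP => i j; rewrite ffunE mxE; apply/eqP; apply/negPn/negP.
  by move/h1; have := bw i; have := bw j; have := bv I; rewrite /B; lia.
- apply/matrixP => i j; rewrite mxE; apply/eqP; apply/negPn/negP.
  by move/h2; have := bw i; have := bw j; rewrite /B; lia.
- apply/matrixP => i j; rewrite mxE; apply/eqP; apply/negPn/negP.
  by move/h3; have := bv i; have := bv j; rewrite /B; lia.
apply/ffunP => I; apply/matrixP => i j; rewrite ffunE mxE; apply/eqP; apply/negPn/negP.
by move/h4; have := bw i; have := bw j; have := bv I; rewrite /B; lia.
Qed.

End Weights.

Section NilpotentCubics.
Variable C : numClosedFieldType.
(* The cubic forms a y^2 z + r(x, y): those with only monomials of positive
   weight for the weights (1, 2, -3) of x, y, z. *)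
Definition n3c (a r0 r1 r2 r3 : C) (m n : nat) : C :=
  match m, n with
  | 2, 1 => a | 0, 0 => r0 | 1, 0 => r1 | 2, 0 => r2 | 3, 0 => r3 | _, _ => 0
  end.

Definition weights6 (p q : int) (i : 'I_6) : int :=
  match val i with 0 | 3 => p | 1 | 4 => q | _ => - (p + q) end%N.
Definition weights3 (p q : int) (i : 'I_3) : int :=
  match val i with 0 => p | 1 => q | _ => - (p + q) end%N.

Lemma mkW_weights (f : nat -> nat -> nat -> C) (p q : int) (P : int -> Prop) :
  (forall I i j, (I < 3)%N -> (i < j)%N -> (j < 6)%N -> f I i j != 0 ->
    P (weights6 p q (j6 i) + weights6 p q (j6 j) + weights3 p q (j3 I))) ->
  forall I i j, mkW f I i j != 0 -> P (weights6 p q i + weights6 p q j + weights3 p q I).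
Proof.
move=> h I i j; rewrite mkWE /sk !lt_E; case: ltngtP => [ij|ij|_]; last by rewrite eqxx.
  by move/(h I i j (ltn_ord I) ij (ltn_ord j)); rewrite -!ord6E -ord3E.
rewrite oppr_eq0 => /(h I j i (ltn_ord I) ij (ltn_ord i)).
by rewrite -!ord6E -ord3E [weights6 _ _ j + _]addrC.
Qed.

Lemma ad_nilpotent_mkW (f : nat -> nat -> nat -> C) (p q : int) :
  (forall I i j, (I < 3)%N -> (i < j)%N -> (j < 6)%N -> f I i j != 0 ->
    1 <= weights6 p q (j6 i) + weights6 p q (j6 j) + weights3 p q (j3 I)) ->
  ad_nilpotent (e7_of (mkW f)).
Proof.
move=> h; apply: (@ad_nilpotent_weights _ (weights6 p q) (weights3 p q)).
- by rewrite !big_ord_recl big_ord0 /weights6 /=; lia.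
- by rewrite !big_ord_recl big_ord0 /weights3 /=; lia.
exact: (mkW_weights (P := fun n => 1 <= n)).
Qed.

Lemma n3c_weights (a r0 r1 r2 r3 : C) :
  wt_ge (weights6 1 2) (weights3 1 2) 1 (mkW (efF (cub (n3c a r0 r1 r2 r3)))).
Proof.
apply: (mkW_weights (P := fun n => 1 <= n)); case_coords; rewrite /cub /= ?eqxx //.
Qed.

Lemma ad_nilpotent_n3 (a r0 r1 r2 r3 : C) :
  ad_nilpotent (e7_of (mkW (efF (cub (n3c a r0 r1 r2 r3))))).
Proof.
apply: (@ad_nilpotent_weights _ (weights6 1 2) (weights3 1 2)).
- by rewrite !big_ord_recl big_ord0 /weights6 /=; lia.
- by rewrite !big_ord_recl big_ord0 /weights3 /=; lia.
exact: n3c_weights.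
Qed.

(** The weight of the i-th coefficient is three times the i-th exponent. The exponent of a vanishing
    coefficient is taken to be -2, and the other two are 1. *)
Lemma ad_nilpotent_ferm (c1 c2 c3 : C) : c1 * c2 * c3 = 0 ->
  ad_nilpotent (e7_of (mkW (ferm c1 c2 c3 0 0))).
Proof.
move=> /eqP; rewrite !mulf_eq0 -orbA => /or3P[] /eqP ->.
- apply: (@ad_nilpotent_mkW _ (-2) 1); case_coords; rewrite /= ?eqxx //.
- apply: (@ad_nilpotent_mkW _ 1 (-2)); case_coords; rewrite /= ?eqxx //.
- apply: (@ad_nilpotent_mkW _ 1 1); case_coords; rewrite /= ?eqxx //.
Qed.
End NilpotentCubics.

Lemma lact00 (C : numFieldType) (l : tensor_type C) : lact 0 0 l = 0.
Proof.
apply/ffunP => I; apply/matrixP => i j; rewrite lactE ffunE !mxE.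
by rewrite !big1 ?addr0 // => k _; rewrite !mxE ?mul0r ?mulr0 ?addr0.
Qed.

Lemma dstar_sub (C : numFieldType) (p q : tensor_type C) : dstar (p - q) = dstar p - dstar q.
Proof.
have sE I i j : (p - q) I i j = p I i j - q I i j by rewrite !ffunE !mxE.
congr (_, _); apply/matrixP => i j; rewrite !mxE.
  rewrite -sumrB; apply: eq_bigr => I _; rewrite -sumrB; apply: eq_bigr => k _.
  by rewrite sE mulrBl.
rewrite -mulrBr; congr (_ * _).
rewrite -sumrB; apply: eq_bigr => I _; rewrite -sumrB; apply: eq_bigr => k _.
by rewrite sE mulrBl.
Qed.

Lemma omega_ex (C : numClosedFieldType) : exists w : C, w ^+ 2 = - 1 - w.
Proof.
have [w] := solve_monicpoly (fun _ => -1 : C) (isT : (0 < 2)%N).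
by rewrite !big_ord_recl big_ord0 => E; exists w; rewrite E /=; ring.
Qed.

(** * Transversality under perturbations of positive weight *)

Section WeightsTransverse.
Variable C : numClosedFieldType.
Local Notation tens := (tensor_type C).
Variables (w : 'I_6 -> int) (v : 'I_3 -> int).

Definition trunc (n : int) (l : tens) : tens :=
  [ffun I => \matrix_(i, j) if n <= w i + w j + v I then l I i j else 0].

Lemma truncE n l I i j :
  trunc n l I i j = if n <= w i + w j + v I then l I i j else 0.
Proof. by rewrite ffunE mxE. Qed.

Lemma trunc_id n (l : tens) : wt_ge w v n l -> trunc n l = l.
Proof.
move=> wl; apply/ffunP => I; apply/matrixP => i j; rewrite truncE.
by case: ifP => // /negbT nl; apply/esym/eqP; apply: contraNT nl => /wl.
Qed.

Lemma truncD n (l m : tens) : trunc n (l + m) = trunc n l + trunc n m.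
Proof.
apply/ffunP => I; apply/matrixP => i j.
have D (a b : tens) : (a + b) I i j = a I i j + b I i j by rewrite ffunE mxE.
by rewrite D !truncE D; case: ifP; rewrite ?addr0.
Qed.

(** As [k] has weight 0, cutting off weights in the image amounts to cutting them off in [X] and
    [Y]. *)
Lemma trunc_lact n X Y (k : tens) : (forall I i j, k I i j != 0 -> w i + w j + v I = 0) ->
  trunc n (lact X Y k) = lact (\matrix_(i, j) if n <= w i - w j then X i j else 0)
    (\matrix_(i, j) if n <= v i - v j then Y i j else 0) k.
Proof.
move=> hk; apply/ffunP => I; apply/matrixP => i j; rewrite truncE !lactE.
have T (b b' : bool) (x y : C) : (y != 0 -> b = b') ->
    (if b then x * y else 0) = (if b' then x else 0) * y.
  case: (eqVneq y 0) => [->|y0] bb; first by rewrite !mulr0; case: b {bb}.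
  by rewrite bb //; case: (b'); rewrite ?mul0r.
set c := n <= _; have push (m : nat) (F G : 'I_m -> C) :
    (forall x, (if c then F x else 0) = G x) -> (if c then \sum_x F x else 0) = \sum_x G x.
  by move=> FG; rewrite -(eq_bigr _ (fun x _ => FG x)); case: (c) => //; rewrite big1.
have split_if (x y : C) : (if c then x + y else 0) = (if c then x else 0) + (if c then y else 0).
  by case: (c); rewrite ?addr0.
rewrite split_if; congr (_ + _); apply: push => x.
  rewrite split_if !mxE; congr (_ + _).
    by apply: T => /hk; rewrite /c; lia.
  by rewrite mulrC; rewrite [RHS]mulrC; apply: T => /hk; rewrite /c; lia.
by rewrite !mxE; apply: T => /hk; rewrite /c; lia.
Qed.

(** A solution for [k], cut off at the lowest weight of [u], leaves for k + nu an error of strictly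
    higher weight. The induction is on the number [N] of weights left below the bound [B]. *)
Lemma max_transverse_weights (k nu : tens) : W nu ->
  (forall I i j, k I i j != 0 -> w i + w j + v I = 0) ->
  (forall n m, W m -> dstar m = 0 -> W (trunc n m) /\ dstar (trunc n m) = 0) ->
  wt_ge w v 1 nu -> max_transverse k -> max_transverse (k + nu).
Proof.
move=> Wnu hk ker wnu tr.
suff ind N (B : int) : forall u : tens, W u -> wt_ge w v (B - N%:Z) u ->
    (forall u : tens, wt_ge w v B u -> u = 0) -> exists X Y n, [/\ W n, dstar n = 0 & u = lact X Y (k + nu) + n].
  pose b : nat := (2 * \sum_i `|w i| + \sum_i `|v i|)%N.
  have bw i : (`|w i| <= \sum_i `|w i|)%N by rewrite (bigD1 i) //= leq_addr.
  have bv i : (`|v i| <= \sum_i `|v i|)%N by rewrite (bigD1 i) //= leq_addr.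
  move=> u Wu; have [|u' h|X [Y [n [Wn n0 E]]]] := @ind (2 * b + 1)%N (b%:Z + 1) u Wu.
  - by move=> I i j _; have := bw i; have := bw j; have := bv I; rewrite /b; lia.
  - apply/ffunP => I; apply/matrixP => i j; rewrite ffunE mxE; apply/eqP/negPn/negP.
    by move/h; have := bw i; have := bw j; have := bv I; rewrite /b; lia.
  by exists (lact X Y (k + nu)), n; split=> //; apply/tangent_orbitE; exists X, Y.
elim: N => [|N IH] u Wu wu top.
  exists 0, 0, 0; split; first by move=> I; rewrite ffunE trmx0 oppr0.
    by rewrite -(subrr u) dstar_sub subrr.
  by rewrite lact00 addr0; apply: top; move: wu; rewrite subr0.
have [_ [n0 [/tangent_orbitE[X [Y ->]] Wn0 ds0 uE]]] := tr u Wu.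
set n := B - N.+1%:Z in wu.
set X' := \matrix_(i, j) if n <= w i - w j then X i j else 0.
set Y' := \matrix_(i, j) if n <= v i - v j then Y i j else 0.
have {}uE : u = lact X' Y' k + trunc n n0.
  by rewrite -(trunc_id wu) {1}uE truncD (trunc_lact _ _ _ hk).
have [Wt dt] := ker n n0 Wn0 ds0.
have cut (t : bool) (x : C) : (if t then x else 0) != 0 -> t.
  by case: t; rewrite ?eqxx.
have [|X2 [Y2 [n2 [Wn2 dn2 E]]]] := IH (lact X' Y' nu) (lact_W _ _ Wnu) _ top.
  move=> I i j; rewrite lactE => /addf_neq0P[] /sum_neq0[x].
    rewrite /X' !mxE => /addf_neq0P[] /mulf_neq0P[].
      by move=> /cut h1 /wnu h2; rewrite /n in h1; lia.
    by move=> /wnu h2 /cut h1; rewrite /n in h1; lia.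
  by rewrite /Y' !mxE => /mulf_neq0P[/cut h1 /wnu h2]; rewrite /n in h1; lia.
exists (X' - X2), (Y' - Y2), (trunc n n0 - n2); split.
- have [[f ->] [g ->]] := (W_mkW Wt, W_mkW Wn2); rewrite mkW_sub; exact: mkW_W.
- by rewrite dstar_sub dt dn2 subrr.
have -> : lact (X' - X2) (Y' - Y2) (k + nu) = lact X' Y' (k + nu) - lact X2 Y2 (k + nu).
  rewrite [RHS]addrC -[- lact _ _ _]scaleN1r -lact_linear_l !scaleN1r.
  by rewrite [- X2 + _]addrC [- Y2 + _]addrC.
have -> : lact X' Y' (k + nu) = lact X' Y' k + lact X' Y' nu.
  by rewrite -[k]scale1r lact_linear_r !scale1r.
rewrite E uE; set p := lact X' Y' k; set r := lact X2 Y2 _.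
by rewrite (addrC r) [p + (n2 + r)]addrA addrK addrACA subrr addr0.
Qed.
End WeightsTransverse.

Section Omega.
Variable C : numClosedFieldType.

Lemma omega_neq (w : C) : w ^+ 2 = - 1 - w -> 2 * w + 1 != 0.
Proof.
move=> w2; have w21 : (2 * w + 1) ^+ 2 = - 3.
  by transitivity (4 * w ^+ 2 + 4 * w + 1); [ring|rewrite w2; ring].
apply/eqP => e; move/eqP: w21; rewrite e expr0n eq_sym oppr_eq0.
by rewrite pnatr_eq0.
Qed.

Lemma cube_w (w x y : C) : w ^+ 2 = - 1 - w ->
  (y * w + x * w ^+ 2) ^+ 3 = x ^+ 3 + y ^+ 3 + 3 * x * y * (w * y + (- 1 - w) * x).
Proof.
move=> w2; have w3 : w ^+ 3 = 1 by rewrite exprS w2 mulrBr -expr2 w2; ring.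
transitivity (w ^+ 3 * (y ^+ 3 + 3 * w * y ^+ 2 * x + 3 * w ^+ 2 * y * x ^+ 2 + w ^+ 3 * x ^+ 3)).
  by ring.
by rewrite w3 w2; ring.
Qed.

Lemma trans_k (c1 c2 c3 : C) : c1 * c2 * c3 = 0 ->
  max_transverse (mkW (ferm c1 c2 c3 (-2) 2)).
Proof.
move=> c0; have [w w2] := omega_ex C; have o0 := omega_neq w2.
have t3 : (2 : C) ^+ 3 != 0 by rewrite expf_neq0 ?pnatr_eq0.
have n3 : (- 2 : C) ^+ 3 = - 2 ^+ 3 by ring.
apply: (trans_ferm w2); rewrite ?c0 ?oppr_eq0 ?pnatr_eq0 ?add0r ?n3 ?[0 == _]eq_sym ?oppr_eq0 //.
- by rewrite -subr_eq0 (_ : _ - _ = - 16) ?oppr_eq0 ?pnatr_eq0 //; ring.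
- rewrite cube_w // (_ : _ + _ = - 24 * (2 * w + 1)); last by ring.
  by rewrite mulf_neq0 // oppr_eq0 pnatr_eq0.
rewrite addrC cube_w // (_ : _ + _ = 24 * (2 * w + 1)); last by ring.
by rewrite mulf_neq0 // pnatr_eq0.
Qed.
End Omega.

Section TransverseN3.
Variable C : numClosedFieldType.

Lemma trans_n3 (a r0 r1 r2 r3 : C) : max_transverse
  (mkW (fun I i j => kF C I i j + efF (cub (n3c a r0 r1 r2 r3)) I i j)).
Proof.
have -> : mkW (fun I i j => kF C I i j + efF (cub (n3c a r0 r1 r2 r3)) I i j)
    = mkW (kF C) + mkW (efF (cub (n3c a r0 r1 r2 r3))).
  rewrite -[mkW (kF C)]scale1r -mkW_linear; apply: mkW_eq => I i j _ _ _.
  by rewrite mul1r.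
apply: (@max_transverse_weights _ (weights6 1 2) (weights3 1 2)).
- exact: mkW_W.
- apply: (mkW_weights (P := fun n => n = 0)); case_coords; rewrite /kF /= ?eqxx //.
- move=> n _ /W_mkW[f ->] /dstar0P/symT_cub[d ->].
  (* For the weights 1, 2, -3, the monomial with exponents 3 - x - y, x, y has weight 3 + x - 4 y;
     hence the truncation of a cubic is again a cubic. *)
  have -> : trunc (weights6 1 2) (weights3 1 2) n (mkW (efF (cub d))) = mkW (efF (cub
      (fun x y => if n <= 3 + x%:Z - 4 * y%:Z then d x y else 0))).
    apply: W_eqP => [| |I i j I3 ij j6'].
    + move=> I; apply/matrixP => i j; rewrite mxE [in RHS]mxE !truncE.
      by rewrite (W_skew (mkW_W _)) (addrC (weights6 1 2 j)); case: ifP; rewrite ?oppr0.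
    + exact: mkW_W.
    rewrite truncE !mkWE /sk j3K // !j6K // ?(ltn_trans ij) // !lt_E ij.
    move: I i j I3 ij j6'; case_coords; rewrite /efF /cub /=; case: ifP => //.
  by split; [exact: mkW_W|exact: dstar_cub].
- exact: n3c_weights.
by apply: trans_k; rewrite !mul0r.
Qed.
End TransverseN3.

(** * Consequences of nilpotency, from eigenvalues of (ad p)^3 *)

Section NonNilpotent.
Variable C : numClosedFieldType.
Local Notation tens := (tensor_type C).

Lemma nilpotent_eigenvalue (p : tens) (y : tens * ('M[C]_6 * 'M[C]_3) * tens) (c : C) :
  ad_nilpotent (e7_of p) -> e7 y -> y != 0 ->
  iter 3 (e7_bracket (e7_of p)) y = c *: y -> c = 0.
Proof.
case=> n nil ey y0 E; apply/eqP; apply: contraNT y0 => c0.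
pose T := (tens * ('M[C]_6 * 'M[C]_3) * tens)%type.
have lin d (z : T) : e7_bracket (e7_of p) (d *: z) = d *: e7_bracket (e7_of p) z.
  by have := bracket_linear p d z 0; rewrite !addr0 bracket0 addr0.
have itl m d (z : T) : iter m (e7_bracket (e7_of p)) (d *: z) = d *: iter m (e7_bracket (e7_of p)) z.
  by elim: m => //= m ->; exact: lin.
have h m : iter (m * 3) (e7_bracket (e7_of p)) y = c ^+ m *: y.
  elim: m => [|m IH]; first by rewrite scale1r.
  by rewrite mulSn addnC iterD E itl IH scalerA -exprS.
have it0 m : iter m (e7_bracket (e7_of p)) (0 : T) = 0.
  by elim: m => //= m ->; exact: bracket0.
have : iter (n * 3) (e7_bracket (e7_of p)) y = 0.
  by rewrite mulnC mulSn addnC iterD nil.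
move/eqP; rewrite h => /eqP E0.
have := congr1 (fun z => c ^- n *: z) E0.
by rewrite scalerA mulVf ?expf_neq0 // scale1r scaler0 => ->.
Qed.

(** Three brackets with an element of W lead from sl_6 through W and W^* back to degree 0, and the
    hypotheses follow [u] along this path. The action of [u] enters with a minus sign, so the
    eigenvalue is - c. *)
Lemma nilpotent_eigenblock (f g' g : nat -> nat -> nat -> C) (u : nat -> nat -> C) (c : C) :
  ad_nilpotent (e7_of (mkW f)) ->
  sm 6 (fun i => u i i) = 0 -> (exists i j, [/\ (i < 6)%N, (j < 6)%N & u i j != 0]) ->
  mkW (lactF u (fun _ _ => 0) f) = mkW g' -> mkW (crossF f g') = mkW g ->
  (forall i j, (i < 6)%N -> (j < 6)%N -> pairF f g i j = c * u i j) ->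
  (forall i j, (i < 3)%N -> (j < 3)%N -> pairF3 f g i j = 0) -> c = 0.
Proof.
move=> nil u0 [i0 [j0 [i06 j06 un]]] eg' eg e6 e3; apply/eqP; rewrite -oppr_eq0; apply/eqP.
have tu : \tr (mk6 u) = 0.
  by rewrite /mxtrace big_sm6 -[RHS]u0; apply: eq_sm => k k6; rewrite mxE !j6K.
apply: (@nilpotent_eigenvalue (mkW f) (0, (mk6 u, 0), 0) (-c)) => //.
- split; rewrite ?mxtrace0 //; move=> I; rewrite !ffunE trmx0 oppr0 //.
- apply/eqP => /(congr1 (fun z : tens * ('M[C]_6 * 'M[C]_3) * tens => z.1.2.1 (j6 i0) (j6 j0))) /=.
  by rewrite !mxE !j6K //; apply/eqP.
rewrite -[iter 3 _ _]/(e7_bracket _ (e7_bracket _ (e7_bracket _ _))).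
have p60 (l : tens) : pair6 l 0 = 0.
  by apply: linear_fun0 => a x y; exact: pair6_linear_r.
have p30 (l : tens) : pair3 l 0 = 0.
  by apply: linear_fun0 => a x y; exact: pair3_linear_r.
have c0 (l : tens) : cross l 0 = 0.
  by apply: linear_fun0 => a x y; exact: cross_linear_r.
set m := cross (mkW f) (- lact (mk6 u) 0 (mkW f)).
have mE : m = - mkW g.
  rewrite /m -(_ : lact (mk6 u) (mk3 (fun _ _ => 0)) (mkW f) = lact (mk6 u) 0 (mkW f)); last first.
    by congr (lact _ _ _); apply/matrixP => i j; rewrite !mxE.
  by rewrite lactFE eg' -scaleN1r -[_ *: mkW _]addr0 cross_linear_r c0 crossE addr0 scaleN1r eg.
have -> : e7_bracket (e7_of (mkW f)) (0, (mk6 u, 0), 0)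
    = (0, (0, 0), - lact (mk6 u) 0 (mkW f)).
  by rewrite e7_bracket_of p60 p30 c0.
have -> : e7_bracket (e7_of (mkW f)) (0, (0, 0), - lact (mk6 u) 0 (mkW f))
    = (m, (0, 0), 0).
  by rewrite e7_bracket_of p60 p30 lact00 oppr0.
rewrite e7_bracket_of lact00 c0 oppr0.
have -> : pair6 (mkW f) m = - c *: mk6 u.
  rewrite mE -scaleN1r -[_ *: mkW _]addr0 pair6_linear_r p60 addr0 scaleN1r scaleNr.
  rewrite pair6E; congr (- _).
  have -> : mk6 (pairF f g) = c *: mk6 u.
    by apply/matrixP => i j; rewrite !mxE e6.
  by rewrite /tracefree linearZ /= tu mulr0 mul0r raddf0 subr0.
have -> : pair3 (mkW f) m = 0.
  rewrite mE -scaleN1r -[_ *: mkW _]addr0 pair3_linear_r p30 addr0 scaleN1r.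
  rewrite pair3E.
  have -> : mk3 (fun I J => 2^-1 * pairF3 f g I J) = 0.
    by apply/matrixP => i j; rewrite !mxE e3 ?mulr0.
  by rewrite /tracefree mxtrace0 mul0r raddf0 subr0 oppr0.
congr (_, (_, _), _); by rewrite scaler0.
Qed.

(** Matrices sending each f^j to a multiple of one e^i, with i = j for a = 0 and a cyclic shift for
    a = 1. For a = 0 they pass through [xxF] and [yyF] on the path of [nilpotent_eigenblock]. *)
Definition shiftU (a : nat) (u0 u1 u2 : C) (i j : nat) : C :=
  match a, i, j with
  | 0, 0, 3 => u0 | 0, 1, 4 => u1 | 0, 2, 5 => u2
  | 1, 0, 4 => u0 | 1, 1, 5 => u1 | 1, 2, 3 => u2
  | _, _, _ => 0%R end%N.

Definition xxF (p0 p1 p2 : C) (I i j : nat) : C :=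
  match I, i, j with
  | 0, 1, 2 => p0 | 1, 0, 2 => - p1 | 2, 0, 1 => p2 | _, _, _ => 0 end.
Definition yyF (p0 p1 p2 : C) (I i j : nat) : C :=
  match I, i, j with
  | 0, 4, 5 => p0 | 1, 3, 5 => - p1 | 2, 3, 4 => p2 | _, _, _ => 0 end.

Local Ltac expand := cbv [pairF pairF3 crossF wedgeF wedge4 lactF sm sk lt_ shiftU xxF
  yyF kF ferm efF cub eqn nat_of_bool addn addn_rec Nat.add]; rewrite /=.

(** The matrix sending each f^i to e^i is an eigenvector of the third power of the adjoint action.
    The cubic form does not contribute to its eigenvalue 64 mu^3. *)
Lemma nilpotent_slice (mu : C) (c : nat -> nat -> C) :
  ad_nilpotent (e7_of (mkW (fun I i j => mu * kF C I i j + efF (cub c) I i j))) ->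
  mu = 0.
Proof.
move=> nil.
have : - 64 * mu ^+ 3 = 0.
  apply: (@nilpotent_eigenblock _ (xxF (4 * mu) (4 * mu) (4 * mu))
    (yyF (16 * mu ^+ 2) (16 * mu ^+ 2) (16 * mu ^+ 2)) (shiftU 0%N 1 1 1) _ nil).
  - by cbv [sm shiftU]; rewrite !addr0.
  - by exists 0%N, 3%N; rewrite /= oner_eq0.
  - apply: mkW_eq; case_coords;
    expand; ring.
  - apply: mkW_eq; case_coords;
    expand; ring.
  - case=> [|[|[|[|[|[|i]]]]]] //; case=> [|[|[|[|[|[|j]]]]]] // _ _;
    expand; rewrite ?r0 ?r1 ?r2; ring.
  - case=> [|[|[|i]]] //; case=> [|[|[|j]]] // _ _; expand; ring.
by move/eqP; rewrite mulf_eq0 oppr_eq0 pnatr_eq0 expf_eq0 /= => /eqP.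
Qed.

Lemma nilpotent_ferm_diag (c1 c2 c3 l2 l3 w : C) : w ^+ 3 = 1 ->
  ad_nilpotent (e7_of (mkW (ferm c1 c2 c3 l2 l3))) -> l3 * w = l2.
Proof.
move=> w3 nil.
have w0 : w != 0 by apply: contra_eq_neq w3 => ->; rewrite expr0n /= eq_sym oner_eq0.
(* Up to sign, each bracket of the path multiplies the triple (1, w, w^2) by [t]; the eigenvalue is
   the cube of [t]. *)
pose t := l3 * w ^+ 2 - l2 * w.
pose T x y := l3 * x - l2 * y.
have t0 x : T (w ^+ 2 * x) (w * x) = t * x by rewrite /T /t; ring.
have t1 x : T x (w ^+ 2 * x) = t * (w * x).
  by rewrite /T /t -[l3 * x]mulr1 -w3; ring.
have t2 x : T (w * x) x = t * (w ^+ 2 * x).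
  by rewrite /T /t -[l3 * _]mulr1 -[l2 * _]mulr1 -w3; ring.
pose p0 := T (w ^+ 2) w; pose p1 := T 1 (w ^+ 2); pose p2 := T w 1.
pose q0 := T p2 p1; pose q1 := T p0 p2; pose q2 := T p1 p0.
have [Ep0 Ep1 Ep2] : [/\ p0 = t, p1 = w * t & p2 = w ^+ 2 * t].
  by have := t0 1; have := t1 1; have := t2 1; rewrite !mulr1 /p0 /p1 /p2 => -> -> ->;
    split; ring.
have [Eq0 Eq1 Eq2] : [/\ q0 = t ^+ 2, q1 = w * t ^+ 2 & q2 = w ^+ 2 * t ^+ 2].
  rewrite /q0 /q1 /q2 Ep0 Ep1 Ep2; rewrite t0 t1 t2; split; ring.
have [r0 r1 r2] : [/\ T q2 q1 = t ^+ 3, T q0 q2 = t ^+ 3 * w & T q1 q0 = t ^+ 3 * w ^+ 2].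
  rewrite Eq0 Eq1 Eq2 t0 t1 t2; split; ring.
have : - t ^+ 3 = 0.
  apply: (@nilpotent_eigenblock _ (xxF p0 p1 p2)
    (yyF q0 q1 q2) (shiftU 0%N 1 w (w ^+ 2)) _ nil).
  - by cbv [sm shiftU]; rewrite !addr0.
  - by exists 0%N, 3%N; rewrite /= oner_eq0.
  - apply: mkW_eq; case_coords;
    expand; rewrite /q0 /q1 /q2 /p0 /p1 /p2 /T; ring.
  - apply: mkW_eq; case_coords;
    expand; rewrite /q0 /q1 /q2 /p0 /p1 /p2 /T; ring.
  - case=> [|[|[|[|[|[|i]]]]]] //; case=> [|[|[|[|[|[|j]]]]]] // _ _;
    expand; rewrite [RHS]mulNr ?[X in _ = - X]mulr1 -?r1 -?r2 -?r0 /T; ring.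
  - case=> [|[|[|i]]] //; case=> [|[|[|j]]] // _ _; expand; rewrite /q0 /q1 /q2 /p0 /p1 /p2 /T; ring.
move/eqP; rewrite oppr_eq0 expf_eq0 /= subr_eq0 => /eqP E.
by apply: (mulIf w0); rewrite -mulrA -expr2.
Qed.

(** The cube root 1 gives l3 = l2 and a primitive one gives l3 w = l2, so both vanish. The shifted
    block then has eigenvalue c1 c2 c3 up to sign. *)
Lemma nilpotent_ferm (c1 c2 c3 l2 l3 : C) :
  ad_nilpotent (e7_of (mkW (ferm c1 c2 c3 l2 l3))) ->
  [/\ l2 = 0, l3 = 0 & c1 * c2 * c3 = 0].
Proof.
move=> nil; have [w w2] := omega_ex C.
have w3 : w ^+ 3 = 1 by rewrite exprS w2 mulrBr -expr2 w2; ring.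
have E1 : l3 = l2 by rewrite -(nilpotent_ferm_diag (expr1n _ 3) nil) mulr1.
have E2 := nilpotent_ferm_diag w3 nil.
have w1 : w != 1.
  apply: contra_eq_neq w2 => ->; rewrite expr1n -subr_eq0 opprB opprK.
  by rewrite (_ : 1 + (1 + 1) = 3%:R :> C) ?pnatr_eq0 //; ring.
have L3 : l3 = 0.
  apply/eqP; move/eqP: E2; rewrite -{}E1 -subr_eq0 -{2}[l3]mulr1 -mulrBr mulf_eq0.
  by rewrite subr_eq0 (negPf w1) orbF.
have L2 : l2 = 0 by rewrite -E1.
split=> //; rewrite L3 L2 in nil.
apply: (@nilpotent_eigenblock _ (fun I i j => match I, i, j with
    | 0, 0, 2 => c1 | 1, 0, 1 => - c2 | 2, 1, 2 => - c3 | _, _, _ => 0 end)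
  (fun I i j => match I, i, j with
    | 0, 3, 4 => c2 * c3 | 1, 4, 5 => c3 * c1 | 2, 3, 5 => - (c1 * c2) | _, _, _ => 0 end)
  (shiftU 1%N 1 1 1) _ nil).
  - by cbv [sm shiftU]; rewrite !addr0.
  - by exists 0%N, 4%N; rewrite /= oner_eq0.
  - apply: mkW_eq; case_coords;
    expand; ring.
  - apply: mkW_eq; case_coords;
    expand; ring.
  - case=> [|[|[|[|[|[|i]]]]]] //; case=> [|[|[|[|[|[|j]]]]]] // _ _;
    expand; rewrite ?r0 ?r1 ?r2; ring.
  - case=> [|[|[|i]]] //; case=> [|[|[|j]]] // _ _; expand; ring.
Qed.
End NonNilpotent.

(** * Centralizers of the Cartan elements in W *)

Section Centralizer.
Variable C : numClosedFieldType.

(** Going once around the cycle gives p^3 x = q^3 x. *)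
Lemma cyc3 (p q x y z : C) : p ^+ 3 != q ^+ 3 ->
  p * x = q * y -> p * y = q * z -> p * z = q * x -> [/\ x = 0, y = 0 & z = 0].
Proof.
move=> pq xy yz zx; have d : p ^+ 3 - q ^+ 3 != 0 by rewrite subr_eq0.
have E t : p ^+ 3 * t = q ^+ 3 * t -> t = 0.
  by move/eqP; rewrite -subr_eq0 -mulrBl mulf_eq0 (negPf d) => /eqP.
have h x' y' z' : p * x' = q * y' -> p * y' = q * z' -> p * z' = q * x' -> x' = 0.
  move=> e1 e2 e3; apply: E; transitivity (p ^+ 2 * (p * x')); first by ring.
  rewrite e1; transitivity (p * q * (p * y')); first by ring.
  rewrite e2; transitivity (q ^+ 2 * (p * z')); first by ring.
  by rewrite e3; ring.
split; [exact: h xy yz zx|exact: h yz zx xy|exact: h zx xy yz].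
Qed.

(** The predecessor modulo 3. *)
Definition pr (k : nat) : nat := match k with 0 => 2 | 1 => 0 | _ => 1 end.

(* The linear system is a 3 x 3 system over the group ring of Z/3, with
   determinant a generator times the sum of the cubes minus 3 L0 L1 L2. *)
Lemma block_solve (L0 L1 L2 : C) (a b c : nat -> C) :
  (L0 ^+ 3 + L1 ^+ 3 + L2 ^+ 3) ^+ 3 != (3 * (L0 * L1 * L2)) ^+ 3 ->
  (forall k, (k < 3)%N -> L2 * a k + L1 * b k + L0 * c (pr k) = 0) ->
  (forall k, (k < 3)%N -> L0 * a k + L2 * b (pr k) + L1 * c k = 0) ->
  (forall k, (k < 3)%N -> L1 * a (pr k) + L0 * b k + L2 * c k = 0) ->
  forall k, (k < 3)%N -> [/\ a k = 0, b k = 0 & c k = 0].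
Proof.
move=> d h1 h2 h3.
set p := (L0 ^+ 3 + _ + _) in d; set q := 3 * _ in d.
pose A k := L2 * a k + L1 * b k + L0 * c (pr k).
pose B k := L0 * a k + L2 * b (pr k) + L1 * c k.
pose D k := L1 * a (pr k) + L0 * b k + L2 * c k.
have A0 k : (k < 3)%N -> A k = 0 by exact: h1.
have B0 k : (k < 3)%N -> B k = 0 by exact: h2.
have D0 k : (k < 3)%N -> D k = 0 by exact: h3.
have pr3 k : (pr k < 3)%N by case: k => [|[|k]].
(* Cofactor combinations of the equations leave, on each of [a], [b], [c] separately, the operator p
   times the shift minus q; [cyc3] inverts it. *)
have ea k : (k < 3)%N -> p * a (pr k) = q * a k.
  move=> k3; apply/eqP; rewrite -subr_eq0; apply/eqP.
  transitivity (L2 ^+ 2 * A (pr k) - L0 * L1 * A k + L0 ^+ 2 * B (pr k)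
    - L1 * L2 * B k + L1 ^+ 2 * D k - L0 * L2 * D (pr (pr k))).
    by rewrite /p /q /A /B /D; case: k k3 => [|[|[|k]]] // _; rewrite /pr; ring.
  by rewrite !A0 ?B0 ?D0 //; ring.
have eb k : (k < 3)%N -> p * b (pr k) = q * b k.
  move=> k3; apply/eqP; rewrite -subr_eq0; apply/eqP.
  transitivity (L1 ^+ 2 * A (pr k) - L0 * L2 * A k + L2 ^+ 2 * B k
    - L0 * L1 * B (pr (pr k)) + L0 ^+ 2 * D (pr k) - L1 * L2 * D k).
    by rewrite /p /q /A /B /D; case: k k3 => [|[|[|k]]] // _; rewrite /pr; ring.
  by rewrite !A0 ?B0 ?D0 //; ring.
have ec k : (k < 3)%N -> p * c (pr k) = q * c k.
  move=> k3; apply/eqP; rewrite -subr_eq0; apply/eqP.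
  transitivity (L0 ^+ 2 * A k - L1 * L2 * A (pr (pr k)) + L1 ^+ 2 * B (pr k)
    - L0 * L2 * B k + L2 ^+ 2 * D (pr k) - L0 * L1 * D k).
    by rewrite /p /q /A /B /D; case: k k3 => [|[|[|k]]] // _; rewrite /pr; ring.
  by rewrite !A0 ?B0 ?D0 //; ring.
have [a0 a1 a2] := cyc3 d (ea 1%N isT) (ea 2%N isT) (ea 0%N isT).
have [b0 b1 b2] := cyc3 d (eb 1%N isT) (eb 2%N isT) (eb 0%N isT).
have [c0 c1 c2] := cyc3 d (ec 1%N isT) (ec 2%N isT) (ec 0%N isT).
by case=> [|[|[|k]]].
Qed.

Section Equations.
Variables (c l2 l3 : C) (f : nat -> nat -> nat -> C).
Hypothesis E : cross (mkW (ferm c c c l2 l3)) (mkW f) = 0.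

Let E' K i j : (K < 3)%N -> (i < j)%N -> (j < 6)%N ->
  crossF (ferm c c c l2 l3) f K i j = 0.
Proof.
move=> K3 ij j6'; have := congr1 (fun t : tensor_type C => t (j3 K) (j6 i) (j6 j)) E.
by rewrite crossE mkWE /sk j3K // !j6K ?(ltn_trans ij) // lt_E ij !ffunE mxE.
Qed.

Local Notation F I i j := (f I%N i%N j%N) (only parsing).
Local Ltac entry K i j := rewrite -[RHS](@E' K i j isT isT isT);
  cbv [crossF wedgeF wedge4 ferm]; rewrite /=; ring.
Local Ltac entryN K i j := apply: oppr_inj; rewrite [RHS]oppr0 -[RHS](@E' K i j isT isT isT);
  cbv [crossF wedgeF wedge4 ferm]; rewrite /=; ring.

(** In the commutation equations, the digits after [e] are K, i, j for the entry (K, i, 3 + j),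
    which involves mixed coefficients of [f]. The [z] equations, on e /\ e and f /\ f coefficients,
    come in the cyclic triples of [cyc3]. *)
Let e001 : l3 * F 2 1 5 + c * F 1 1 3 + l2 * F 1 2 5 = 0.
Proof. by entryN 0%N 0%N 4%N. Qed.
Let e002 : c * F 2 2 3 + l3 * F 2 1 4 + l2 * F 1 2 4 = 0.
Proof. by entry 0%N 0%N 5%N. Qed.
Let e010 : l2 * F 2 2 4 + c * F 1 0 4 + l3 * F 1 2 5 = 0.
Proof. by entryN 0%N 1%N 3%N. Qed.
Let e011 : l3 * F 2 0 5 + l2 * F 2 2 3 + c * F 1 0 3 = 0.
Proof. by entry 0%N 1%N 4%N. Qed.
Let e020 : c * F 2 0 5 + l2 * F 2 1 4 + l3 * F 1 1 5 = 0.
Proof. by entry 0%N 2%N 3%N. Qed.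
Let e022 : c * F 2 0 3 + l3 * F 1 1 3 + l2 * F 1 0 4 = 0.
Proof. by entryN 0%N 2%N 5%N. Qed.
Let e100 : c * F 0 1 4 + l3 * F 2 2 4 + l2 * F 2 1 5 = 0.
Proof. by entryN 1%N 0%N 3%N. Qed.
Let e101 : c * F 0 1 3 + l2 * F 0 2 5 + l3 * F 2 2 3 = 0.
Proof. by entry 1%N 0%N 4%N. Qed.
Let e102 : l2 * F 0 2 4 - l2 * F 2 1 3 = 0.
Proof. by entryN 1%N 0%N 5%N. Qed.
Let e110 : c * F 0 0 4 + l3 * F 0 2 5 + l2 * F 2 0 5 = 0.
Proof. by entry 1%N 1%N 3%N. Qed.
Let e111 : c * F 0 0 3 - c * F 2 2 5 = 0.
Proof. by entryN 1%N 1%N 4%N. Qed.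
Let e112 : l3 * F 0 2 3 + c * F 2 2 4 + l2 * F 2 0 3 = 0.
Proof. by entryN 1%N 1%N 5%N. Qed.
Let e120 : l3 * F 0 1 5 - l3 * F 2 0 4 = 0.
Proof. by entryN 1%N 2%N 3%N. Qed.
Let e121 : l2 * F 0 0 5 + c * F 2 1 5 + l3 * F 2 0 3 = 0.
Proof. by entryN 1%N 2%N 4%N. Qed.
Let e122 : l3 * F 0 1 3 + l2 * F 0 0 4 + c * F 2 1 4 = 0.
Proof. by entry 1%N 2%N 5%N. Qed.
Let e200 : l3 * F 1 2 4 + l2 * F 1 1 5 + c * F 0 2 5 = 0.
Proof. by entry 2%N 0%N 3%N. Qed.
Let e201 : l3 * F 1 2 3 - l3 * F 0 1 5 = 0.
Proof. by entryN 2%N 0%N 4%N. Qed.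
Let e202 : l2 * F 1 1 3 + c * F 0 2 3 + l3 * F 0 1 4 = 0.
Proof. by entryN 2%N 0%N 5%N. Qed.
Let e210 : l2 * F 1 0 5 - l2 * F 0 2 4 = 0.
Proof. by entryN 2%N 1%N 3%N. Qed.
Let e211 : c * F 1 2 5 + l3 * F 0 0 5 + l2 * F 0 2 3 = 0.
Proof. by entryN 2%N 1%N 4%N. Qed.
Let e212 : c * F 1 2 4 + l2 * F 1 0 3 + l3 * F 0 0 4 = 0.
Proof. by entry 2%N 1%N 5%N. Qed.
Let e220 : l3 * F 1 0 4 + c * F 0 0 5 + l2 * F 0 1 4 = 0.
Proof. by entryN 2%N 2%N 3%N. Qed.
Let e221 : c * F 1 1 5 + l3 * F 1 0 3 + l2 * F 0 1 3 = 0.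
Proof. by entry 2%N 2%N 4%N. Qed.
Let e222 : c * F 1 1 4 - c * F 0 0 3 = 0.
Proof. by entryN 2%N 2%N 5%N. Qed.
Let z0d0 : l3 * (F 2 0 1) = l2 * (- F 1 0 2).
Proof. by apply/eqP; rewrite -subr_eq0; apply/eqP; first [entry 0%N 4%N 5%N|entryN 0%N 4%N 5%N]. Qed.
Let z0d1 : l3 * (F 0 1 2) = l2 * (F 2 0 1).
Proof. by apply/eqP; rewrite -subr_eq0; apply/eqP; first [entry 1%N 3%N 5%N|entryN 1%N 3%N 5%N]. Qed.
Let z0d2 : l3 * (- F 1 0 2) = l2 * (F 0 1 2).
Proof. by apply/eqP; rewrite -subr_eq0; apply/eqP; first [entry 2%N 3%N 4%N|entryN 2%N 3%N 4%N]. Qed.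
Let z0a0 : c * (- F 2 0 2) = l3 * (F 1 1 2).
Proof. by apply/eqP; rewrite -subr_eq0; apply/eqP; first [entry 0%N 3%N 5%N|entryN 0%N 3%N 5%N]. Qed.
Let z0a1 : c * (F 0 0 1) = l3 * (- F 2 0 2).
Proof. by apply/eqP; rewrite -subr_eq0; apply/eqP; first [entry 1%N 3%N 4%N|entryN 1%N 3%N 4%N]. Qed.
Let z0a2 : c * (F 1 1 2) = l3 * (F 0 0 1).
Proof. by apply/eqP; rewrite -subr_eq0; apply/eqP; first [entry 2%N 4%N 5%N|entryN 2%N 4%N 5%N]. Qed.
Let z0b0 : l2 * (F 2 1 2) = c * (F 1 0 1).
Proof. by apply/eqP; rewrite -subr_eq0; apply/eqP; first [entry 0%N 3%N 4%N|entryN 0%N 3%N 4%N]. Qed.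
Let z0b1 : l2 * (- F 0 0 2) = c * (F 2 1 2).
Proof. by apply/eqP; rewrite -subr_eq0; apply/eqP; first [entry 1%N 4%N 5%N|entryN 1%N 4%N 5%N]. Qed.
Let z0b2 : l2 * (F 1 0 1) = c * (- F 0 0 2).
Proof. by apply/eqP; rewrite -subr_eq0; apply/eqP; first [entry 2%N 3%N 5%N|entryN 2%N 3%N 5%N]. Qed.
Let z3d0 : l2 * (F 2 3 4) = l3 * (- F 1 3 5).
Proof. by apply/eqP; rewrite -subr_eq0; apply/eqP; first [entry 0%N 1%N 2%N|entryN 0%N 1%N 2%N]. Qed.
Let z3d1 : l2 * (F 0 4 5) = l3 * (F 2 3 4).
Proof. by apply/eqP; rewrite -subr_eq0; apply/eqP; first [entry 1%N 0%N 2%N|entryN 1%N 0%N 2%N]. Qed.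
Let z3d2 : l2 * (- F 1 3 5) = l3 * (F 0 4 5).
Proof. by apply/eqP; rewrite -subr_eq0; apply/eqP; first [entry 2%N 0%N 1%N|entryN 2%N 0%N 1%N]. Qed.
Let z3a0 : c * (- F 2 3 5) = l2 * (F 1 4 5).
Proof. by apply/eqP; rewrite -subr_eq0; apply/eqP; first [entry 0%N 0%N 2%N|entryN 0%N 0%N 2%N]. Qed.
Let z3a1 : c * (F 0 3 4) = l2 * (- F 2 3 5).
Proof. by apply/eqP; rewrite -subr_eq0; apply/eqP; first [entry 1%N 0%N 1%N|entryN 1%N 0%N 1%N]. Qed.
Let z3a2 : c * (F 1 4 5) = l2 * (F 0 3 4).
Proof. by apply/eqP; rewrite -subr_eq0; apply/eqP; first [entry 2%N 1%N 2%N|entryN 2%N 1%N 2%N]. Qed.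
Let z3b0 : l3 * (F 2 4 5) = c * (F 1 3 4).
Proof. by apply/eqP; rewrite -subr_eq0; apply/eqP; first [entry 0%N 0%N 1%N|entryN 0%N 0%N 1%N]. Qed.
Let z3b1 : l3 * (- F 0 3 5) = c * (F 2 4 5).
Proof. by apply/eqP; rewrite -subr_eq0; apply/eqP; first [entry 1%N 1%N 2%N|entryN 1%N 1%N 2%N]. Qed.
Let z3b2 : l3 * (F 1 3 4) = c * (- F 0 3 5).
Proof. by apply/eqP; rewrite -subr_eq0; apply/eqP; first [entry 2%N 0%N 2%N|entryN 2%N 0%N 2%N]. Qed.

Hypotheses (n2 : c ^+ 3 != l2 ^+ 3) (n3 : c ^+ 3 != l3 ^+ 3) (n23 : l2 ^+ 3 != l3 ^+ 3).

Lemma central_xx_yy I i j : (I < 3)%N -> (i < j)%N -> (j < 3)%N ->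
  f I i j = 0 /\ f I (3 + i)%N (3 + j)%N = 0.
Proof.
have m2 : l2 ^+ 3 != c ^+ 3 by rewrite eq_sym.
have m3 : l3 ^+ 3 != c ^+ 3 by rewrite eq_sym.
have m23 : l3 ^+ 3 != l2 ^+ 3 by rewrite eq_sym.
have N x : - x = 0 -> x = 0 :> C by move/eqP; rewrite oppr_eq0 => /eqP.
have [q0d0 q0d1 q0d2] := cyc3 m23 z0d0 z0d2 z0d1.
have [q0a0 q0a1 q0a2] := cyc3 n3 z0a0 z0a2 z0a1.
have [q0b0 q0b1 q0b2] := cyc3 m2 z0b0 z0b2 z0b1.
have [q3d0 q3d1 q3d2] := cyc3 n23 z3d0 z3d2 z3d1.
have [q3a0 q3a1 q3a2] := cyc3 n2 z3a0 z3a2 z3a1.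
have [q3b0 q3b1 q3b2] := cyc3 m3 z3b0 z3b2 z3b1.
case: I => [|[|[|I]]] //; case: i => [|[|i]] //; case: j => [|[|[|j]]] // _ _ _;
  by split=> //; apply: N.
Qed.

Lemma central_diag :
  [/\ c * (F 0 0 3 - F 1 1 4) = 0 /\ c * (F 0 0 3 - F 2 2 5) = 0,
      l3 * (F 0 1 5 - F 1 2 3) = 0 /\ l3 * (F 0 1 5 - F 2 0 4) = 0
    & l2 * (F 0 2 4 - F 1 0 5) = 0 /\ l2 * (F 0 2 4 - F 2 1 3) = 0].
Proof.
split; split.
- by rewrite -[RHS]oppr0 -[in RHS]e222; ring.
- by rewrite -[RHS]e111; ring.
- by rewrite -[RHS]oppr0 -[in RHS]e201; ring.
- by rewrite -[RHS]e120; ring.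
- by rewrite -[RHS]oppr0 -[in RHS]e210; ring.
- by rewrite -[RHS]e102; ring.
Qed.

(** The equations respect the class of I + i + j modulo 3. The classes 1 and 2 have nine unknowns
    each and form a system for [block_solve]; class 0 holds the terms of [ferm]. *)
Lemma central_off : (c ^+ 3 + l3 ^+ 3 + l2 ^+ 3) ^+ 3 != (3 * (c * l3 * l2)) ^+ 3 ->
  forall I i j, (I < 3)%N -> (i < 3)%N -> (j < 3)%N -> ((I + i + j) %% 3 != 0)%N ->
  f I i (3 + j)%N = 0.
Proof.
move=> d.
have d2 : (c ^+ 3 + l2 ^+ 3 + l3 ^+ 3) ^+ 3 != (3 * (c * l2 * l3)) ^+ 3.
  by rewrite addrAC (mulrAC c).
have h1 := @block_solve c l3 l2
  (fun k : nat => match k with 0 => F 0 0 4 | 1 => F 1 1 5 | _ => F 2 2 3 end)%N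
  (fun k : nat => match k with 0 => F 0 1 3 | 1 => F 1 2 4 | _ => F 2 0 5 end)%N
  (fun k : nat => match k with 0 => F 0 2 5 | 1 => F 1 0 3 | _ => F 2 1 4 end)%N d.
have k1 := h1
  (ltac:(by case=> [|[|[|k]]] // _; rewrite /pr; first [rewrite -[RHS]e122; ring|rewrite -[RHS]e200; ring|rewrite -[RHS]e011; ring]))
  (ltac:(by case=> [|[|[|k]]] // _; rewrite /pr; first [rewrite -[RHS]e110; ring|rewrite -[RHS]e221; ring|rewrite -[RHS]e002; ring]))
  (ltac:(by case=> [|[|[|k]]] // _; rewrite /pr; first [rewrite -[RHS]e101; ring|rewrite -[RHS]e212; ring|rewrite -[RHS]e020; ring])).
have [w004 w013 w025] := k1 0%N isT.
have [w115 w124 w103] := k1 1%N isT.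
have [w223 w205 w214] := k1 2%N isT.
have h2 := @block_solve c l2 l3
  (fun k : nat => match k with 0 => F 0 0 5 | 1 => F 2 2 4 | _ => F 1 1 3 end)%N
  (fun k : nat => match k with 0 => F 0 2 3 | 1 => F 2 1 5 | _ => F 1 0 4 end)%N
  (fun k : nat => match k with 0 => F 0 1 4 | 1 => F 2 0 3 | _ => F 1 2 5 end)%N d2.
have k2 := h2
  (ltac:(by case=> [|[|[|k]]] // _; rewrite /pr; first [rewrite -[RHS]e211; ring|rewrite -[RHS]e100; ring|rewrite -[RHS]e022; ring]))
  (ltac:(by case=> [|[|[|k]]] // _; rewrite /pr; first [rewrite -[RHS]e220; ring|rewrite -[RHS]e112; ring|rewrite -[RHS]e001; ring]))
  (ltac:(by case=> [|[|[|k]]] // _; rewrite /pr; first [rewrite -[RHS]e202; ring|rewrite -[RHS]e121; ring|rewrite -[RHS]e010; ring])).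
have [w005 w023 w014] := k2 0%N isT.
have [w224 w215 w203] := k2 1%N isT.
have [w113 w104 w125] := k2 2%N isT.
by case=> [|[|[|I]]] //; case=> [|[|[|i]]] //; case=> [|[|[|j]]].
Qed.

(** The equations become the symmetries of a cubic form, except that the six entries with distinct
    indices may take two values; a multiple of k accounts for their difference. *)
Lemma central_sym : c = 0 -> l3 = - l2 -> l2 != 0 ->
  exists mu d, mkW f = mkW (fun I i j => mu * kF C I i j + efF (cub d) I i j).
Proof.
move=> c0 l3E l20.
have S x y : l2 * x - l2 * y = 0 -> x = y :> C.
  by rewrite -mulrBr => /eqP; rewrite mulf_eq0 (negPf l20) subr_eq0 => /eqP.
have s001 : F 1 2 5 = F 2 1 5 by apply: S; rewrite -[RHS]e001 c0 l3E; ring.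
have s002 : F 1 2 4 = F 2 1 4 by apply: S; rewrite -[RHS]e002 c0 l3E; ring.
have s010 : F 2 2 4 = F 1 2 5 by apply: S; rewrite -[RHS]e010 c0 l3E; ring.
have s011 : F 2 2 3 = F 2 0 5 by apply: S; rewrite -[RHS]e011 c0 l3E; ring.
have s020 : F 2 1 4 = F 1 1 5 by apply: S; rewrite -[RHS]e020 c0 l3E; ring.
have s022 : F 1 0 4 = F 1 1 3 by apply: S; rewrite -[RHS]e022 c0 l3E; ring.
have s100 : F 2 1 5 = F 2 2 4 by apply: S; rewrite -[RHS]e100 c0 l3E; ring.
have s101 : F 0 2 5 = F 2 2 3 by apply: S; rewrite -[RHS]e101 c0 l3E; ring.
have s110 : F 2 0 5 = F 0 2 5 by apply: S; rewrite -[RHS]e110 c0 l3E; ring.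
have s112 : F 2 0 3 = F 0 2 3 by apply: S; rewrite -[RHS]e112 c0 l3E; ring.
have s121 : F 0 0 5 = F 2 0 3 by apply: S; rewrite -[RHS]e121 c0 l3E; ring.
have s122 : F 0 0 4 = F 0 1 3 by apply: S; rewrite -[RHS]e122 c0 l3E; ring.
have s200 : F 1 1 5 = F 1 2 4 by apply: S; rewrite -[RHS]e200 c0 l3E; ring.
have s202 : F 1 1 3 = F 0 1 4 by apply: S; rewrite -[RHS]e202 c0 l3E; ring.
have s211 : F 0 2 3 = F 0 0 5 by apply: S; rewrite -[RHS]e211 c0 l3E; ring.
have s212 : F 1 0 3 = F 0 0 4 by apply: S; rewrite -[RHS]e212 c0 l3E; ring.
have s220 : F 0 1 4 = F 1 0 4 by apply: S; rewrite -[RHS]e220 c0 l3E; ring.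
have s221 : F 0 1 3 = F 1 0 3 by apply: S; rewrite -[RHS]e221 c0 l3E; ring.
have [_ [d1 d2] [d3 d4]] := central_diag.
have D3 x y : l3 * (x - y) = 0 -> x = y :> C by rewrite l3E mulNr mulrBr => /eqP; rewrite oppr_eq0 => /eqP/S.
have D2 x y : l2 * (x - y) = 0 -> x = y :> C by rewrite mulrBr; exact: S.
have r015 := D3 _ _ d1; have r015' := D3 _ _ d2; have r024 := D2 _ _ d3; have r024' := D2 _ _ d4.
have r013 : F 0 1 3 = F 0 0 4 by rewrite -s122.
have r103 : F 1 0 3 = F 0 0 4 by rewrite s212.
have r203 : F 2 0 3 = F 0 0 5 by rewrite -s121.
have r023 : F 0 2 3 = F 0 0 5 by rewrite s211.
have r113 : F 1 1 3 = F 0 1 4 by rewrite s202.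
have r104 : F 1 0 4 = F 0 1 4 by rewrite -s220.
have r223 : F 2 2 3 = F 0 2 5 by rewrite -s101.
have r205 : F 2 0 5 = F 0 2 5 by rewrite s110.
have r214 : F 2 1 4 = F 1 1 5 by rewrite s020.
have r124 : F 1 2 4 = F 1 1 5 by rewrite -s200.
have r215 : F 2 1 5 = F 1 2 5 by rewrite -s001.
have r224 : F 2 2 4 = F 1 2 5 by rewrite s010.
(* At these two places k has the entries 2 and -2. *)
pose mu := (F 0 1 5 - F 0 2 4) / 4.
have mu4 : F 0 1 5 = F 0 2 4 + 4 * mu by rewrite /mu; field.
have sT : symT (fun I i j => f I i j - mu * kF C I i j).
  split.
  - move=> I i j I3 ij j3'; have [-> _] := central_xx_yy I3 ij j3'.
    move: I i j I3 ij j3'.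
    by case=> [|[|[|I]]] //; case=> [|[|i]] //; case=> [|[|[|j]]] // _ _ _; rewrite /=; ring.
  - move=> I i j I3 ij j3'; have [_ ->] := central_xx_yy I3 ij j3'.
    move: I i j I3 ij j3'.
    by case=> [|[|[|I]]] //; case=> [|[|i]] //; case=> [|[|[|j]]] // _ _ _; rewrite /=; ring.
  - by case=> [|[|[|I]]] //; case=> [|[|i]] //; case=> [|[|[|j]]] // _ _ _;
      rewrite /= ?(r013, r103, r203, r023, r113, r104, r223, r205, r214, r124, r215, r224, =^~ r015, =^~ r015', =^~ r024, =^~ r024', mu4); ring.
  - by case=> [|[|I]] //; move=> i; case=> [|[|[|j]]] //; case: i => [|[|[|i]]] // _ _ _;
      rewrite /= ?(r013, r103, r203, r023, r113, r104, r223, r205, r214, r124, r215, r224, =^~ r015, =^~ r015', =^~ r024, =^~ r024', mu4); ring.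
have [d Ed] := symT_cub sT; exists mu, d.
transitivity (mu *: mkW (kF C) + mkW (fun I i j => f I i j - mu * kF C I i j)).
  by rewrite -mkW_linear; apply: mkW_eq => I i j _ _ _; ring.
by rewrite Ed mkW_linear.
Qed.
End Equations.

Lemma ferm_shape (c1 c2 c3 l2 l3 : C) f :
  (forall I i j, (I < 3)%N -> (i < j)%N -> (j < 3)%N ->
     f I i j = 0 /\ f I (3 + i)%N (3 + j)%N = 0) ->
  (forall I i j, (I < 3)%N -> (i < 3)%N -> (j < 3)%N -> ((I + i + j) %% 3 != 0)%N ->
     f I i (3 + j)%N = 0) ->
  [/\ f 0%N 0%N 3%N = c1, f 1%N 1%N 4%N = c2 & f 2%N 2%N 5%N = c3] ->
  [/\ f 0%N 2%N 4%N = l2, f 1%N 0%N 5%N = l2 & f 2%N 1%N 3%N = l2] ->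
  [/\ f 0%N 1%N 5%N = l3, f 1%N 2%N 3%N = l3 & f 2%N 0%N 4%N = l3] ->
  mkW f = mkW (ferm c1 c2 c3 l2 l3).
Proof.
move=> z off [e1 e2 e3] [e4 e5 e6] [e7 e8 e9]; apply: mkW_eq => I i j I3 ij j6'.
case: (ltnP j 3) => [j3'|j3'].
  have [-> _] := z I i j I3 ij j3'; move: I i j I3 ij j3' {j6'}.
  by case=> [|[|[|I]]] //; case=> [|[|i]] //; case=> [|[|[|j]]].
have {j3'} [k E] : exists k, j = (3 + k)%N by exists (j - 3)%N; rewrite subnKC.
rewrite {j}E -[6%N]/(3 + 3)%N ltn_add2l in ij j6' *.
case: (ltnP i 3) => [i3|i3].
  case: (boolP ((I + i + k) %% 3 != 0)%N) => [h|].
    rewrite off //; move: I i k I3 i3 j6' h {ij}.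
    by case=> [|[|[|I]]] //; case=> [|[|[|i]]] //; case=> [|[|[|j]]].
  move: I i k I3 i3 j6' {ij}.
  by case=> [|[|[|I]]] //; case=> [|[|[|i]]] //; case=> [|[|[|j]]].
have {i3} [h E] : exists h, i = (3 + h)%N by exists (i - 3)%N; rewrite subnKC.
rewrite {i}E ltn_add2l in ij *.
have [_ ->] := z I h k I3 ij j6'; move: I h k I3 ij j6'.
by case=> [|[|[|I]]] //; case=> [|[|i]] //; case=> [|[|[|j]]].
Qed.

Let S (t x y : C) : t != 0 -> t * (x - y) = 0 -> y = x.
Proof. by move=> /negPf t0 /eqP; rewrite mulf_eq0 t0 subr_eq0 => /eqP. Qed.

Lemma central_family1 (c l2 l3 : C) f : c != 0 -> l2 != 0 -> l3 != 0 ->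
  c ^+ 3 != l2 ^+ 3 -> c ^+ 3 != l3 ^+ 3 -> l2 ^+ 3 != l3 ^+ 3 ->
  (c ^+ 3 + l2 ^+ 3 + l3 ^+ 3) ^+ 3 != (3 * c * l2 * l3) ^+ 3 ->
  cross (mkW (ferm c c c l2 l3)) (mkW f) = 0 ->
  exists a b e, mkW f = mkW (ferm a a a b e).
Proof.
move=> c0 l20 l30 n2 n3 n23 d E.
have [[/(S c0) d1 /(S c0) d2] [/(S l30) d3 /(S l30) d4]
  [/(S l20) d5 /(S l20) d6]] := central_diag E.
have {}d : (c ^+ 3 + l3 ^+ 3 + l2 ^+ 3) ^+ 3 != (3 * (c * l3 * l2)) ^+ 3.
  by rewrite addrAC (mulrAC c) !mulrA.
exists (f 0%N 0%N 3%N), (f 0%N 2%N 4%N), (f 0%N 1%N 5%N).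
exact: (ferm_shape (central_xx_yy E n2 n3 n23) (central_off E d)).
Qed.

Lemma central_family2 (l2 l3 : C) f : l2 != 0 -> l3 != 0 ->
  l2 ^+ 3 != l3 ^+ 3 -> l2 ^+ 3 + l3 ^+ 3 != 0 ->
  cross (mkW (ferm 0 0 0 l2 l3)) (mkW f) = 0 ->
  exists c1 c2 c3 b e, mkW f = mkW (ferm c1 c2 c3 b e).
Proof.
move=> l20 l30 n23 d E.
have [_ [/(S l30) d3 /(S l30) d4] [/(S l20) d5 /(S l20) d6]] := central_diag E.
have n2 : 0 ^+ 3 != l2 ^+ 3 by rewrite expr0n eq_sym expf_neq0.
have n3 : 0 ^+ 3 != l3 ^+ 3 by rewrite expr0n eq_sym expf_neq0.
have {}d : (0 ^+ 3 + l3 ^+ 3 + l2 ^+ 3) ^+ 3 != (3 * (0 * l3 * l2)) ^+ 3.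
  by rewrite !mul0r mulr0 !expr0n add0r expf_neq0 // addrC.
exists (f 0%N 0%N 3%N), (f 1%N 1%N 4%N), (f 2%N 2%N 5%N), (f 0%N 2%N 4%N), (f 0%N 1%N 5%N).
exact: (ferm_shape (central_xx_yy E n2 n3 n23) (central_off E d)).
Qed.

Lemma central_family5 (l : C) f : l != 0 ->
  cross (mkW (ferm 0 0 0 (- l) l)) (mkW f) = 0 ->
  exists mu d, mkW f = mkW (fun I i j => mu * kF C I i j + efF (cub d) I i j).
Proof.
move=> l0 E; have l3 : l ^+ 3 != 0 by rewrite expf_neq0.
have nl : (- l) ^+ 3 = - l ^+ 3 by rewrite exprNn -signr_odd mulN1r.
apply: (central_sym E) => //; rewrite ?opprK ?oppr_eq0 //.
- by rewrite nl expr0n eq_sym oppr_eq0.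
- by rewrite expr0n eq_sym.
rewrite nl eq_sym -subr_eq0 opprK -mulr2n mulrn_eq0 //.
Qed.
End Centralizer.

(** * Normal forms of ternary cubics *)

Section TernaryCubics.
Variable C : numClosedFieldType.
Implicit Types (c : nat -> nat -> C) (u v w : nat -> C) (A B : nat -> nat -> C).
Local Notation co c m n := (c m%N n%N) (only parsing).

(** The polarization of the cubic with coefficients [c], taken without multinomial factors. *)
Definition tri c u v w : C :=
  let: (u0, u1, u2) := (u 0%N, u 1%N, u 2%N) in
  let: (v0, v1, v2) := (v 0%N, v 1%N, v 2%N) in
  let: (w0, w1, w2) := (w 0%N, w 1%N, w 2%N) in
  co c 0 0 * (u0 * v0 * w0) + co c 3 0 * (u1 * v1 * w1) + co c 0 3 * (u2 * v2 * w2)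
  + co c 1 0 * (u0 * v0 * w1 + u0 * v1 * w0 + u1 * v0 * w0)
  + co c 0 1 * (u0 * v0 * w2 + u0 * v2 * w0 + u2 * v0 * w0)
  + co c 2 0 * (u1 * v1 * w0 + u1 * v0 * w1 + u0 * v1 * w1)
  + co c 2 1 * (u1 * v1 * w2 + u1 * v2 * w1 + u2 * v1 * w1)
  + co c 0 2 * (u2 * v2 * w0 + u2 * v0 * w2 + u0 * v2 * w2)
  + co c 1 2 * (u2 * v2 * w1 + u2 * v1 * w2 + u1 * v2 * w2)
  + co c 1 1 * (u0 * v1 * w2 + u0 * v2 * w1 + u1 * v0 * w2 + u1 * v2 * w0
                + u2 * v0 * w1 + u2 * v1 * w0).

Definition pull c A (m n : nat) : C :=
  let t i j k := tri c (A i) (A j) (A k) in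
  match m, n with
  | 0, 0 => t 0%N 0%N 0%N | 1, 0 => t 0%N 0%N 1%N | 2, 0 => t 0%N 1%N 1%N
  | 3, 0 => t 1%N 1%N 1%N | 0, 1 => t 0%N 0%N 2%N | 1, 1 => t 0%N 1%N 2%N
  | 2, 1 => t 1%N 1%N 2%N | 0, 2 => t 0%N 2%N 2%N | 1, 2 => t 1%N 2%N 2%N
  | _, _ => t 2%N 2%N 2%N
  end.

Definition det3 A : C :=
  A 0%N 0%N * (A 1%N 1%N * A 2%N 2%N - A 1%N 2%N * A 2%N 1%N)
  - A 0%N 1%N * (A 1%N 0%N * A 2%N 2%N - A 1%N 2%N * A 2%N 0%N)
  + A 0%N 2%N * (A 1%N 0%N * A 2%N 1%N - A 1%N 1%N * A 2%N 0%N).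

Definition fshape c := [/\ co c 1 0 = 0, co c 0 1 = 0, co c 2 0 = 0
  & [/\ co c 2 1 = 0, co c 0 2 = 0 & co c 1 2 = 0]].
Definition nshape c := [/\ co c 0 1 = 0, co c 1 1 = 0, co c 0 2 = 0
  & co c 1 2 = 0 /\ co c 0 3 = 0].
Definition good c := exists2 A, det3 A != 0 & fshape (pull c A) \/ nshape (pull c A).

Definition vec (x y z : C) (k : nat) : C := match k with 0 => x | 1 => y | _ => z end.
Definition rows u v w (k : nat) : nat -> C := match k with 0 => u | 1 => v | _ => w end.
Definition comb u A (k : nat) : C := u 0%N * A 0%N k + u 1%N * A 1%N k + u 2%N * A 2%N k.
Definition del (i k : nat) : C := (eqn i k)%:R.

Lemma tri_pull c A u v w : tri (pull c A) u v w = tri c (comb u A) (comb v A) (comb w A).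
Proof. cbv [tri pull comb]; ring. Qed.

Lemma det3_comb A B : det3 (fun i => comb (B i) A) = det3 B * det3 A.
Proof. cbv [det3 comb]; ring. Qed.

Lemma good_pull c A : det3 A != 0 -> good (pull c A) -> good c.
Proof.
move=> A0 [B B0 gB]; exists (fun i => comb (B i) A); first by rewrite det3_comb mulf_neq0.
case: gB => [[]|[]]; rewrite /pull !tri_pull => h1 h2 h3 h4; [left|right]; split=> //.
Qed.

Lemma good_fshape c : fshape c -> good c.
Proof.
case=> h1 h2 h3 [h4 h5 h6]; exists (rows (vec 1 0 0) (vec 0 1 0) (vec 0 0 1)).
  by rewrite (_ : det3 _ = 1) ?oner_eq0 //; cbv [det3 rows vec]; ring.
by left; split; [| | |split]; cbv [pull tri rows vec]; rewrite ?(h1, h2, h3, h4, h5, h6); ring.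
Qed.

(** The point (1, 0, 0) is singular, with tangent cone a y^2 + 2 b y z + d z^2. A double tangent, or
    a zero cone, leads to [nshape]. Two distinct tangent directions become basis vectors, and shears
    along the singular point then lead to [fshape]. *)
Lemma singular_std c : co c 0 0 = 0 -> co c 1 0 = 0 -> co c 0 1 = 0 -> good c.
Proof.
move=> h0 h1 h2; set a := co c 2 0; set b := co c 1 1; set d := co c 0 2.
have fin x1 x2 y1 y2 : x1 * y2 - x2 * y1 != 0 ->
   a * x1 ^+ 2 + 2 * b * x1 * x2 + d * x2 ^+ 2 = 0 ->
   a * y1 ^+ 2 + 2 * b * y1 * y2 + d * y2 ^+ 2 = 0 ->
   a * x1 * y1 + b * (x1 * y2 + x2 * y1) + d * x2 * y2 != 0 -> good c.
  move=> dt ex ey m0; set m := a * x1 * y1 + _ + _ in m0.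
  pose A := rows (vec 1 0 0) (vec 0 x1 x2) (vec 0 y1 y2).
  (* Adding s times the singular point to the first tangent vector changes this value of [tri] by 2
     m s. *)
  pose s := - tri c (A 1%N) (A 1%N) (A 2%N) / (2 * m).
  pose t := - tri c (A 1%N) (A 2%N) (A 2%N) / (2 * m).
  have s0 : tri c (A 1%N) (A 1%N) (A 2%N) + 2 * m * s = 0.
    by rewrite /s mulrC divfK ?addrN // mulf_neq0 // pnatr_eq0.
  have t0 : tri c (A 1%N) (A 2%N) (A 2%N) + 2 * m * t = 0.
    by rewrite /t mulrC divfK ?addrN // mulf_neq0 // pnatr_eq0.
  exists (rows (vec 1 0 0) (vec s x1 x2) (vec t y1 y2)).
    by rewrite (_ : det3 _ = x1 * y2 - x2 * y1) //; cbv [det3 rows vec]; ring.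
  left; split; [| | |split]; rewrite -/a -/b -/d; cbv [pull].
  - by cbv [tri rows vec]; rewrite h0 h1 h2; ring.
  - by cbv [tri rows vec]; rewrite h0 h1 h2; ring.
  - by rewrite -[RHS]ex; cbv [tri rows vec]; rewrite h0 h1 h2 -/a -/b -/d; ring.
  - rewrite -[RHS]s0 -[X in _ = X]addr0 -[X in _ = _ + X](mul0r t) -ex /m /A.
    by cbv [tri rows vec]; rewrite h0 h1 h2 -/a -/b -/d; ring.
  - by rewrite -[RHS]ey; cbv [tri rows vec]; rewrite h0 h1 h2 -/a -/b -/d; ring.
  rewrite -[RHS]t0 -[X in _ = X]addr0 -[X in _ = _ + X](mul0r s) -ey /m /A.
  by cbv [tri rows vec]; rewrite h0 h1 h2 -/a -/b -/d; ring.
have two0 : (2 : C) != 0 by rewrite pnatr_eq0.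
have [e|ne] := eqVneq (b ^+ 2) (a * d).
  have [a0|a0] := eqVneq a 0.
    have b0 : b = 0 by apply/eqP; rewrite -sqrf_eq0 e a0 mul0r.
    exists (rows (vec 0 1 0) (vec 0 0 1) (vec 1 0 0)).
      by rewrite (_ : det3 _ = 1) ?oner_eq0 //; cbv [det3 rows vec]; ring.
    by right; split; [| | |split]; cbv [pull tri rows vec]; rewrite ?(h0, h1, h2) -/a -/b -/d
      ?a0 ?b0; ring.
  exists (rows (vec 0 (- b) a) (vec 0 1 0) (vec 1 0 0)).
    by rewrite (_ : det3 _ = - a) ?oppr_eq0 //; cbv [det3 rows vec]; ring.
  right; split; [| | |split].
  - rewrite -[RHS](mulr0 (- a)) -[X in _ = _ * X](subrr (b ^+ 2)) {2}e; cbv [pull tri rows vec].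
    by rewrite ?(h0, h1, h2) -/a -/b -/d; ring.
  - by cbv [pull tri rows vec]; rewrite ?(h0, h1, h2) -/a -/b -/d; ring.
  - by cbv [pull tri rows vec]; rewrite ?(h0, h1, h2) -/a -/b -/d; ring.
  - by cbv [pull tri rows vec]; rewrite ?(h0, h1, h2) -/a -/b -/d; ring.
  by cbv [pull tri rows vec]; rewrite ?(h0, h1, h2) -/a -/b -/d; ring.
have [a0|a0] := eqVneq a 0.
  have b0 : b != 0 by apply: contraNneq ne => ->; rewrite a0 mul0r expr0n.
  apply: (fin 1 0 (- d / (2 * b)) 1); rewrite ?a0.
  - by rewrite mul1r mul0r subr0 oner_eq0.
  - by ring.
  - by field.
  by move: b0; congr (_ != 0); ring.
pose s := sqrtC (b ^+ 2 - a * d).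
have s2 : s ^+ 2 = b ^+ 2 - a * d by rewrite sqrtCK.
have s0 : s != 0 by rewrite sqrtC_eq0 subr_eq0.
clearbody s.
apply: (fin ((- b + s) / a) 1 ((- b - s) / a) 1).
- by rewrite (_ : _ * 1 - _ = 2 * s / a) ?mulf_neq0 ?invr_eq0 //; field.
- transitivity ((s ^+ 2 - (b ^+ 2 - a * d)) / a); first by field.
  by rewrite s2 subrr mul0r.
- transitivity ((s ^+ 2 - (b ^+ 2 - a * d)) / a); first by field.
  by rewrite s2 subrr mul0r.
rewrite (_ : _ + d * 1 * 1 = (2 * (- s ^+ 2) + (s ^+ 2 - (b ^+ 2 - a * d))) / a); last by field.
by rewrite {2}s2 subrr addr0 mulf_neq0 ?invr_eq0 // mulf_neq0 // oppr_eq0 expf_neq0.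
Qed.

Definition nz u := exists2 k, (k < 3)%N & u k != 0.

Lemma complete u : nz u -> exists v w, det3 (rows u v w) != 0.
Proof.
case; case=> [|[|[|k]]] // _ k0.
- exists (vec 0 1 0), (vec 0 0 1); rewrite (_ : det3 _ = u 0%N) //; cbv [det3 rows vec]; ring.
- exists (vec 0 0 1), (vec 1 0 0); rewrite (_ : det3 _ = u 1%N) //; cbv [det3 rows vec]; ring.
- exists (vec 1 0 0), (vec 0 1 0); rewrite (_ : det3 _ = u 2%N) //; cbv [det3 rows vec]; ring.
Qed.

Lemma complete2 u v : nz u ->
  (exists s, forall k, (k < 3)%N -> v k = s * u k) \/ exists w, det3 (rows u v w) != 0.
Proof.
move=> nu; pose m i j := u i * v j - u j * v i.
have [m01|m01] := eqVneq (m 0%N 1%N) 0; last first.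
  by right; exists (vec 0 0 1); rewrite (_ : det3 _ = m 0%N 1%N) //; cbv [det3 rows vec m]; ring.
have [m12|m12] := eqVneq (m 1%N 2%N) 0; last first.
  by right; exists (vec 1 0 0); rewrite (_ : det3 _ = m 1%N 2%N) //; cbv [det3 rows vec m]; ring.
have [m20|m20] := eqVneq (m 2%N 0%N) 0; last first.
  by right; exists (vec 0 1 0); rewrite (_ : det3 _ = m 2%N 0%N) //; cbv [det3 rows vec m]; ring.
left; case: nu => i i3 ui; exists (v i / u i) => k k3; rewrite mulrAC; apply: (mulIf ui).
rewrite divfK // -[RHS]addr0.
have : m i k = 0.
  have N x y : m x y = 0 -> m y x = 0 by rewrite -[in X in _ -> X]oppr0 => <-; rewrite /m; ring.
  move: i i3 k k3 {ui}; case=> [|[|[|i]]] // _; case=> [|[|[|k]]] // _; rewrite ?(N _ _ m01) ?(N _ _ m12) ?(N _ _ m20) //;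
    by rewrite /m; ring.
by move<-; rewrite /m; ring.
Qed.

Lemma tri_del c u v w : tri c u v w = w 0%N * tri c u v (del 0)
  + w 1%N * tri c u v (del 1) + w 2%N * tri c u v (del 2).
Proof. cbv [tri del eqn nat_of_bool]; rewrite /=; ring. Qed.

(** [v] is in the kernel of the Hessian of the cubic at [u]; for v = u this says that the cubic is
    singular at [u]. *)
Definition kills c u v := forall w, tri c u v w = 0.

Lemma killsP c u v : (forall k, (k < 3)%N -> tri c u v (del k) = 0) -> kills c u v.
Proof. by move=> h w; rewrite tri_del !h // !mulr0 !addr0. Qed.

Lemma singular_good c u : nz u -> kills c u u -> good c.
Proof.
move=> /complete[v [w d]] k; apply: (good_pull d); apply: singular_std.
all: exact: k.
Qed.

Lemma triC c u v w : tri c u v w = tri c v u w.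
Proof. cbv [tri]; ring. Qed.
Lemma triA c u v w : tri c u v w = tri c w u v.
Proof. cbv [tri]; ring. Qed.

Lemma kills_scale c u v s : (forall k, (k < 3)%N -> v k = s * u k) -> nz v ->
  kills c u v -> kills c u u.
Proof.
move=> E [k k3 vk] h w.
have s0 : s != 0 by apply: contraNneq vk => s0; rewrite E // s0 mul0r.
apply: (mulfI s0); rewrite mulr0 -[RHS](h w).
by cbv [tri]; rewrite !E //; ring.
Qed.

(* The transform makes the XYZ-form diagonal plus a multiple of itself. *)
Lemma fourier_good c : (forall m n, (m, n) != (1, 1)%N -> c m n = 1) -> good c.
Proof.
move=> c1; have [w w2] := omega_ex C; set t := co c 1 1.
have z0 : w ^+ 2 + w + 1 = 0 by rewrite w2; ring.
have w0 : w != 0.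
  by apply: contra_eq_neq z0 => ->; rewrite expr0n !add0r oner_eq0.
have w1 : w != 1.
  by apply: contra_eq_neq z0 => ->; rewrite (_ : _ + _ = 3) ?pnatr_eq0 //; ring.
have wN : w + 1 != 0.
  apply: contra_eq_neq z0 => /eqP; rewrite addr_eq0 => /eqP ->.
  by rewrite (_ : _ + _ = 1) ?oner_eq0 //; ring.
exists (rows (vec 1 1 1) (vec 1 w (w ^+ 2)) (vec 1 (w ^+ 2) (w ^+ 4))).
  rewrite (_ : det3 _ = w * (w - 1) ^+ 3 * (w + 1)); last by cbv [det3 rows vec]; ring.
  by rewrite !mulf_neq0 ?expf_neq0 // subr_eq0.
(* Each coefficient to be killed is a multiple of w^2 + w + 1; the quotient is supplied. *)
have L (q x : C) : x = q * (w ^+ 2 + w + 1) -> x = 0 by rewrite z0 mulr0.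
left; split; [| | |split]; cbv [pull tri rows vec]; 
  rewrite !(c1 0%N 0%N isT, c1 3%N 0%N isT, c1 0%N 3%N isT, c1 1%N 0%N isT, c1 0%N 1%N isT, c1 2%N 0%N isT, c1 2%N 1%N isT, c1 0%N 2%N isT, c1 1%N 2%N isT) -/t.
- by apply: (L (7 + 2 * t)); ring.
- by apply: (L (7 + 2 * t - 7 * w - 2 * w * t + 7 * w ^+ 2 + 2 * w ^+ 2 * t)); ring.
- by apply: (L (3 + w + 2 * w * t + 3 * w ^+ 2)); ring.
- by apply: (L (1 + w + 2 * w ^+ 2 - w ^+ 3 + 2 * w ^+ 3 * t + 2 * w ^+ 4 + w ^+ 5
    + w ^+ 6)); ring.
- by apply: (L (3 - 3 * w + 4 * w ^+ 2 + 2 * w ^+ 2 * t - w ^+ 3 - 2 * w ^+ 3 * t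
    + 4 * w ^+ 4 + 2 * w ^+ 4 * t - 3 * w ^+ 5 + 3 * w ^+ 6)); ring.
- by apply: (L (1 + 2 * w ^+ 2 + w ^+ 4 + 2 * w ^+ 4 * t + 2 * w ^+ 6 + w ^+ 8)); ring.
Qed.

Lemma nz_vec x y z : [|| x != 0, y != 0 | z != 0] -> nz (vec x y z).
Proof. by case/or3P => h; [exists 0%N|exists 1%N|exists 2%N]. Qed.

(* The cubic is x^3 + 3 a x y^2 + b y^3 + 3 z^2 y = (x + M y)^3 + 3 y (z - L) (z + L)
   with M = m^2 and L = m x + n y; unless it is singular, we rescale the four
   linear forms. *)
Lemma weierstrass_good c :
  [/\ co c 0 0 = 0, co c 1 0 = 0 & co c 2 0 = 0] ->
  [/\ co c 1 1 = 0, co c 2 1 = 0 & co c 0 2 = 0] ->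
  co c 0 1 = 1 -> co c 3 0 = 1 -> good c.
Proof.
case=> h00 h10 h20 [h11 h21 h02] h01 h30; set a := co c 1 2; set b := co c 0 3.
have two0 : (2 : C) != 0 by rewrite pnatr_eq0.
have four0 : (4 : C) != 0 by rewrite pnatr_eq0.
have [[a0 b0]|ab] : a = 0 /\ b = 0 \/ (a != 0) || (b != 0).
- by case: (eqVneq a 0) => a0; case: (eqVneq b 0) => b0; [left|right|right|right].
- apply: (@singular_good _ (vec 0 0 1)); first by apply: nz_vec; rewrite oner_eq0 !orbT.
  move=> w; cbv [tri vec]; rewrite -/a -/b a0 b0 h02; ring.
(* Write the cubic as (x + M y)^3 + 3 y (z^2 - Q(x, y)). The quartic says that the discriminant of Q
   vanishes, so that Q is a square L^2; up to the sign of M it is the 3-division polynomial of the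
   curve. *)
have [M M0 EM] : exists2 M, M != 0 & M ^+ 4 + 6 * a * M ^+ 2 - 4 * b * M - 3 * a ^+ 2 = 0.
  have [a0|a0] := eqVneq a 0.
    move: ab; rewrite a0 eqxx /= => b0.
    have [r rE] : exists r : C, r ^+ 3 = 4 * b by exists (3.-root (4 * b)); rewrite rootCK.
    exists r; last by rewrite exprS rE; ring.
    by apply: contraNneq (mulf_neq0 four0 b0) => r0; rewrite -rE r0 expr0n.
  have [r] := solve_monicpoly
    (fun i => nth (0 : C) [:: 3 * a ^+ 2; 4 * b; - 6 * a; 0] i) (isT : (0 < 4)%N).
  rewrite !big_ord_recl big_ord0 /= => rE; exists r; last by rewrite rE /bump /=; ring.
  apply: contra_neq a0 => r0; move/eqP: rE; rewrite r0 expr0n /bump /= !mulr0 !addr0.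
  by rewrite !expr0n !(mulr0, addr0, add0r) mulr1 eq_sym mulf_eq0 pnatr_eq0 /= sqrf_eq0 => /eqP.
pose m := sqrtC M; have m2 : m ^+ 2 = M by rewrite sqrtCK.
have m0 : m != 0 by rewrite sqrtC_eq0.
clearbody m; subst M; clear M0.
pose n := (m ^+ 4 - a) / (2 * m).
have Ea : a = m ^+ 4 - 2 * m * n by rewrite /n; field.
have Eb : b = m ^+ 6 - 3 * n ^+ 2.
  apply: (mulfI (mulf_neq0 four0 (expf_neq0 2 m0))); rewrite -[RHS]subr0 -EM.
  by rewrite /n; field.
clearbody n; clear EM ab.
(* If n = m^3, then L = m (x + M y), and the point x = - M, y = 1, z = 0 is singular. *)
have [al|al] := eqVneq (m ^+ 3 - n) 0.
  have En : n = m ^+ 3 by apply/esym/eqP; rewrite -subr_eq0 al.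
  apply: (@singular_good _ (vec 0 (- m ^+ 2) 1)); first by apply: nz_vec; rewrite oner_eq0 !orbT.
  move=> w; cbv [tri vec]; rewrite -/a -/b h00 h10 h20 h11 h21 h02 h01 h30 Ea Eb En; ring.
(* Otherwise x + M y = (L + (m^3 - n) y) / m. The new coordinates are the multiples of y, z - L, z +
   L that add up to x + M y. *)
pose r := (m ^+ 3 - n)^-1.
apply: (@good_pull _ (rows (vec 0 (- n * r) (m * r)) (vec (- m) 1 0) (vec m 1 0))).
  rewrite (_ : det3 _ = - 2 * m ^+ 2 * r); last by cbv [det3 rows vec]; ring.
  by rewrite !mulf_neq0 ?expf_neq0 ?invr_eq0 // oppr_eq0.
apply: fourier_good; case=> [|[|[|[|i]]]]; case=> [|[|[|j]]] // _;
  cbv [pull tri rows vec]; rewrite -/a -/b h00 h10 h20 h11 h21 h02 h01 h30 Ea Eb /r;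
  by field.
Qed.

(** A flex at (1, 0, 0), the tangent being the zero locus of the third coordinate. Unless the cubic
    is singular, scalings and one shear bring it to the form of [weierstrass_good]. *)
Lemma flex_std c : co c 0 0 = 0 -> co c 1 0 = 0 -> co c 2 0 = 0 -> co c 1 1 = 0 -> good c.
Proof.
move=> h00 h10 h20 h11.
have [h01|d0] := eqVneq (co c 0 1) 0; first exact: singular_std.
have [h30|b0] := eqVneq (co c 3 0) 0.
  (* The tangent is a component of the cubic, which is singular where this line meets the residual
     conic. *)
  pose x := sqrtC (- co c 2 1 / co c 0 1).
  have x2 : x ^+ 2 * co c 0 1 + co c 2 1 = 0 by rewrite sqrtCK divfK // addNr.
  clearbody x; apply: (@singular_good _ (vec x 1 0)).
    by apply: nz_vec; rewrite oner_eq0 !orbT.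
  move=> w; rewrite -[RHS](mulr0 (w 2%N)) -[X in _ = _ * X]x2; cbv [tri vec]; rewrite h00 h10 h20 h11 h30; ring.
pose p := (sqrtC (co c 0 1))^-1; have pE : p ^+ 2 * co c 0 1 = 1.
  by rewrite exprVn sqrtCK mulVf.
have p0 : p != 0 by rewrite invr_eq0 sqrtC_eq0.
have [q qE] := cube_root b0.
have q0 : q != 0 by apply: contra_eq_neq qE => ->; rewrite expr0n mul0r eq_sym oner_eq0.
have two0 : (2 : C) != 0 by rewrite pnatr_eq0.
pose t := - co c 2 1 / co c 3 0; pose s := - co c 0 2 / (2 * co c 0 1).
have tE : co c 2 1 + t * co c 3 0 = 0 by rewrite divfK // addrN.
have sE : co c 0 2 + 2 * s * co c 0 1 = 0 by rewrite /s; field.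
clearbody p s t.
apply: (@good_pull _ (rows (vec p 0 0) (vec 0 q 0) (vec s t 1))).
  rewrite (_ : det3 _ = p * q) ?mulf_neq0 //; cbv [det3 rows vec]; ring.
apply: weierstrass_good; first split; try split; cbv [pull tri rows vec]; rewrite ?h00 ?h10 ?h20 ?h11.
- ring.
- ring.
- ring.
- ring.
- by rewrite -[RHS](mulr0 (q ^+ 2)) -[X in _ = _ * X]tE; ring.
- by rewrite -[RHS](mulr0 p) -[X in _ = _ * X]sE; ring.
- by rewrite -[RHS]pE; ring.
- by rewrite -[RHS]qE; ring.
Qed.

Lemma flex_good c u v : nz u -> nz v -> kills c u v -> tri c u u u = 0 -> good c.
Proof.
move=> nu nv k uuu; have [[s sE]|[w d]] := complete2 v nu.
  exact: singular_good nu (kills_scale sE nv k).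
apply: (good_pull d); apply: flex_std; cbv [pull rows] => //.
by rewrite triA triC k.
Qed.

(** Elimination of y gives a common point of the cubic of [hessian_std_normal] and its Hessian, in
    the chart where the last coordinate is 1. *)
Lemma curve_point (d e f : C) : d ^+ 3 != e ^+ 3 -> exists y z,
  y ^+ 3 + z ^+ 3 + 3 * d * y + 3 * e * z + f = 0 /\
  y * z * (f + d * y + e * z) - e ^+ 2 * y - d ^+ 2 * z = 0.
Proof.
move=> de; have n9 : d ^+ 3 - e ^+ 3 != 0 by rewrite subr_eq0.
(* The coefficients, up to degree 8 in z, of the resultant of the two equations with respect to y;
   its leading term is (d^3 - e^3) z^9. *)
pose n z := nth (0 : C) [:: 1 * e ^+ 6 * f ^+ 1;
    - 3 * e ^+ 4 * f ^+ 2 + 3 * e ^+ 7 - 3 * d ^+ 3 * e ^+ 4;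
    3 * e ^+ 2 * f ^+ 3 - 12 * e ^+ 5 * f ^+ 1 + 12 * d ^+ 3 * e ^+ 2 * f ^+ 1;
    - 1 * f ^+ 4 + 15 * e ^+ 3 * f ^+ 2 - 8 * e ^+ 6 - 8 * d ^+ 3 * f ^+ 2 + 24 * d ^+ 3 * e ^+ 3 - 16 * d ^+ 6;
    - 6 * e ^+ 1 * f ^+ 3 + 18 * e ^+ 4 * f ^+ 1 - 24 * d ^+ 3 * e ^+ 1 * f ^+ 1;
    - 9 * e ^+ 2 * f ^+ 2 + 6 * e ^+ 5 - 6 * d ^+ 3 * e ^+ 2;
    - 1 * f ^+ 3 - 4 * e ^+ 3 * f ^+ 1 - 4 * d ^+ 3 * f ^+ 1;
    - 3 * e ^+ 1 * f ^+ 2;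
    - 3 * e ^+ 2 * f ^+ 1] z.
have [z zE] := solve_monicpoly (fun i => - n i / (d ^+ 3 - e ^+ 3)) (isT : (0 < 9)%N).
pose P := 3 * d; pose G := z ^+ 3 + 3 * e * z + f.
pose A := d * z; pose B := z * (e * z + f) - e ^+ 2; pose D := - d ^+ 2 * z.
have N0 : A ^+ 3 * G ^+ 2 - B ^+ 3 * G + D ^+ 3 - A ^+ 2 * B * G * P + A ^+ 2 * D * P ^+ 2
    + B ^+ 2 * D * P - 2 * A * D ^+ 2 * P + 3 * A * B * D * G = 0.
  rewrite -[RHS](mulr0 (d ^+ 3 - e ^+ 3)) -[X in _ = _ * X](subrr (z ^+ 9)) {2}zE.
  by rewrite !big_ord_recl big_ord0 /bump /n /= /A /B /D /G /P; field.
have [y1 y1E] := solve_monicpoly (fun i => nth (0 : C) [:: - G; - P; 0] i) (isT : (0 < 3)%N).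
have {}y1E : y1 ^+ 3 + P * y1 + G = 0.
  by rewrite y1E !big_ord_recl big_ord0 /bump /=; ring.
have [y2 y2E] := solve_monicpoly (fun i => nth (0 : C) [:: - (P + y1 ^+ 2); - y1] i)
  (isT : (0 < 2)%N).
have {}y2E : y2 ^+ 2 + y1 * y2 + P + y1 ^+ 2 = 0.
  by rewrite y2E !big_ord_recl big_ord0 /bump /=; ring.
pose y3 := - y1 - y2; pose q y := A * y ^+ 2 + B * y + D.
have EP : P = - (y2 ^+ 2 + y1 * y2 + y1 ^+ 2).
  by apply/eqP; rewrite -addr_eq0 addrC -y2E; apply/eqP; ring.
have EG : G = y1 * y2 * (y1 + y2).
  by rewrite -[RHS]addr0 -y1E EP; ring.
(* The first equation is a monic cubic in y with roots y1, y2, y3; the product of [q] over them is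
   the resultant, zero by [N0]. *)
have : q y1 * q y2 * q y3 = 0 by rewrite -[RHS]N0 EP EG /q /y3; ring.
have fin y : y ^+ 3 + P * y + G = 0 -> q y = 0 -> exists y z,
  y ^+ 3 + z ^+ 3 + 3 * d * y + 3 * e * z + f = 0 /\
  y * z * (f + d * y + e * z) - e ^+ 2 * y - d ^+ 2 * z = 0.
  move=> c0 q0; exists y, z; split; first by rewrite -[RHS]c0 /P /G; ring.
  by rewrite -[RHS]q0 /q /A /B /D; ring.
move/eqP; rewrite !mulf_eq0 => /orP[/orP[]|] /eqP; apply: fin => //.
  by rewrite EP EG; ring.
by rewrite EP EG /y3; ring.
Qed.

Definition hess c u (i j : nat) : C := tri c u (del i) (del j).
Definition rV3 (x : 'rV[C]_3) (k : nat) : C := x 0 (j3 k).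

Lemma rV3_nz (x : 'rV[C]_3) : x != 0 -> nz (rV3 x).
Proof.
move=> x0; have [i xi] : exists i, x 0 i != 0.
  apply/existsP; apply: contraNT x0; rewrite negb_exists => /forallP h.
  apply/eqP/matrixP => i j; rewrite ord1 mxE; apply/eqP; move: (h j); by rewrite negbK.
by exists i; [exact: ltn_ord|rewrite /rV3 -ord3E].
Qed.

Lemma hess_mul c u (x : 'rV[C]_3) k : (k < 3)%N ->
  (x *m mk3 (hess c u)) 0 (j3 k) = tri c u (rV3 x) (del k).
Proof.
move=> k3; rewrite mxE big_sm3 /=; move: k k3; case=> [|[|[|k]]] // _;
  rewrite !mxE; cbv [hess tri del rV3 eqn nat_of_bool]; rewrite /=; ring.
Qed.

Lemma hess_kills c u : \det (mk3 (hess c u)) = 0 -> exists2 v, nz v & kills c u v.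
Proof.
move/eqP/det0P => [x x0 xh]; exists (rV3 x); first exact: rV3_nz.
by apply: killsP => k k3; rewrite -hess_mul // xh mxE.
Qed.

(** Along the line through the first two basis points the Hessian matrices form a pencil. An
    eigenvalue gives a degenerate member, whose kernel contains [v]. *)
Lemma hessian_point c : exists u v, [/\ nz u, nz v & kills c u v].
Proof.
have [d0|d0] := eqVneq (\det (mk3 (hess c (del 1)))) 0.
  have [v nv k] := hess_kills d0; exists (del 1), v; split=> //.
  by exists 1%N; rewrite // oner_eq0.
have unit1 : mk3 (hess c (del 1)) \in unitmx by rewrite unitmxE unitfE.
have [l /eigenvalueP[x xE x0]] :=
  eigenvalue_closed (mk3 (hess c (del 0)) *m invmx (mk3 (hess c (del 1)))) isT.
exists (vec 1 (- l) 0), (rV3 x); split.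
- by apply: nz_vec; rewrite oner_eq0.
- exact: rV3_nz.
have E : x *m mk3 (hess c (del 0)) = l *: (x *m mk3 (hess c (del 1))).
  by rewrite -[LHS](mulmxKV unit1) -(mulmxA x) xE -scalemxAl.
apply: killsP => k k3.
have : (x *m mk3 (hess c (del 0))) 0 (j3 k) - l * (x *m mk3 (hess c (del 1))) 0 (j3 k) = 0.
  by rewrite E mxE subrr.
rewrite !hess_mul // => h; rewrite -[RHS]h; move: (del k) => w.
cbv [tri vec del eqn nat_of_bool]; rewrite /=; ring.
Qed.

Lemma det_mk3 A : \det (mk3 A) = det3 A.
Proof.
rewrite (expand_det_row _ ord0) !big_ord_recl big_ord0 /cofactor.
rewrite !(expand_det_row _ ord0) !big_ord_recl !big_ord0 /cofactor !det_mx11 !mxE.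
cbv [det3]; rewrite /= /bump /= !(addn0, add0n, addn1, add1n) !(expr0, expr1, expr2); ring.
Qed.

(** The cubic is x^3 + y^3 + 3 d x z^2 + 3 e y z^2 + f z^3. If d^3 and e^3 differ, [curve_point]
    gives a flex; if they agree and are not 0, then (e, - d, 0) is one; if d = e = 0, the form is
    diagonal. *)
Lemma hessian_std_normal c : [/\ co c 1 0 = 0, co c 2 0 = 0 & co c 1 1 = 0] ->
  [/\ co c 0 1 = 0, co c 2 1 = 0, co c 0 0 = 1 & co c 3 0 = 1] -> good c.
Proof.
case=> h10 h20 h11 [h01 h21 h00 h30].
set d := co c 0 2; set e := co c 1 2; set f := co c 0 3.
have [de|de] := eqVneq (d ^+ 3) (e ^+ 3); last first.
  have [y [z [p0 q0]]] := curve_point f de.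
  have nu : nz (vec y z 1) by apply: nz_vec; rewrite oner_eq0 !orbT.
  have [|v nv k] := @hess_kills c (vec y z 1).
    rewrite det_mk3 -[RHS]q0; cbv [det3 hess tri vec del eqn nat_of_bool].
    by rewrite /= h10 h20 h11 h01 h21 h00 h30 -/d -/e -/f; ring.
  apply: (flex_good nu nv k); rewrite -[RHS]p0; cbv [tri vec].
  by rewrite h10 h20 h11 h01 h21 h00 h30 -/d -/e -/f; ring.
have [d0|d0] := eqVneq d 0.
  have e0 : e = 0 by move/eqP: de; rewrite d0 expr0n eq_sym expf_eq0 => /eqP.
  exact: good_fshape.
apply: (@flex_good _ (vec e (- d) 0) (vec 0 0 1)).
- by apply: nz_vec; rewrite oppr_eq0 d0 orbT.
- by apply: nz_vec; rewrite oner_eq0 !orbT.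
- move=> w; cbv [tri vec]; rewrite h10 h20 h11 h01 h21 h00 h30 -/d -/e -/f; ring.
rewrite -[RHS](subrr (e ^+ 3)) -{2}de; cbv [tri vec].
by rewrite h10 h20 h11 h01 h21 h00 h30 -/d -/e -/f; ring.
Qed.

Lemma hessian_std c : co c 1 0 = 0 -> co c 2 0 = 0 -> co c 1 1 = 0 -> good c.
Proof.
move=> h10 h20 h11.
have [a0|a0] := eqVneq (co c 0 0) 0; first exact: flex_std.
have [b0|b0] := eqVneq (co c 3 0) 0.
  apply: (@good_pull _ (rows (vec 0 1 0) (vec 1 0 0) (vec 0 0 1))).
    by rewrite (_ : det3 _ = -1) ?oppr_eq0 ?oner_eq0 //; cbv [det3 rows vec]; ring.
  by apply: flex_std; cbv [pull tri rows vec]; rewrite ?h10 ?h20 ?h11 ?b0; ring.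
have [p pE] := cube_root a0; have [q qE] := cube_root b0.
have p0 : p != 0 by apply: contra_eq_neq pE => ->; rewrite expr0n mul0r eq_sym oner_eq0.
have q0 : q != 0 by apply: contra_eq_neq qE => ->; rewrite expr0n mul0r eq_sym oner_eq0.
pose s := - co c 0 1 / co c 0 0; pose t := - co c 2 1 / co c 3 0.
have sE : co c 0 1 + s * co c 0 0 = 0 by rewrite divfK // addrN.
have tE : co c 2 1 + t * co c 3 0 = 0 by rewrite divfK // addrN.
clearbody s t.
apply: (@good_pull _ (rows (vec p 0 0) (vec 0 q 0) (vec s t 1))).
  rewrite (_ : det3 _ = p * q) ?mulf_neq0 //; cbv [det3 rows vec]; ring.
apply: hessian_std_normal; split; cbv [pull tri rows vec]; rewrite ?h10 ?h20 ?h11.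
- by ring.
- by ring.
- by ring.
- by rewrite -[RHS](mulr0 (p ^+ 2)) -[X in _ = _ * X]sE; ring.
- by rewrite -[RHS](mulr0 (q ^+ 2)) -[X in _ = _ * X]tE; ring.
- by rewrite -[RHS]pE; ring.
- by rewrite -[RHS]qE; ring.
Qed.

(** If the two points of [hessian_point] coincide projectively, the cubic is singular there;
    otherwise they are taken as the first two basis vectors. *)
Theorem cubic_good c : good c.
Proof.
have [u [v [nu nv k]]] := hessian_point c.
have [[s sE]|[w d]] := complete2 v nu.
  exact: singular_good nu (kills_scale sE nv k).
apply: (good_pull d); apply: hessian_std; cbv [pull rows].
- by rewrite triA triC k.
- exact: k.
- exact: k.
Qed.
End TernaryCubics.

(** * The action of GL_3 on the slice *)

Section Slice2.
Variable C : numClosedFieldType.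
Local Notation tens := (tensor_type C).

Definition actF (G H : nat -> nat -> C) (f : nat -> nat -> nat -> C) (I i j : nat) : C :=
  sm 3 (fun J => H I J * sm 6 (fun a => sm 6 (fun b => G i a * sk (f J) a b * G j b))).

Lemma actFE (G H : nat -> nat -> C) (f : nat -> nat -> nat -> C) :
  act (mk6 G) (mk3 H) (mkW f) = mkW (actF G H f).
Proof.
apply: W_eqP => [||I i j I3 ij j6']; [exact/act_W/mkW_W|exact: mkW_W|].
rewrite mkWE {1}/sk j3K // !j6K ?(ltn_trans ij) // lt_E ij actE summxE big_sm3.
apply: eq_sm => J J3; rewrite mxE [mk3 H _ _]mxE !j3K //; congr (_ * _).
rewrite conj_mxE -(pair_bigA _ (fun a b => mk6 G (j6 i) a * mk6 G (j6 j) b * mkW f (j3 J) a b)).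
rewrite big_sm6; apply: eq_sm => a a6; rewrite big_sm6; apply: eq_sm => b b6.
by rewrite !mxE mkWE !j6K ?(ltn_trans ij) // j3K // mulrAC.
Qed.

Definition blk2 (A : nat -> nat -> C) (i j : nat) : C :=
  match i, j with
  | 0, 0 | 0, 1 | 0, 2 | 1, 0 | 1, 1 | 1, 2 | 2, 0 | 2, 1 | 2, 2 => A i j
  | i'.+3, j'.+3 => A i' j'
  | _, _ => 0 end.

Definition slc (mu : C) (c : nat -> nat -> C) : tens :=
  mkW (fun I i j => mu * kF C I i j + efF (cub c) I i j).

(** GL_3 acts through the same matrix on E, F and g_{-2}; k is built from the alternating symbol and
    only picks up the determinant. *)
Lemma slc_act (A : nat -> nat -> C) mu c :
  act (mk6 (blk2 A)) (mk3 A) (slc mu c) = slc (mu * det3 A) (pull c A).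
Proof.
rewrite actFE; apply: mkW_eq; case_coords;
  cbv [actF sm sk lt_ blk2 kF ferm efF cub eqn nat_of_bool addn addn_rec Nat.add pull tri det3];
  ring.
Qed.
Lemma slc_scale (a mu : C) c : a *: slc mu c = slc (a * mu) (fun m n => a * c m n).
Proof.
rewrite -mkW_scale; apply: mkW_eq => I i j _ _ _; rewrite mulrDr mulrA; congr (_ + _).
by rewrite /efF; case: ifP => _; case: j => [|[|[|j]]]; rewrite ?mulr0.
Qed.

Lemma slc1E c : slc 1 c = kbr C + mkW (efF (cub c)).
Proof.
rewrite kbrE -[mkW (kF C)]scale1r -mkW_linear; apply: mkW_eq => I i j _ _ _.
by rewrite mul1r.
Qed.

Lemma theta_slc c : theta (slc 1 c) = 0.
Proof. by rewrite /theta -dstar_sub slc1E addrAC subrr add0r dstar_cub. Qed.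

Lemma slc_theta (p : tens) : W p -> theta p = 0 -> exists c, p = slc 1 c.
Proof.
move=> /W_mkW[f ->]; rewrite /theta -dstar_sub kbrE mkW_sub.
move/dstar0P/symT_cub => [c E]; exists c.
by rewrite slc1E kbrE -E -mkW_sub addrC subrK.
Qed.

Lemma max_transverse_act (g : 'M[C]_6) (h : 'M[C]_3) (p : tens) :
  g \in unitmx -> h \in unitmx ->
  (forall n, W n -> dstar n = 0 -> dstar (act g h n) = 0) ->
  max_transverse p -> max_transverse (act g h p).
Proof.
move=> gu hu st tr w Ww.
have [v [n [/tangent_orbitE[X [Y ->]] Wn n0 E]]] := tr _ (act_W (invmx g) (invmx h) Ww).
exists (act g h (lact X Y p)), (act g h n); split.
- by apply/tangent_orbitE; exists (g *m X *m invmx g), (h *m Y *m invmx h); rewrite lact_act.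
- exact: act_W.
- exact: st.
have := congr1 (act g h) E; rewrite act_comp !mulmxV // act1 => ->.
by rewrite -[lact X Y p]scale1r act_linear !scale1r.
Qed.

Lemma blk2_mul (A B : nat -> nat -> C) :
  mk6 (blk2 A) *m mk6 (blk2 B) = mk6 (blk2 (fun i j => sm 3 (fun k => A i k * B k j))).
Proof.
apply/matrixP => i j; rewrite mxE big_sm6 [RHS]mxE.
transitivity (sm 6 (fun k => blk2 A i k * blk2 B k j)).
  by apply: eq_sm => k k6; rewrite !mxE j6K.
move: (val i) (val j) (ltn_ord i) (ltn_ord j) => {}i {}j.
case: i => [|[|[|[|[|[|i]]]]]] //; case: j => [|[|[|[|[|[|j]]]]]] // _ _;
  cbv [blk2 sm]; ring.
Qed.

Lemma blk2_unit (A : nat -> nat -> C) : det3 A != 0 ->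
  mk6 (blk2 A) \in unitmx /\ mk3 A \in unitmx.
Proof.
move=> A0; have u3 : mk3 A \in unitmx by rewrite unitmxE det_mk3 unitfE.
split=> //; pose B i j := invmx (mk3 A) (j3 i) (j3 j).
apply: (@mulmx1_unit _ _ _ (mk6 (blk2 B)) _).1.
rewrite blk2_mul; apply/matrixP => i j; rewrite !mxE.
have E a b : (a < 3)%N -> (b < 3)%N -> sm 3 (fun k => A a k * B k b) = (eqn a b)%:R.
  move=> a3 b3; have /matrixP/(_ (j3 a) (j3 b)) := mulmxV u3.
  rewrite !mxE big_sm3 => E; transitivity ((j3 a == j3 b)%:R : C).
    by rewrite -E; apply: eq_sm => k k3; rewrite mxE !j3K.
  by rewrite -val_eqE /= !j3K.
rewrite (_ : (i == j) = eqn i j) //.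
move: (nat_of_ord i) (nat_of_ord j) (ltn_ord i) (ltn_ord j) => {}i {}j.
by case: i => [|[|[|[|[|[|i]]]]]] //; case: j => [|[|[|[|[|[|j]]]]]] // _ _;
  rewrite /blk2 ?E.
Qed.

(** Dividing by det A on g_{-2} makes the action fix k. It then preserves the slice and the kernel
    of [dstar], hence transversality. *)
Lemma slc_normal (A : nat -> nat -> C) c : det3 A != 0 -> exists g h,
  [/\ g \in unitmx, h \in unitmx,
      forall mu d, act g h (slc mu d) = slc mu (fun m n => (det3 A)^-1 * pull d A m n)
    & max_transverse (slc 1 c) -> max_transverse (act g h (slc 1 c))].
Proof.
move=> A0; have [gu hu] := blk2_unit A0.
exists (mk6 (blk2 A)), ((det3 A)^-1 *: mk3 A).
have hu' : (det3 A)^-1 *: mk3 A \in unitmx by rewrite unitmxZ // unitfE invr_eq0.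
have E mu d : act (mk6 (blk2 A)) ((det3 A)^-1 *: mk3 A) (slc mu d)
    = slc mu (fun m n => (det3 A)^-1 * pull d A m n).
  rewrite -[mk6 _]scale1r act_scalemx expr1n mul1r slc_act slc_scale mulrCA mulVf // mulr1.
  by [].
split=> //; apply: max_transverse_act => // n /W_mkW[f ->] /dstar0P/symT_cub[d ->].
have s0 e : mkW (efF (cub e)) = slc 0 e.
  by apply: mkW_eq => I i j _ _ _; rewrite mul0r add0r.
by rewrite s0 E -s0 dstar_cub.
Qed.

Lemma fshape_scale (a : C) c : fshape c -> fshape (fun m n => a * c m n).
Proof. by case=> h1 h2 h3 [h4 h5 h6]; split; [| | |split]; rewrite /= ?h1 ?h2 ?h3 ?h4 ?h5 ?h6 mulr0. Qed.

Lemma nshape_scale (a : C) c : nshape c -> nshape (fun m n => a * c m n).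
Proof. by case=> h1 h2 h3 [h4 h5]; split; [| | |split]; rewrite /= ?h1 ?h2 ?h3 ?h4 ?h5 mulr0. Qed.

Lemma U_slc (l : tens) : U l -> exists G H c,
  [/\ G \in unitmx, H \in unitmx, l = act G H (slc 1 c), max_transverse (slc 1 c)
    & fshape c \/ nshape c].
Proof.
case=> Wl [g [h [gu hu th tr]]]; have [c E] := slc_theta (act_W g h Wl) th.
have [A A0 sh] := cubic_good c; rewrite E in tr.
have [g' [h' [gu' hu' E' tr']]] := slc_normal c A0.
exists (invmx g *m invmx g'), (invmx h *m invmx h'), (fun m n => (det3 A)^-1 * pull c A m n).
split; rewrite ?unitmx_mul ?unitmx_inv ?gu ?hu //.
- by rewrite -E' -act_comp [act (invmx g') _ _]act_comp !mulVmx // act1 -E act_comp !mulVmx // act1.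
- by rewrite -E'; exact: tr'.
by case: sh => sh; [left; exact: fshape_scale|right; exact: nshape_scale].
Qed.

Lemma U_intro G H c : G \in unitmx -> H \in unitmx -> max_transverse (slc 1 c) ->
  U (act G H (slc 1 c)).
Proof.
move=> Gu Hu tr; split; first exact/act_W/mkW_W.
exists (invmx G), (invmx H); rewrite act_comp !mulVmx // act1; split=> //.
- by rewrite unitmx_inv.
- by rewrite unitmx_inv.
exact: theta_slc.
Qed.
End Slice2.

(** * Families as orbits of a Cartan element plus a commuting nilpotent *)

Section Families.
Variable C : numClosedFieldType.
Local Notation tens := (tensor_type C).

(** Counting from 0: a^1, a^3, a^5 play the role of e^1, e^2, e^3, and a^2, a^4, a^6 that of f^1,
    f^2, f^3. This turns u_1, u_2, u_3 into the three patterns of [ferm]. *)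
Definition pidx (k : nat) : nat := nth 0%N [:: 0; 2; 4; 1; 3; 5]%N k.
Definition Gof (a : 'M[C]_6) : 'M[C]_6 := mk6 (fun i k => a (j6 (pidx k)) (j6 i)).

Lemma Gof_unit a : a \in unitmx -> Gof a \in unitmx.
Proof.
move=> au; have inj : injective (fun k : 'I_6 => j6 (pidx k)).
  move=> i j; rewrite (ord6E i) (ord6E j).
  move: (nat_of_ord i) (nat_of_ord j) (ltn_ord i) (ltn_ord j) => {}i {}j.
  by case: i => [|[|[|[|[|[|i]]]]]] //; case: j => [|[|[|[|[|[|j]]]]]] // _ _ /(congr1 val).
have -> : Gof a = (perm_mx (perm inj) *m a)^T.
  by rewrite -row_permE; apply/matrixP => i k; rewrite !mxE permE -ord6E.
by rewrite unitmx_tr unitmx_mul unitmx_perm.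
Qed.

Lemma ferm_std (a : 'M[C]_6) (b : 'M[C]_3) x1 x2 x3 :
  x1 *: u1 a b + x2 *: u2 a b + x3 *: u3 a b
  = act (Gof a) b^T (mkW (ferm x1 x1 x1 x2 x3)).
Proof.
have i6 k : (k < 6)%N -> inord k = j6 k by move=> k6; apply: val_inj; rewrite /= inordK // j6K.
have i3 k : (k < 3)%N -> inord k = j3 k by move=> k3; apply: val_inj; rewrite /= inordK // j3K.
have D (s1 s2 s3 s4 s5 s6 s7 s8 s9 : 'M[C]_6) (v1 v2 v3 : 'rV[C]_3) I i j :
    (x1 *: (tensor s1 v1 + tensor s2 v2 + tensor s3 v3)
     + x2 *: (tensor s4 v1 + tensor s5 v2 + tensor s6 v3)
     + x3 *: (tensor s7 v1 + tensor s8 v2 + tensor s9 v3)) I i j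
    = x1 * (v1 0 I * s1 i j + v2 0 I * s2 i j + v3 0 I * s3 i j)
      + x2 * (v1 0 I * s4 i j + v2 0 I * s5 i j + v3 0 I * s6 i j)
      + x3 * (v1 0 I * s7 i j + v2 0 I * s8 i j + v3 0 I * s9 i j).
  by rewrite /tensor !ffunE !mxE.
apply/ffunP => I; apply/matrixP => i j.
pose A k i := a (j6 (pidx k)) i; pose B J := b (j3 J) I.
transitivity (sm 3 (fun J => B J * sm 6 (fun k => sm 6 (fun n =>
    A k i * A n j * sk (ferm x1 x1 x1 x2 x3 J) k n)))); last first.
  rewrite actE summxE big_sm3; apply: eq_sm => J J3.
  rewrite mxE [b^T _ _]mxE conj_mxE; congr (_ * _).
  rewrite -(pair_bigA _ (fun x y => Gof a i x * Gof a j y * mkW (ferm x1 x1 x1 x2 x3) (j3 J) x y)).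
  rewrite big_sm6; apply: eq_sm => k k6; rewrite big_sm6; apply: eq_sm => n n6.
  by rewrite mkWE !mxE !j6K // j3K // -!ord6E.
have r6 k : (k < 6)%N -> row (inord (pidx k)) a 0 =1 A k.
  by move=> k6 x; rewrite mxE i6 //; case: k k6 => [|[|[|[|[|[|k]]]]]].
have r3 k : (k < 3)%N -> row (inord k) b 0 I = B k by move=> k3; rewrite mxE i3.
rewrite /u1 /u2 /u3 D !wedgexE.
rewrite !(r6 0%N) // !(r6 1%N) // !(r6 2%N) // !(r6 3%N) // !(r6 4%N) // !(r6 5%N) //.
rewrite !(r3 0%N) // !(r3 1%N) // !(r3 2%N) //.
move: A B {r6 r3} => A B; cbv [sm sk lt_ ferm]; ring.
Qed.

(** The families 1, 2 and 5 differ only in the condition [S] on the three parameters. *)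
Definition stdset (a : 'M[C]_6) (b : 'M[C]_3) (S : C -> C -> C -> Prop) : set tens :=
  [set l | exists x1 x2 x3,
     l = x1 *: u1 a b + x2 *: u2 a b + x3 *: u3 a b /\ S x1 x2 x3]%classic.

Lemma star0 (g : 'M[C]_6) (h : 'M[C]_3) : star g h 0 = 0 :> tens.
Proof. by apply: linear_fun0 => c x y; exact: act_linear. Qed.

Lemma bracket_eq0 (l m : tens) : e7_bracket (e7_of l) (e7_of m) = 0 <-> cross l m = 0.
Proof.
rewrite e7_bracket_of.
have p60 : pair6 l 0 = 0 by apply: linear_fun0 => a x y; exact: pair6_linear_r.
have p30 : pair3 l 0 = 0 by apply: linear_fun0 => a x y; exact: pair3_linear_r.
by rewrite p60 p30 lact00 oppr0; split=> [[]|->].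
Qed.

Lemma family_std_elim (a : 'M[C]_6) (b : 'M[C]_3) S l : a \in unitmx -> b \in unitmx ->
  Defs.family (stdset a b S) l -> exists G H x1 x2 x3 f,
  [/\ G \in unitmx, H \in unitmx, S x1 x2 x3,
      l = act G H (mkW (ferm x1 x1 x1 x2 x3) + mkW f)
    & cross (mkW (ferm x1 x1 x1 x2 x3)) (mkW f) = 0 /\ ad_nilpotent (e7_of (mkW f))].
Proof.
move=> /Gof_unit au bu [Wl [s [n [[Ws Wn lE [_ nil /bracket_eq0 sn]] [g [h [g1 h1 [x1 [x2 [x3 [sE Sx]]]]]]]]]]].
have gu : g \in unitmx by rewrite unitmxE g1 unitr1.
have hu : h \in unitmx by rewrite unitmxE h1 unitr1.
have btu : b^T \in unitmx by rewrite unitmx_tr.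
pose G := invmx g *m Gof a; pose H := invmx h *m b^T.
have Gu : G \in unitmx by rewrite unitmx_mul unitmx_inv gu au.
have Hu : H \in unitmx by rewrite unitmx_mul unitmx_inv hu btu.
have [f fE] := W_mkW (act_W (invmx G) (invmx H) Wn).
have nE : n = act G H (mkW f) by rewrite -fE act_comp !mulmxV // act1.
have {}sE : s = act G H (mkW (ferm x1 x1 x1 x2 x3)).
  by rewrite -act_comp -ferm_std -sE act_comp !mulVmx // act1.
exists G, H, x1, x2, x3, f; split=> //.
  by rewrite -[mkW (ferm _ _ _ _ _)]scale1r act_linear scale1r -sE -nE.
split; last by rewrite -fE; apply: ad_nilpotent_act; rewrite ?unitmx_inv.
have -> : mkW (ferm x1 x1 x1 x2 x3) = act (invmx G) (invmx H) s.
  by rewrite sE act_comp !mulVmx // act1.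
by rewrite -fE cross_act ?unitmx_inv // sn star0 scaler0.
Qed.

Lemma det1_scale (n : nat) (M N : 'M[C]_n.+1) : M \in unitmx -> N \in unitmx ->
  exists2 t : C, t != 0 & \det (t *: (M *m invmx N)) = 1.
Proof.
move=> Mu Nu; have d0 : \det (M *m invmx N) != 0.
  by rewrite -unitfE -unitmxE unitmx_mul Mu unitmx_inv.
exists (n.+1.-root (\det (M *m invmx N))^-1); last by rewrite detZ rootCK // mulVf.
by rewrite rootC_eq0 // invr_eq0.
Qed.

(** [G] and [H] are any invertible matrices, whereas a family asks for determinant 1. Normalizing
    the determinants rescales the three parameters together, which [S] must allow. *)
Lemma family_std_intro (a : 'M[C]_6) (b : 'M[C]_3) S (G : 'M[C]_6) (H : 'M[C]_3) x1 x2 x3 f :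
  a \in unitmx -> b \in unitmx -> G \in unitmx -> H \in unitmx ->
  (forall t y1 y2 y3, t != 0 -> S y1 y2 y3 -> S (t * y1) (t * y2) (t * y3)) ->
  S x1 x2 x3 -> cross (mkW (ferm x1 x1 x1 x2 x3)) (mkW f) = 0 ->
  ad_nilpotent (e7_of (mkW f)) ->
  Defs.family (stdset a b S) (act G H (mkW (ferm x1 x1 x1 x2 x3) + mkW f)).
Proof.
move=> /Gof_unit au bu Gu Hu Sc Sx cr nil.
have btu : b^T \in unitmx by rewrite unitmx_tr.
split.
  by rewrite -[mkW (ferm _ _ _ _ _)]scale1r -mkW_linear; exact/act_W/mkW_W.
exists (act G H (mkW (ferm x1 x1 x1 x2 x3))), (act G H (mkW f)); split.
  split; [exact/act_W/mkW_W|exact/act_W/mkW_W| |split].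
  - by rewrite -[mkW (ferm _ _ _ _ _)]scale1r act_linear !scale1r.
  - exact/ad_semisimple_act/ad_semisimple_cartan.
  - exact: ad_nilpotent_act.
  by apply/bracket_eq0; rewrite cross_act // cr star0 scaler0.
have [t t0 tE] := det1_scale au Gu; have [r r0 rE] := det1_scale btu Hu.
exists (t *: (Gof a *m invmx G)), (r *: (b^T *m invmx H)); split=> //.
exists (t ^+ 2 * r * x1), (t ^+ 2 * r * x2), (t ^+ 2 * r * x3); split; last first.
  by apply: Sc; rewrite ?mulf_neq0 ?expf_neq0.
rewrite act_scalemx -act_comp [act (invmx G) _ _]act_comp !mulVmx // act1 -ferm_std.
by move: (u1 a b) (u2 a b) (u3 a b) => v1 v2 v3; rewrite !scalerDr !scalerA.
Qed.
End Families.

(** * Tensors of the slice in normal form *)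

Section Normal.
Variable C : numClosedFieldType.
Local Notation tens := (tensor_type C).

Lemma fshape_slc mu (c : nat -> nat -> C) : fshape c -> slc mu c =
  mkW (ferm (c 0%N 0%N) (c 3%N 0%N) (c 0%N 3%N) (c 1%N 1%N - 2 * mu) (c 1%N 1%N + 2 * mu)).
Proof.
case=> h1 h2 h3 [h4 h5 h6]; apply: mkW_eq; case_coords;
  cbv [kF ferm efF cub lt_ eqn nat_of_bool addn addn_rec Nat.add]; rewrite ?h1 ?h2 ?h3 ?h4 ?h5 ?h6; ring.
Qed.

Lemma slc_fshape (c1 c2 c3 l2 : C) : exists2 c, fshape c &
  slc 1 c = mkW (ferm c1 c2 c3 l2 (l2 + 4)).
Proof.
pose c m n : C := match m, n with
  | 0, 0 => c1 | 3, 0 => c2 | 0, 3 => c3 | 1, 1 => l2 + 2 | _, _ => 0 end.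
have fc : fshape c by [].
exists c => //; rewrite fshape_slc //=; congr (mkW (ferm _ _ _ _ _)); ring.
Qed.

Lemma nshape_slc (c : nat -> nat -> C) : nshape c -> exists a r0 r1 r2 r3,
  forall mu, slc mu c = slc mu (n3c a r0 r1 r2 r3).
Proof.
case=> h1 h2 h3 [h4 h5].
exists (c 2%N 1%N), (c 0%N 0%N), (c 1%N 0%N), (c 2%N 0%N), (c 3%N 0%N) => nu.
apply: mkW_eq; case_coords;
  cbv [kF ferm efF cub n3c lt_ eqn nat_of_bool addn addn_rec Nat.add]; by rewrite ?h1 ?h2 ?h3 ?h4 ?h5.
Qed.

Lemma mkW0 (f : nat -> nat -> nat -> C) :
  (forall I i j, (I < 3)%N -> (i < j)%N -> (j < 6)%N -> f I i j = 0) -> mkW f = 0.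
Proof.
move=> f0; rewrite -[RHS](scale0r (mkW f)) -mkW_scale.
by apply: mkW_eq => I i j *; rewrite mul0r f0.
Qed.

Lemma cross_kF (c : nat -> nat -> C) : cross (mkW (ferm 0 0 0 (-2) 2)) (slc 0 c) = 0.
Proof.
rewrite crossE; apply: mkW0; case_coords;
  cbv [crossF wedgeF wedge4 kF ferm efF cub sk lt_ eqn nat_of_bool addn addn_rec Nat.add]; ring.
Qed.

Lemma cross_ferm (c1 c2 c3 l2 l3 : C) :
  cross (mkW (ferm 0 0 0 l2 l3)) (mkW (ferm c1 c2 c3 0 0)) = 0.
Proof.
rewrite crossE; apply: mkW0; case_coords; cbv [crossF wedgeF wedge4 ferm]; ring.
Qed.

Lemma slc0_add (c : nat -> nat -> C) :
  slc 1 c = mkW (ferm 0 0 0 (-2) 2) + slc 0 c.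
Proof.
rewrite -[mkW (ferm _ _ _ _ _)]scale1r -mkW_linear; apply: mkW_eq => I i j _ _ _.
by rewrite /kF; ring.
Qed.

Lemma ferm_add (c1 c2 c3 l2 l3 : C) :
  mkW (ferm c1 c2 c3 l2 l3) = mkW (ferm 0 0 0 l2 l3) + mkW (ferm c1 c2 c3 0 0).
Proof.
rewrite -[mkW (ferm 0 _ _ _ _)]scale1r -mkW_linear.
apply: mkW_eq; case_coords; rewrite /=; ring.
Qed.

Lemma max_transverse_scale (t : C) (p : tens) : t != 0 ->
  max_transverse p -> max_transverse (t *: p).
Proof.
move=> t0 tr; have -> : t *: p = act 1%:M (t *: 1%:M) p.
  by rewrite -[X in act X]scale1r act_scalemx expr1n mul1r act1.
apply: max_transverse_act => //; rewrite ?unitmx1 ?unitmxZ ?unitmx1 ?unitfE //.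
move=> n /W_mkW[f ->] /dstar0P/symT_cub[d ->].
rewrite -[X in act X]scale1r act_scalemx expr1n mul1r act1.
have s0 e : mkW (efF (cub e)) = slc 0 e.
  by apply: mkW_eq => I i j _ _ _; rewrite mul0r add0r.
by rewrite s0 slc_scale mulr0 -s0 dstar_cub.
Qed.

(* Both sides are the product of the nine linear forms m + w^i x + w^j y. *)
Lemma nine_lines (w m x y : C) : w ^+ 2 = - 1 - w ->
  (m ^+ 3 + (x + y) ^+ 3) * (m ^+ 3 + (y * w + x * w ^+ 2) ^+ 3)
    * (m ^+ 3 + (y * w ^+ 2 + x * w) ^+ 3)
  = (m ^+ 3 + x ^+ 3 + y ^+ 3) ^+ 3 - (3 * m * x * y) ^+ 3.
Proof.
move=> w2; have := cube_w x y w2; have := cube_w y x w2.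
rewrite [X in X ^+ 3 = _ -> _]addrC => -> ->.
set a := m ^+ 3 + x ^+ 3 + y ^+ 3; pose t := 3 * x * y.
(* The two sides differ by a multiple of w^2 + w + 1; the factor inserted here is the quotient. *)
rewrite -[RHS]addr0 -(mulr0 ((a + t * (x + y)) * t ^+ 2 * (2 * x * y - x ^+ 2 - y ^+ 2))).
have -> : 0 = w ^+ 2 + w + 1 by rewrite w2; ring.
by rewrite /a /t; ring.
Qed.

Definition S1 (x1 x2 x3 : C) :=
  [/\ [/\ x1 != 0, x2 != 0 & x3 != 0],
      [/\ x1 ^+ 3 != x2 ^+ 3, x1 ^+ 3 != x3 ^+ 3 & x2 ^+ 3 != x3 ^+ 3]
    & (x1 ^+ 3 + x2 ^+ 3 + x3 ^+ 3) ^+ 3 - (3 * x1 * x2 * x3) ^+ 3 != 0].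
Definition S2 (x1 x2 x3 : C) := [/\ x1 = 0, x2 != 0, x3 != 0
  & (x2 ^+ 3 + x3 ^+ 3 != 0) && (x2 ^+ 3 - x3 ^+ 3 != 0)].
Definition S5 (x1 x2 x3 : C) := [/\ x1 = 0, x2 = - x3 & x3 != 0].

Lemma family1E (a : 'M[C]_6) (b : 'M[C]_3) : family1 a b = Defs.family (stdset a b S1).
Proof.
congr Defs.family; apply/seteqP; split=> l /= [x1 [x2 [x3]]].
  by case=> lE h1 h2 h3; exists x1, x2, x3; split.
by case=> lE [h1 h2 h3]; exists x1, x2, x3; split.
Qed.

Lemma family2E (a : 'M[C]_6) (b : 'M[C]_3) : family2 a b = Defs.family (stdset a b S2).
Proof.
congr Defs.family; apply/seteqP; split=> l /=.
  case=> x [y [lE x0 y0 h]]; exists 0, x, y; split; last by split.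
  by move: lE; move: (u1 a b) (u2 a b) (u3 a b) => v1 v2 v3 ->; rewrite scale0r add0r.
case=> x1 [x [y [lE [x10 x0 y0 h]]]]; exists x, y; split=> //.
by move: lE; move: (u1 a b) (u2 a b) (u3 a b) => v1 v2 v3 ->; rewrite x10 scale0r add0r.
Qed.

Lemma family5E (a : 'M[C]_6) (b : 'M[C]_3) : family5 a b = Defs.family (stdset a b S5).
Proof.
congr Defs.family; apply/seteqP; split=> l /=.
  case=> x [lE x0]; exists 0, (- x), x; split; last by split.
  move: lE; move: (u1 a b) (u2 a b) (u3 a b) => v1 v2 v3 ->.
  by rewrite scale0r add0r scalerBr scaleNr addrC.
case=> x1 [x2 [x [lE [x10 x20 x0]]]]; exists x; split=> //.
move: lE; move: (u1 a b) (u2 a b) (u3 a b) => v1 v2 v3 ->.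
by rewrite x10 x20 scale0r add0r scalerBr scaleNr addrC.
Qed.
End Normal.

(** * The two inclusions *)

Section Main.
Variable C : numClosedFieldType.

Local Notation tens := (tensor_type C).
Variables (a : 'M[C]_6) (b : 'M[C]_3).
Hypotheses (au : a \in unitmx) (bu : b \in unitmx).

Let union (l : tens) := [\/ Defs.family (stdset a b (@S1 C)) l,
  Defs.family (stdset a b (@S2 C)) l | Defs.family (stdset a b (@S5 C)) l].

Let scale1 (t y1 y2 y3 : C) : t != 0 -> S1 y1 y2 y3 -> S1 (t * y1) (t * y2) (t * y3).
Proof.
move=> t0 [[h1 h2 h3] [h4 h5 h6] h7]; have t3 : t ^+ 3 != 0 by rewrite expf_neq0.
split; first by rewrite !mulf_neq0.
  by rewrite !exprMn !(inj_eq (mulfI t3)).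
rewrite (_ : _ - _ = (t ^+ 3) ^+ 3 * ((y1 ^+ 3 + y2 ^+ 3 + y3 ^+ 3) ^+ 3 - (3 * y1 * y2 * y3) ^+ 3)).
  by rewrite mulf_neq0 // expf_neq0.
by ring.
Qed.

Let scale2 (t y1 y2 y3 : C) : t != 0 -> S2 y1 y2 y3 -> S2 (t * y1) (t * y2) (t * y3).
Proof.
move=> t0 [-> h1 h2 /andP[h3 h4]]; have t3 : t ^+ 3 != 0 by rewrite expf_neq0.
by split; rewrite ?mulr0 ?mulf_neq0 // !exprMn -mulrDr -mulrBr !mulf_neq0.
Qed.

Let scale5 (t y1 y2 y3 : C) : t != 0 -> S5 y1 y2 y3 -> S5 (t * y1) (t * y2) (t * y3).
Proof. by move=> t0 [-> -> h]; split; rewrite ?mulr0 ?mulrN ?mulf_neq0. Qed.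

Let f0 : mkW (ferm (0 : C) 0 0 0 0) = 0.
Proof.
apply: mkW0; case=> [|[|[|I]]] //; case=> [|[|[|[|[|i]]]]] //;
  by case=> [|[|[|[|[|[|j]]]]]].
Qed.

Lemma union_nshape G H (c : nat -> nat -> C) : G \in unitmx -> H \in unitmx ->
  nshape c -> union (act G H (slc 1 c)).
Proof.
move=> Gu Hu /nshape_slc[x [r0 [r1 [r2 [r3 E]]]]]; apply: Or33; rewrite slc0_add E.
have s0 e : slc 0 e = mkW (efF (cub e)) :> tens.
  by apply: mkW_eq => I i j _ _ _; rewrite mul0r add0r.
have cr := cross_kF (n3c x r0 r1 r2 r3); rewrite s0 in cr *.
apply: family_std_intro => //; last exact: ad_nilpotent_n3.
by split=> //; rewrite pnatr_eq0.
Qed.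

Lemma union_fermat0 G H (c : nat -> nat -> C) : G \in unitmx -> H \in unitmx ->
  fshape c -> max_transverse (slc 1 c) ->
  c 0%N 0%N * c 3%N 0%N * c 0%N 3%N = 0 -> union (act G H (slc 1 c)).
Proof.
move=> Gu Hu fc; rewrite fshape_slc // mulr1 => tr abc.
have nil := ad_nilpotent_ferm abc.
have [w w2] := omega_ex C.
have [l20 l30 n23 _ [ne1 ne2]] := trans_ferm_nec w2 tr; rewrite ferm_add.
have [d0|d0] := eqVneq (c 1%N 1%N) 0.
  apply: Or33; rewrite d0 sub0r add0r.
  apply: family_std_intro => //; last exact: cross_ferm.
  by split=> //; rewrite pnatr_eq0.
apply: Or32; apply: family_std_intro => //; last exact: cross_ferm.
split=> //; rewrite subr_eq0 n23 andbT.
rewrite abc !add0r in ne1 ne2.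
set x := _ - 2 in ne1 ne2 *; set y := _ + 2 in ne1 ne2 *.
have xy : x + y != 0.
  by rewrite (_ : x + y = 2 * c 1%N 1%N) ?mulf_neq0 ?pnatr_eq0 //; rewrite /x /y; ring.
(* By [nine_lines] at m = 0 this product is (x^3 + y^3)^3. *)
have : ((x + y) ^+ 3) * (y * w + x * w ^+ 2) ^+ 3 * (y * w ^+ 2 + x * w) ^+ 3 != 0.
  by rewrite mulf_neq0 // mulf_neq0 // expf_neq0.
have := nine_lines 0 x y w2; rewrite !expr0n !add0r => ->.
by rewrite mulr0 !mul0r expr0n subr0 expf_eq0.
Qed.

Let reduce G H (c : nat -> nat -> C) A : G \in unitmx -> H \in unitmx ->
  max_transverse (slc 1 c) -> det3 A != 0 -> exists G' H' c',
  [/\ G' \in unitmx, H' \in unitmx,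
      act G H (slc 1 c) = act G' H' (slc 1 c'), max_transverse (slc 1 c')
    & forall m n, c' m n = (det3 A)^-1 * pull c A m n].
Proof.
move=> Gu Hu tr A0; have [g [h [gu hu E tr']]] := slc_normal c A0.
exists (G *m invmx g), (H *m invmx h), (fun m n => (det3 A)^-1 * pull c A m n).
split; rewrite ?unitmx_mul ?unitmx_inv ?Gu ?Hu //.
  by rewrite -E act_comp -!mulmxA !mulVmx // !mulmx1.
by rewrite -E; exact: tr'.
Qed.

(** A diagonal matrix of determinant 1 keeps the coefficient of x y z. Two of its entries are cube
    roots that turn two coefficients into [m]; the value of m^3 then turns the third into [m] as
    well. *)
Let fermat_diag G H (c : nat -> nat -> C) m : G \in unitmx -> H \in unitmx ->
  fshape c -> max_transverse (slc 1 c) -> m != 0 ->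
  m ^+ 3 = c 0%N 0%N * c 3%N 0%N * c 0%N 3%N -> exists G' H' c',
  [/\ [/\ G' \in unitmx, H' \in unitmx & act G H (slc 1 c) = act G' H' (slc 1 c')],
      max_transverse (slc 1 c'), fshape c', c' 1%N 1%N = c 1%N 1%N
    & [/\ c' 0%N 0%N = m, c' 3%N 0%N = m & c' 0%N 3%N = m]].
Proof.
move=> Gu Hu fc tr m0 m3.
have abc : c 0%N 0%N * c 3%N 0%N * c 0%N 3%N != 0 by rewrite -m3 expf_neq0.
have := abc; rewrite !mulf_eq0 !negb_or => /andP[/andP[a0 b0] g0].
set al := c 0%N 0%N in m3 a0 *; set be := c 3%N 0%N in m3 b0 *.
set ga := c 0%N 3%N in m3 g0 *.
have [h1 h2 h3 [h4 h5 h6]] := fc.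
pose s1 := 3.-root (m / al); pose s2 := 3.-root (m / be); pose s3 := (s1 * s2)^-1.
have e1 : s1 ^+ 3 = m / al by rewrite rootCK.
have e2 : s2 ^+ 3 = m / be by rewrite rootCK.
have s10 : s1 != 0 by rewrite rootC_eq0 // mulf_neq0 ?invr_eq0.
have s20 : s2 != 0 by rewrite rootC_eq0 // mulf_neq0 ?invr_eq0.
have s123 : s1 * s2 * s3 = 1 by rewrite mulfV // mulf_neq0.
have e3 : s3 ^+ 3 * ga = m.
  rewrite exprVn exprMn e1 e2; apply: (mulfI (expf_neq0 2 m0)).
  by rewrite -exprSr m3; field; rewrite a0 b0 m0.
have {}e1 : s1 ^+ 3 * al = m by rewrite e1 divfK.
have {}e2 : s2 ^+ 3 * be = m by rewrite e2 divfK.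
clearbody s1 s2 s3.
pose A := rows (vec s1 0 0) (vec 0 s2 0) (vec 0 0 s3).
have dA : det3 A = 1 by rewrite -[RHS]s123; cbv [det3 A rows vec]; ring.
have A0 : det3 A != 0 by rewrite dA oner_eq0.
have [G' [H' [c' [Gu' Hu' E tr' cE]]]] := reduce Gu Hu tr A0.
have {}cE i j : c' i j = pull c A i j by rewrite cE dA invr1 mul1r.
exists G', H', c'; split=> //.
- split; [| | |split]; rewrite cE; cbv [pull tri A rows vec];
    rewrite ?h1 ?h2 ?h3 ?h4 ?h5 ?h6; ring.
- rewrite cE -[RHS]mulr1 -[X in _ = _ * X]s123; cbv [pull tri A rows vec].
  by rewrite ?h1 ?h2 ?h3 ?h4 ?h5 ?h6; ring.
split; rewrite cE.
- by rewrite -[RHS]e1; cbv [pull tri A rows vec]; rewrite -/al; ring.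
- by rewrite -[RHS]e2; cbv [pull tri A rows vec]; rewrite -/be; ring.
- by rewrite -[RHS]e3; cbv [pull tri A rows vec]; rewrite -/ga; ring.
Qed.

Lemma union_fermat G H (c : nat -> nat -> C) : G \in unitmx -> H \in unitmx ->
  fshape c -> max_transverse (slc 1 c) -> union (act G H (slc 1 c)).
Proof.
move=> Gu Hu fc tr.
have [|abc] := eqVneq (c 0%N 0%N * c 3%N 0%N * c 0%N 3%N) 0; first exact: union_fermat0.
set de := c 1%N 1%N; have [w w2] := omega_ex C.
have z0 : w ^+ 2 + w + 1 = 0 by rewrite w2; ring.
(* As l2 + l3 = 2 de, this quantity is m^3 + (l2 + l3)^3. *)
have [sing|nsing] := eqVneq (c 0%N 0%N * c 3%N 0%N * c 0%N 3%N + 8 * de ^+ 3) 0.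
  (* The cubic is a triangle: its three lines are taken as coordinates. *)
  have m3 : (- 2 * de) ^+ 3 = c 0%N 0%N * c 3%N 0%N * c 0%N 3%N.
    by apply/eqP; rewrite eq_sym -subr_eq0 -[X in _ == X]sing; apply/eqP; ring.
  have m0 : - 2 * de != 0 by apply: contraNneq abc => m0; rewrite -m3 m0 expr0n.
  have [G1 [H1 [c1 [[Gu1 Hu1 ->] tr1 [h1 h2 h3 [h4 h5 h6]] d4 [d1 d2 d3]]]]] :=
    fermat_diag Gu Hu fc tr m0 m3.
  (* With m = - 2 de the cubic is m (x^3 + y^3 + z^3 - 3 x y z), and this Fourier matrix turns it
     into a multiple of x y z. *)
  pose A := rows (vec 1 1 1) (vec 1 (w ^+ 2) w) (vec 1 w (w ^+ 2)).
  have A0 : det3 A != 0.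
    rewrite (_ : det3 A = 3 * (2 * w + 1)) ?mulf_neq0 ?pnatr_eq0 ?omega_neq //.
    rewrite -[RHS]addr0 -[X in _ = _ + X](mulr0 (w ^+ 2 - w - 3)).
    by rewrite -[X in _ = _ + _ * X]z0; cbv [det3 A rows vec]; ring.
  have [G2 [H2 [c2 [Gu2 Hu2 -> tr2 cE]]]] := reduce Gu1 Hu1 tr1 A0.
  have P0 (q x : C) : x = de * q * (w ^+ 2 + w + 1) -> (det3 A)^-1 * x = 0.
    by move=> ->; rewrite z0 !mulr0.
  apply: union_fermat0 => //.
    split; [| | |split]; rewrite cE; cbv [pull tri];
      [apply: (P0 0)|apply: (P0 0)|apply: (P0 (- 2 + 4 * w - 2 * w ^+ 2))
      |apply: (P0 (- 2 + 2 * w + 2 * w ^+ 2 - 2 * w ^+ 3))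
      |apply: (P0 (- 2 + 4 * w - 2 * w ^+ 2))
      |apply: (P0 (- 2 + 2 * w + 2 * w ^+ 2 - 2 * w ^+ 3))];
      rewrite h1 h2 h3 h4 h5 h6 d1 d2 d3 d4 -/de; cbv [A rows vec]; ring.
  rewrite (_ : c2 0%N 0%N = 0) ?mul0r // cE; apply: (P0 0); cbv [pull tri].
  by rewrite h1 h2 h3 h4 h5 h6 d1 d2 d3 d4 -/de; cbv [A rows vec]; ring.
pose m := 3.-root (c 0%N 0%N * c 3%N 0%N * c 0%N 3%N).
have m3 : m ^+ 3 = c 0%N 0%N * c 3%N 0%N * c 0%N 3%N by rewrite rootCK.
have m0 : m != 0 by apply: contraNneq abc => m0; rewrite -m3 m0 expr0n.
have [G1 [H1 [c1 [[Gu1 Hu1 ->] tr1 fc1 d4 [d1 d2 d3]]]]] := fermat_diag Gu Hu fc tr m0 m3.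
move: tr1; rewrite fshape_slc // d1 d2 d3 d4 -/de mulr1 => tr1.
have [l20 l30 n23 [n2 n3] [ne1 ne2]] := trans_ferm_nec w2 tr1.
have mm : m * m * m = m ^+ 3 by ring.
apply: Or31; rewrite -[mkW _]addr0 -f0.
apply: family_std_intro => //.
- split=> //; first by split=> //; rewrite -mm.
  rewrite -(nine_lines _ _ _ w2) -mm !mulf_neq0 // mm m3.
  by move: nsing; congr (_ + _ != 0); ring.
- rewrite f0; apply: linear_fun0 => x y z; exact: cross_linear_r.
by apply: ad_nilpotent_ferm; rewrite !mul0r.
Qed.

Lemma U_union l : U l -> union l.
Proof.
case/U_slc => G [H [c [Gu Hu -> tr [fc|nc]]]]; first exact: union_fermat.
exact: union_nshape.
Qed.
(** On the slice l3 - l2 = 4; a scalar, absorbed in [H], brings any nonzero difference to this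
    value. *)
Lemma U_ferm G H (c1 c2 c3 l2 l3 : C) : G \in unitmx -> H \in unitmx -> l2 != l3 ->
  max_transverse (mkW (ferm c1 c2 c3 l2 l3)) -> U (act G H (mkW (ferm c1 c2 c3 l2 l3))).
Proof.
move=> Gu Hu n23 tr; have d0 : l3 - l2 != 0 by rewrite subr_eq0 eq_sym.
pose t := 4 / (l3 - l2); have t0 : t != 0 by rewrite mulf_neq0 ?invr_eq0 ?pnatr_eq0.
have tE : t *: mkW (ferm c1 c2 c3 l2 l3)
    = mkW (ferm (t * c1) (t * c2) (t * c3) (t * l2) (t * l2 + 4)).
  have -> : t * l2 + 4 = t * l3 by rewrite /t; field.
  rewrite -mkW_scale; apply: mkW_eq; case_coords; rewrite /= ?mulr0 //.
have [c fc cE] := slc_fshape (t * c1) (t * c2) (t * c3) (t * l2).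
have -> : act G H (mkW (ferm c1 c2 c3 l2 l3)) = act G (t^-1 *: H) (slc 1 c).
  by rewrite cE -tE -[G in RHS]scale1r act_scalemx expr1n mul1r act_scale scalerA mulVf ?scale1r.
apply: U_intro => //; first by rewrite unitmxZ // unitfE invr_eq0.
by rewrite cE -tE; exact: max_transverse_scale.
Qed.

Lemma U_family1 l : Defs.family (stdset a b (@S1 C)) l -> U l.
Proof.
case/family_std_elim => // G [H [x1 [x2 [x3 [f [Gu Hu [[h1 h2 h3] [h4 h5 h6] h7] -> [cr nil]]]]]]].
rewrite subr_eq0 in h7.
have [x [y [z E]]] := central_family1 h1 h2 h3 h4 h5 h6 h7 cr.
(* A nilpotent element of the Cartan subspace is zero. *)
move: nil; rewrite E => /nilpotent_ferm[-> ->] /eqP.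
rewrite !mulf_eq0 !orbb => /eqP ->; rewrite f0 addr0.
apply: U_ferm => //; first by apply: contraNneq h6 => ->.
have [w w2] := omega_ex C; have mm : x1 * x1 * x1 = x1 ^+ 3 by ring.
move: h7; rewrite -subr_eq0 -(nine_lines _ _ _ w2) !mulf_eq0 !negb_or => /andP[/andP[_ n1] n2].
by apply: (trans_ferm w2); rewrite ?mm.
Qed.

Lemma U_family2 l : Defs.family (stdset a b (@S2 C)) l -> U l.
Proof.
case/family_std_elim => // G [H [x1 [x2 [x3 [f [Gu Hu [-> h1 h2 /andP[h3 h4]] -> [cr nil]]]]]]].
rewrite subr_eq0 in h4.
have [c1 [c2 [c3 [y [z E]]]]] := central_family2 h1 h2 h4 h3 cr.
move: nil; rewrite E => /nilpotent_ferm[-> -> c0]; rewrite -ferm_add.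
apply: U_ferm => //; first by apply: contraNneq h4 => ->.
have [w w2] := omega_ex C.
have : (0 ^+ 3 + x2 ^+ 3 + x3 ^+ 3) ^+ 3 - (3 * 0 * x2 * x3) ^+ 3 != 0.
  by rewrite mulr0 !mul0r !expr0n subr0 add0r expf_neq0.
rewrite -(nine_lines _ _ _ w2) !mulf_eq0 !negb_or expr0n => /andP[/andP[_ n1] n2].
by apply: (trans_ferm w2); rewrite ?c0 // eq_sym expf_neq0.
Qed.

Lemma U_family5 l : Defs.family (stdset a b (@S5 C)) l -> U l.
Proof.
case/family_std_elim => // G [H [x1 [x2 [x [f [Gu Hu [-> -> x0] -> [cr nil]]]]]]].
have [mu [d E]] := central_family5 x0 cr; rewrite E in nil *.
(* Nilpotency excludes a multiple of k, so only a cubic form is left. *)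
have {nil} [mu0 nil] := (nilpotent_slice nil, nil); rewrite mu0 in nil *.
pose t := 2 / x; have t0 : t != 0 by rewrite mulf_neq0 ?invr_eq0 ?pnatr_eq0.
pose c m n := t * d m n.
have -> : mkW (ferm 0 0 0 (- x) x) + slc 0 d = t^-1 *: slc 1 c.
  rewrite slc0_add; have -> : slc 0 c = t *: slc 0 d by rewrite slc_scale mulr0.
  have -> : mkW (ferm 0 0 0 (- 2) 2) = t *: mkW (ferm 0 0 0 (- x) x).
    rewrite -mkW_scale; apply: mkW_eq; case_coords; rewrite /= ?mulr0 // /t; by field.
  by rewrite -scalerDr scalerA mulVf // scale1r.
have {}nil : ad_nilpotent (e7_of (slc 0 c)).
  have -> : slc 0 c = t *: slc 0 d by rewrite slc_scale mulr0.
  exact: ad_nilpotent_scale.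
have [A A0 sh] := cubic_good c.
have [g [h [gu hu act_gh _]]] := slc_normal c A0.
pose c' m n := (det3 A)^-1 * pull c A m n.
have {}nil : ad_nilpotent (e7_of (slc 0 c')) by rewrite -act_gh; exact: ad_nilpotent_act.
have -> : act G H (t^-1 *: slc 1 c) = act (G *m invmx g) (t^-1 *: (H *m invmx h)) (slc 1 c').
  rewrite -act_gh -[X in act X (_ *: _)]scale1r act_scalemx expr1n mul1r act_scale.
  by rewrite act_comp -!mulmxA !mulVmx // !mulmx1.
apply: U_intro; rewrite ?unitmxZ ?unitmx_mul ?unitmx_inv ?Gu ?Hu ?gu ?hu ?unitfE ?invr_eq0 //.
(* In the first shape, nilpotency annihilates the coefficient of x y z and the product of the other
   three, which is the situation of [trans_k]; the second shape is that of [trans_n3]. *)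
case: sh => [/(fshape_scale (det3 A)^-1) fc|/(nshape_scale (det3 A)^-1)/nshape_slc].
  move: nil; rewrite -/c' in fc; rewrite !fshape_slc // mulr0 addr0 subr0 mulr1.
  case/nilpotent_ferm => -> _ c0; rewrite !add0r.
  exact: trans_k.
case=> y [r0 [r1 [r2 [r3 ->]]]].
rewrite (_ : slc _ _ = mkW (fun I i j => kF C I i j + efF (cub (n3c y r0 r1 r2 r3)) I i j)).
  exact: trans_n3.
by apply: mkW_eq => I i j _ _ _; rewrite mul1r.
Qed.

End Main.
Theorem theorem4p1 (R : realType) (a : 'M[R[i]]_6) (b : 'M[R[i]]_3)
    (ha : a \in unitmx) (hb : b \in unitmx) :
  (@U R[i] = family1 a b `|` family2 a b `|` family5 a b)%classic.
Proof.
apply/seteqP; split=> l; rewrite family1E family2E family5E.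
  case/(U_union ha hb) => h; [by left; left|by left; right|by right].
case=> [[]|] h; [exact: (U_family1 ha hb)|exact: (U_family2 ha hb)|exact: (U_family5 ha hb)].
Qed.
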